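(* Let $k\ge 3$. Then $Z_k$ produces rebel instantons for any holomorphic Poisson structure $\sigma$ on $Z_k$; that is, for every $\sigma\in H^0(Z_k,\Lambda^2\mathcal T_{Z_k})$ there exist a charge $j$ and a classical instanton $P\in\mathbb{MI}_j(Z_k)$ such that the stalk at $P$ of the quantizing sheaf $\mathcal Q^\sigma$ is nontrivial, i.e. the fibre over $P$ of the classical limit map $\mathbb{QI}^{(1)}_j(\mathcal Z_k(\sigma))\to\mathbb{MI}_j(Z_k)$ is positive-dimensional.
   Context: **Surface.** $Z_k=\mathrm{Tot}(\mathcal O_{\mathbb P^1}(-k))$ is covered by $U=\mathbb C^2_{(z,u)}$ and $V=\mathbb C^2_{(\xi,v)}$, glued on $U\cap V=\mathbb C^*\times\mathbb C$ by $(\xi,v)=(z^{-1},z^ku)$. The zero section is $\ell=\{u=0\}\cup\{v=0\}$. A holomorphic Poisson structure is $\sigma\in H^0(Z_k,\Lambda^2\mathcal T_{Z_k})$, written $\sigma_U\,\partial_z\wedge\partial_u$ on $U$, with $\{f,g\}=\sigma_U(\partial_zf\,\partial_ug-\partial_uf\,\partial_zg)$ on $U$. **Quantization.** $\mathcal Z_k(\sigma)=(Z_k,\mathcal A)$ with $\mathcal A=(\mathcal O_{Z_k}[[\hbar]],\star)$, $\star$ associative, given by bidifferential operators, $f\star g=fg+\{f,g\}\hbar+O(\hbar^2)$. The superscript $(1)$ means working modulo $\hbar^2$, so only $fg+\{f,g\}\hbar$ matters. **Classical instantons.** A rank $2$ bundle $E$ on $Z_k$ with $c_1=0$ has splitting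 type $j\ge0$ if $E|_\ell\simeq\mathcal O_{\mathbb P^1}(j)\oplus\mathcal O_{\mathbb P^1}(-j)$. $\mathrm{SU}(2)$ instantons on $Z_k$ correspond to such bundles whose splitting type is a multiple of $k$. With $\tau\colon Z_k\to X_k$ the contraction of $\ell$ to a point, the (normalized) charge is $h^0(X_k,(\tau_*E)^{\vee\vee}/\tau_*E)+h^0(X_k,R^1\tau_*E)+1$ (for $k\ge2$). Bundles are considered on the first formal neighbourhood $\ell^{(1)}$ of $\ell$ (terms $u^2$ are discarded), with transition matrix $T_p=\begin{pmatrix}z^j&p\\0&z^{-j}\end{pmatrix}$, $p=\sum_{l=k-j+1}^{j-1}p_{1,l}z^lu\neq0$, $k\mid j$. Two are isomorphic on $\ell^{(1)}$ iff the $p$ are proportional. $\mathbb{MI}_j(Z_k)$ is the set of points $P=[p_{1,k-j+1}:\cdots:p_{1,j-1}]\in\mathbb P^{2j-k-2}$ whose bundle has charge $j$. **Quantum instantons.** $\mathbb{QI}^{(1)}_j(\mathcal Z_k(\sigma))$ is the set of equivalence classes of pairs $(p,p')$, representing transition matrices $T_{p+p'\hbar}=\begin{pmatrix}z^j&p+p'\hbar\\0&z^{-j}\end{pmatrix}$, with $p,p'$ both of the form $\sum_{l=k-j+1}^{j-1}(\cdot)z^lu$ and $p$ defining a point of $\mathbb{MI}_j(Z_k)$. The pairs $(p,p')$ and $(q,q')$ are equivalent if there are $\star$-invertible $2\times2$ matrices $A_U,A_V$ over $\mathcal A(U)/\hbar^2$, $\mathcal A(V)/\hbar^2$ with $A_V\star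 T_{q+q'\hbar}=T_{p+p'\hbar}\star A_U$ on $U\cap V$ modulo $u^2$ and $\hbar^2$. The classical limit map sends the class of $(p,p')$ to the point $P$ defined by $p$. **Rebel instantons.** The quantum moduli space is viewed as the étale space of a sheaf $\mathcal Q^\sigma$ (the quantizing sheaf) over the classical one, whose stalk at $P$ is the fibre of the classical limit map over $P$. A classical instanton is rebel for $\sigma$ if this stalk is nontrivial. *)

(* Defs.v *)
From HB Require Import structures.
From mathcomp Require Import all_boot all_order all_algebra.
From mathcomp Require Import all_classical all_reals all_analysis.
From mathcomp Require Import complex.

Set Implicit Arguments.
Unset Strict Implicit.
Unset Printing Implicit Defensive.

Import Order.TTheory GRing.Theory Num.Theory.
Import numFieldNormedType.Exports.

Local Open Scope classical_set_scope.
Local Open Scope ring_scope.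

(* Naming R[i] as a numClosedFieldType gives it the topology and norm that
   numFieldNormedType attaches to the variables of that type. *)
Definition Cplx (R : realType) : numClosedFieldType := R[i].

Notation C2 R := (Cplx R * Cplx R)%type.

(* The C^1 form of the definition of a holomorphic function on an open subset
   of C^2 : the derivative over the field C exists and is continuous. (By
   Goursat and Hartogs the continuity is automatic.) *)
Definition holo (R : realType) (D : set (C2 R)) (f : C2 R -> Cplx R) : Prop :=
  forall x, D x ->
    [/\ differentiable f x, {for x, continuous ('D_(1, 0) f)}
      & {for x, continuous ('D_(0, 1) f)}].

Definition holoM (R : realType) (m n : nat) (D : set (C2 R))
    (M : C2 R -> 'M[Cplx R]_(m, n)) : Prop :=
  forall a b, holo D (fun x => M x a b).

(* The gluing (z, u) |-> (z^-1, z^k u). It is an involution of {z != 0}, so the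
   same formula goes from U to V and from V to U. *)
Definition glue (R : realType) (k : nat) (x : C2 R) : C2 R :=
  (x.1^-1, x.1 ^+ k * x.2).

(* Objects on Z_k are given by their two chart expressions, indexed by bool :
   true is the chart U, false is the chart V. A point of Z_k lying in both
   charts occurs twice, as x in the chart i and as glue k x in the chart ~~ i.
   The section l is x.2 = 0 in both charts. *)
Definition chset (R : realType) := bool -> set (C2 R).
Definition chfun (R : realType) := bool -> C2 R -> Cplx R.
Definition chvec (R : realType) := bool -> C2 R -> 'cV[Cplx R]_2.

(* The open subsets W of X_k, through their inverse images in Z_k : the open
   subsets of Z_k that contain l or do not meet it (X_k carries the quotient
   topology of Z_k / l, since tau is proper). *)
Definition openX (R : realType) (k : nat) (W : chset R) : Prop :=
  [/\ forall i, open (W i),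
      forall i x, x.1 != 0 -> (W i x <-> W (~~ i) (glue k x))
    & forall i j a b, W i (a, 0) -> W j (b, 0)].

Definition subX (R : realType) (W' W : chset R) : Prop :=
  forall i, W' i `<=` W i.

(* Sections over W are represented by functions defined everywhere, whose values
   outside W are irrelevant; thus restriction maps are the identity. In a sheaf
   of O_X-modules, sec W is the set of representatives of sections over W, and
   nul W the set of those that represent 0 on W. *)
Record omod (R : realType) := OMod {
  car : lmodType (Cplx R);
  act : chfun R -> car -> car;
  sec : chset R -> set car;
  nul : chset R -> set car
}.

(* O_X = tau_* O_Z, as X_k is normal. *)
Definition secO (R : realType) (k : nat) (W : chset R) : set (chfun R) :=
  [set f | (forall i, holo (W i) (f i)) /\
           forall i x, W i x -> x.1 != 0 -> f (~~ i) (glue k x) = f i x].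

Definition nulO (R : realType) (W : chset R) : set (chfun R) :=
  [set f | forall i x, W i x -> f i x = 0].

(* tau_* E, for the bundle E on Z_k whose transition matrix T takes the
   coordinates of a section on U to its coordinates on V. *)
Definition tauE (R : realType) (k : nat) (T : C2 R -> 'M[Cplx R]_2) : omod R :=
  @OMod R (bool -> C2 R -> 'cV[Cplx R]_2 : lmodType (Cplx R))
    (fun f s i x => f i x *: s i x)
    (fun W => [set s | (forall i, holoM (W i) (s i)) /\
       forall x, W true x -> x.1 != 0 ->
         s false (glue k x) = T x *m s true x])
    (fun W => [set s | forall i x, W i x -> s i x = 0]).

(* The dual sheaf Hom(M, O_X). A section over W is a morphism of sheaves of
   modules M|W -> O_X|W : a family of maps M(W') -> O_X(W'), for W' open in W,
   that are well defined and O_X(W')-linear, and commute with restrictions. *)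
Definition dual (R : realType) (k : nat) (M : omod R) : omod R :=
  @OMod R
    (chset R -> car M -> bool -> C2 R -> Cplx R : lmodType (Cplx R))
    (fun f phi W s i x => f i x * phi W s i x)
    (fun W => [set phi | forall W', openX k W' -> subX W' W ->
       [/\ forall s, sec W' s -> secO k W' (phi W' s),
           forall s, sec W' s -> nul W' s -> nulO W' (phi W' s),
           forall f s t, secO k W' f -> sec W' s -> sec W' t ->
             nulO W' (fun i x =>
               phi W' (act f s + t) i x
               - (f i x * phi W' s i x + phi W' t i x))
         & forall W'' s, openX k W'' -> subX W'' W' -> sec W' s ->
             nulO W'' (fun i x => phi W'' s i x - phi W' s i x)]])
    (fun W => [set phi | forall W' s, openX k W' -> subX W' W -> sec W' s ->
       nulO W' (phi W' s)]).

Definition bidual_map (R : realType) (k : nat) (M : omod R) (s : car M) :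
    car (dual k (dual k M)) :=
  fun W (phi : car (dual k M)) => phi W s.

(* S / N has dimension n, for linear subspaces N of S of V. *)
Definition quot_dim (K : fieldType) (V : lmodType K) (S N : set V) (n : nat) :
    Prop :=
  exists v : 'I_n -> V, (forall i, S (v i)) /\
    forall s, S s -> exists! c : 'rV[K]_n, N (s - \sum_i c 0 i *: v i).

(* Global sections of the sheaf on X_k associated with the presheaf
   W |-> S W / N W : families of germs that are locally induced by one section
   of the presheaf. A point of X_k may have several chart expressions; their
   values then have the same germ, since W contains all of them. *)
Definition gsec (R : realType) (k : nat) (V : lmodType (Cplx R))
    (S N : chset R -> set V) : set (bool -> C2 R -> V) :=
  [set s | forall i x, exists W c,
     [/\ openX k W, W i x, S W c &
       forall j y, W j y -> exists W',
         [/\ openX k W', subX W' W, W' j y & N W' (s j y - c)]]].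

Definition gnul (R : realType) (k : nat) (V : lmodType (Cplx R))
    (N : chset R -> set V) : set (bool -> C2 R -> V) :=
  [set s | forall i x, exists W, [/\ openX k W, W i x & N W (s i x)]].

Definition h0 (R : realType) (k : nat) (V : lmodType (Cplx R))
    (S N : chset R -> set V) (n : nat) : Prop :=
  quot_dim (V := (bool -> C2 R -> V : lmodType (Cplx R)))
    (gsec k S N) (gnul k N) n.

(* (tau_* E)^vv / tau_* E is the sheaf of the quotients S / N below. *)
Definition biduS (R : realType) (k : nat) (T : C2 R -> 'M[Cplx R]_2)
    (W : chset R) : set (car (dual k (dual k (tauE k T)))) :=
  sec W.

Definition biduN (R : realType) (k : nat) (T : C2 R -> 'M[Cplx R]_2)
    (W : chset R) : set (car (dual k (dual k (tauE k T)))) :=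
  [set phi | sec W phi /\ exists s : car (tauE k T),
     sec W s /\ nul W (phi - bidual_map s)].

(* R^1 tau_* E is the sheaf associated with W |-> H^1(tau^-1 W, E); here H^1 is
   the Cech cohomology of the covering by the two charts, whose members are
   Stein when W is Stein. A cochain is written in the variables of U and in the
   frame of E on V. *)
Definition cechS (R : realType) (W : chset R) :
    set (C2 R -> 'cV[Cplx R]_2) :=
  [set c | holoM [set x | W true x /\ x.1 != 0] c].

Definition cechN (R : realType) (k : nat) (T : C2 R -> 'M[Cplx R]_2)
    (W : chset R) : set (C2 R -> 'cV[Cplx R]_2) :=
  [set c | exists s : chvec R, (forall i, holoM (W i) (s i)) /\
     forall x, W true x -> x.1 != 0 ->
       c x = s false (glue k x) - T x *m s true x].

Definition has_charge (R : realType) (k : nat) (T : C2 R -> 'M[Cplx R]_2)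
    (n : nat) : Prop :=
  exists w h : nat,
    [/\ h0 k (biduS (k := k) (T := T)) (biduN (k := k) (T := T)) w,
        h0 (V := (C2 R -> 'cV[Cplx R]_2 : lmodType (Cplx R)))
          k (@cechS R) (cechN k T) h
      & n = (w + h + 1)%N].

(* The number of exponents l with k - j + 1 <= l <= j - 1. *)
Definition nco (k j : nat) : nat := (2 * j - k - 1)%N.

Definition coefs (R : realType) (k j : nat) := 'rV[Cplx R]_(nco k j).

Definition pfun (R : realType) (k j : nat) (p : coefs R k j) (x : C2 R) :
    Cplx R :=
  (\sum_i p 0 i * x.1 ^ (k%:Z - j%:Z + 1 + (i : nat)%:Z)) * x.2.

Definition Tmx (R : realType) (k j : nat) (p : coefs R k j) (x : C2 R) :
    'M[Cplx R]_2 :=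
  block_mx (x.1 ^+ j)%:M (pfun p x)%:M 0 (x.1 ^- j)%:M : 'M[Cplx R]_(1 + 1).

(* [p] in the projective space, as the set of its homogeneous coordinates. *)
Definition ppoint (R : realType) (n : nat) (p : 'rV[Cplx R]_n) :
    set 'rV[Cplx R]_n :=
  [set q | exists2 c : Cplx R, c != 0 & q = c *: p].

Definition MI (R : realType) (k j : nat) : set (set (coefs R k j)) :=
  [set P | (k %| j)%N /\
     exists p : coefs R k j,
       [/\ p != 0, P = ppoint p & has_charge k (Tmx p) j]].
Arguments MI : clear implicits.

(* A bivector field, s true d_z /\ d_u on U and s false d_xi /\ d_v on V. On
   U /\ V, d_z /\ d_u = J d_xi /\ d_v, where J = - z^-2 z^k is the Jacobian
   determinant of the gluing. On a surface every bivector field is Poisson. *)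
Definition poisson (R : realType) (k : nat) (s : chfun R) : Prop :=
  (forall i, holo setT (s i)) /\
  forall x : C2 R, x.1 != 0 ->
    s false (glue k x) = - (x.1 ^- 2 * x.1 ^+ k) * s true x.

Definition pbr (R : realType) (s f g : C2 R -> Cplx R) (x : C2 R) : Cplx R :=
  s x * ('D_(1, 0) f x * 'D_(0, 1) g x - 'D_(0, 1) f x * 'D_(1, 0) g x).

(* The pair A stands for the matrix of functions A.1 + A.2 hbar mod hbar^2. *)
Definition hmx (R : realType) :=
  ((C2 R -> 'M[Cplx R]_2) * (C2 R -> 'M[Cplx R]_2))%type.

(* Matrix product over functions with f * g = f g + {f, g} hbar. *)
Definition star (R : realType) (s : C2 R -> Cplx R) (A B : hmx R) : hmx R :=
  (fun x => A.1 x *m B.1 x,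
   fun x => A.1 x *m B.2 x + A.2 x *m B.1 x +
     \matrix_(a, b) \sum_c pbr s (fun y => A.1 y a c) (fun y => B.1 y c b) x).

Definition hol_hmx (R : realType) (A : hmx R) : Prop :=
  holoM setT A.1 /\ holoM setT A.2.

Definition hone (R : realType) : hmx R := (fun=> 1%:M, fun=> 0).

Definition star_invertible (R : realType) (s : C2 R -> Cplx R) (A : hmx R) :
    Prop :=
  hol_hmx A /\
  exists B, [/\ hol_hmx B, star s A B = @hone R & star s B A = @hone R].

Definition eqmod_u2 (R : realType) (F G : C2 R -> 'M[Cplx R]_2) : Prop :=
  exists H : C2 R -> 'M[Cplx R]_2, holoM [set x : C2 R | x.1 != 0] H /\
    forall x : C2 R, x.1 != 0 -> F x - G x = x.2 ^+ 2 *: H x.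

Definition qpair (R : realType) (k j : nat) :=
  (coefs R k j * coefs R k j)%type.

Definition Thmx (R : realType) (k j : nat) (a : qpair R k j) : hmx R :=
  (Tmx a.1,
   fun x => block_mx 0 (pfun a.2 x)%:M 0 0 : 'M[Cplx R]_(1 + 1)).

(* The equation on U /\ V is written in the variables of U. *)
Definition qequiv (R : realType) (k j : nat) (s : chfun R)
    (a b : qpair R k j) : Prop :=
  exists AU AV : hmx R,
    [/\ star_invertible (s true) AU, star_invertible (s false) AV &
      let AV' : hmx R := (AV.1 \o @glue R k, AV.2 \o @glue R k) in
      let lhs := star (s true) AV' (Thmx b) in
      let rhs := star (s true) (Thmx a) AU in
      eqmod_u2 lhs.1 rhs.1 /\ eqmod_u2 lhs.2 rhs.2].

Definition qclass (R : realType) (k j : nat) (s : chfun R)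
    (a : qpair R k j) : set (qpair R k j) :=
  [set b | MI R k j (ppoint b.1) /\ qequiv s a b].

Definition QI (R : realType) (k j : nat) (s : chfun R) :
    set (set (qpair R k j)) :=
  [set c | exists2 a : qpair R k j, MI R k j (ppoint a.1) & c = qclass s a].

Definition classical_limit (R : realType) (k j : nat) (s : chfun R)
    (c : set (qpair R k j)) (P : set (coefs R k j)) : Prop :=
  exists2 a : qpair R k j, c = qclass s a & P = ppoint a.1.

(* The stalk at P of the quantizing sheaf. *)
Definition stalk (R : realType) (k j : nat) (s : chfun R)
    (P : set (coefs R k j)) : set (set (qpair R k j)) :=
  [set c | QI s c /\ classical_limit s c P].

(* The stalk is a quotient of the space of the coefficients p' : fixing p above
   P, the map p' |-> class of (p, p') is onto the stalk, and identifies it with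
   the d-dimensional image of a linear map L. *)
Definition stalk_dim (R : realType) (k j : nat) (s : chfun R)
    (P : set (coefs R k j)) (d : nat) : Prop :=
  exists2 p : coefs R k j, P = ppoint p &
  exists L : 'M[Cplx R]_(nco k j, d),
    [/\ row_full L,
        stalk s P = [set qclass s (p, p') | p' in setT]
      & forall p' p'' : coefs R k j,
          qclass s (p, p') = qclass s (p, p'') <-> p' *m L = p'' *m L].

Definition rebel (R : realType) (k j : nat) (s : chfun R)
    (P : set (coefs R k j)) : Prop :=
  exists2 d : nat, (0 < d)%N & stalk_dim s P d.

(* Main.v *)
(* Take j = k and p = z u. Every germ of a section of the bidual of tau_* E comes from tau_* E,
   and the cochains (z^m, 0), 0 < m < k, are a basis of the stalk of R^1 tau_* E at the singular
   point; hence the charge is 0 + (k - 1) + 1 = k.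

   Multiplying an equivalence on the left by the constant matrix 1 + c hbar diag(1, 0) gives
   (p, p') ~ (p, p' + c p), and diag(c, 1) gives (p, p') ~ (c p, c p').

   Conversely, let A_U, A_V be an equivalence between (p, p') and (p, p''). As k >= 3, sigma
   vanishes on l: sigma_V(1/z, 0) = - z^(k-2) sigma_U(z, 0). Liouville's theorem shows that, on l,
   the diagonal entries of the matrices are constant and the upper right ones vanish; at order 0
   in hbar the coefficient of u shows that the two constants agree, with value a != 0, and that
   the upper right entries vanish to second order. So the brackets do not contribute to the
   coefficient of u in the upper right entry at order 1 in hbar, which reads
   a (p'' - p') + c p = g(1/z) - z^k f(z) with f and g entire. The left side only involves
   z, ..., z^(k-1), hence it vanishes. The stalk is therefore C^(k-1) / C p, of dimension
   k - 2 > 0.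

   The theory of one complex variable is obtained from averages over roots of unity in place of
   contour integrals. *)
Require Import Defs.
From HB Require Import structures.
From mathcomp Require Import all_boot all_order all_algebra.
From mathcomp Require Import all_classical all_reals all_analysis.
From mathcomp Require Import complex ring.
Import Defs.

Set Implicit Arguments.
Unset Strict Implicit.
Unset Printing Implicit Defensive.
Import Order.TTheory GRing.Theory Num.Theory.
Import numFieldNormedType.Exports.
Local Open Scope classical_set_scope.
Local Open Scope ring_scope.

(** * Complex numbers *)

(** Why p = z u: the pairs (p, p' + c p) then differ from (p, p') only in the first coefficient, so
    the quotient by C p is the deletion of one coordinate. This p also makes tau_* E reflexive: a
    section of the bidual supplies a function that has to be divisible by u, its restriction to l is
    a constant c, and c z would have to be of the form g(1/z) - z^k f(z). That no nonzero
    combination of z, ..., z^(k-1) has this form also gives the independence of the cochains and the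
    comparison of p' with p''.

    Why the brackets are harmless: sigma = u tau, so they enter the coefficient of u through their
    values on l. In each product one factor is the derivative along l of an entry that is constant
    on l, unless that derivative falls on z^k or z^-k; then the other factor is the u-derivative of
    an upper right entry of A_U or A_V, whence the need for second order vanishing at order 0 in
    hbar.

    A class is the set of pairs reached from a given one, so two classes are equal as soon as left
    multiplications by constants carry the equivalences from either pair to those from the other. *)

Section ComplexTopology.
Variable R : realType.
Local Notation K := (Cplx R).
Implicit Types (z w : K) (t : R).

Definition ofR t : K := real_complex R t.
Definition nm z : R := complex.Re (`|z| : K).

Lemma nmE z : `|z| = ofR (nm z).
Proof. by rewrite /nm normc_def. Qed.

Lemma ofR_le t u : (ofR t <= ofR u) = (t <= u).
Proof. exact: lecR. Qed.

Lemma ofR_lt t u : (ofR t < ofR u) = (t < u).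
Proof. exact: ltcR. Qed.

Lemma ofR_norm t : `|ofR t| = ofR `|t|.
Proof. by rewrite normc_def /= expr0n /= addr0 sqrtr_sqr. Qed.

Lemma gt0_ofR z : 0 < z -> exists2 t, 0 < t & z = ofR t.
Proof.
case: z => a b; rewrite ltcE /= => /andP[/eqP b0 a0]; exists a => //.
by rewrite b0.
Qed.

Lemma ge0_ofR z : 0 <= z -> exists2 t, 0 <= t & z = ofR t.
Proof.
rewrite le_eqVlt => /orP[/eqP <-|/gt0_ofR[t /ltW t0 ->]]; last by exists t.
by exists 0 => //; rewrite /ofR rmorph0.
Qed.

Lemma ofR0 : ofR 0 = 0. Proof. exact: rmorph0. Qed.
Lemma ofR1 : ofR 1 = 1. Proof. exact: rmorph1. Qed.
Lemma ofRD t u : ofR (t + u) = ofR t + ofR u. Proof. exact: rmorphD. Qed.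
Lemma ofRB t u : ofR (t - u) = ofR t - ofR u. Proof. exact: rmorphB. Qed.
Lemma ofRM t u : ofR (t * u) = ofR t * ofR u. Proof. exact: rmorphM. Qed.

Lemma nm_le_tri z w : nm (z + w) <= nm z + nm w.
Proof. by rewrite -ofR_le ofRD -!nmE ler_normD. Qed.

Lemma continuous_ofR : continuous ofR.
Proof.
move=> t; apply/cvgrPdist_le => e /gt0_ofR[d d0 ->].
have := @cvg_id _ (nbhs t).
move/cvgrPdist_le => /(_ _ d0); apply: filterS => u.
by rewrite -ofRB ofR_norm ofR_le.
Qed.

Lemma normc_ge_Im z : ofR `|complex.Im z| <= `|z|.
Proof.
have -> : complex.Im z = complex.Re (- 'i * z : K).
  by case: z => x y; rewrite /= !(mul0r, oppr0, add0r, mulN1r, opprK).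
by apply: (le_trans (normc_ge_Re _)); rewrite normrM normrN normCi mul1r.
Qed.

Lemma continuous_nm : continuous nm.
Proof.
move=> z; apply/(@cvgrPdist_le _ _ _ _ (nbhs_filter z)) => e e0.
apply/nbhs_normP; exists (ofR e); rewrite /= ?(ofR_lt 0)// => w /= /ltW.
rewrite -ofR_le -ofR_norm ofRB -!nmE; apply: le_trans.
exact: ler_dist_dist.
Qed.

Lemma cauchy_cvgC (u : nat -> K) :
  (forall e : K, 0 < e -> exists N, forall n, (N <= n)%N -> `|u n - u N| <= e) ->
  cvg (u @ \oo).
Proof.
move=> H.
have cvgR (g : K -> R) : (forall z w, g (z - w) = g z - g w) ->
    (forall z, ofR `|g z| <= `|z|) -> cvg (g \o u @ \oo).
  move=> gB gle; apply/cauchy_cvgP/cauchy_exP => e e0.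
  have [|N HN] := H (ofR (e / 2)); first by rewrite (ofR_lt 0) divr_gt0.
  exists ((g \o u) N); exists N => // n /= /HN h.
  rewrite /ball /= distrC -gB -ofR_lt; apply: (le_lt_trans (gle _)).
  by apply: (le_lt_trans h); rewrite ofR_lt ltr_pdivrMr// ltr_pMr// ltr1n.
have /cvg_ex[a ca] : cvg ((fun z : K => complex.Re z) \o u @ \oo).
  by apply: cvgR => [[? ?] [? ?]|z] //; exact: normc_ge_Re.
have /cvg_ex[b cb] : cvg ((fun z : K => complex.Im z) \o u @ \oo).
  by apply: cvgR => [[? ?] [? ?]|z] //; exact: normc_ge_Im.
apply/cvg_ex; exists (ofR a + 'i * ofR b).
rewrite (_ : u = (fun n => ofR (complex.Re (u n)) + 'i * ofR (complex.Im (u n)))).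
  apply: cvgD.
    by apply: (@cvg_comp _ _ _ (fun n => complex.Re (u n)) ofR _ _ _ ca); exact: continuous_ofR.
  apply: cvgMr.
  by apply: (@cvg_comp _ _ _ (fun n => complex.Im (u n)) ofR _ _ _ cb); exact: continuous_ofR.
by apply/funext => n; rewrite [LHS]complexE.
Qed.

Lemma compact_disc (r : K) : compact [set z : K | `|z| <= r].
Proof.
have [r0|] := boolP (0 <= r); last first.
  move=> r0; rewrite (_ : [set _ | _] = set0); first exact: compact0.
  by apply/seteqP; split => // z /= h; move: r0; rewrite (le_trans _ h).
pose h (x : R * R) : K := ofR x.1 + 'i * ofR x.2.
have hc : continuous h.
  move=> x; apply: cvgD.
    by apply: (@cvg_comp _ _ _ fst ofR); [exact: cvg_fst|exact: continuous_ofR].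
  apply: cvgMr.
  by apply: (@cvg_comp _ _ _ snd ofR); [exact: cvg_snd|exact: continuous_ofR].
have [t rE] : exists t, r = ofR t.
  by apply/complex_realP; rewrite realE r0.
subst r.
have cl : closed [set z : K | `|z| <= ofR t].
  rewrite (_ : [set _ | _] = nm @^-1` [set u | u <= t]).
    by apply: preimage_closed; [move=> z _; exact: continuous_nm|exact: closed_le].
  by apply/seteqP; split => z /=; rewrite nmE ofR_le.
have := @compact_setX _ _ _ _ (@segment_compact R (- t) t) (@segment_compact R (- t) t).
move/(continuous_compact (continuous_subspaceT hc)); move=> cpt; apply: (subclosed_compact cl cpt) => z /= hz.
exists (complex.Re z, complex.Im z); last by rewrite /h /= [RHS]complexE.
have a1 : `|complex.Re z| <= t.
  by rewrite -ofR_le; apply: le_trans hz; exact: normc_ge_Re.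
have a2 : `|complex.Im z| <= t.
  by rewrite -ofR_le; apply: le_trans hz; exact: normc_ge_Im.
by split; rewrite /= in_itv /= -ler_norml.
Qed.

Lemma compact_circle (r : K) : compact [set z : K | `|z| = r].
Proof.
apply: (subclosed_compact _ (@compact_disc r)); last by move=> z /= ->.
apply: (@preimage_closed _ _ (fun z : K => `|z|) [set r]).
  by move=> z _; exact: norm_continuous.
apply: compact_closed; first exact: norm_hausdorff.
exact: compact_set1.
Qed.

(** A mean value inequality by the supremum argument: the set [S] of points up to which the bound
    holds contains its supremum [T], and the local estimate at [T] carries the bound beyond [T]
    unless [T = b]. Like differentiability, the hypothesis compares s with a fixed centre t only. *)
Lemma segment_lipschitz (g : R -> K) (a b B : R) : a <= b -> 0 <= B ->
  (forall t, a <= t <= b -> \forall s \near t, a <= s <= b ->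
     nm (g s - g t) <= B * `|s - t|) ->
  nm (g b - g a) <= B * (b - a).
Proof.
move=> ab B0 H.
pose S := [set t | a <= t <= b /\ nm (g t - g a) <= B * (t - a)].
have Sa : S a by split; rewrite ?lexx ?ab// !subrr mulr0 -ofR_le -nmE normr0.
have ubS : ubound S b by move=> t [/andP[]].
have supS : has_sup S by split; [exists a | exists b].
set T := sup S.
have aT : a <= T by apply: ub_le_sup => //; exists b.
have Tb : T <= b by apply: ge_sup => //; exists a.
have ST : S T.
  split; first by rewrite aT Tb.
  have := H T; rewrite aT Tb => /(_ isT)/nbhs_normP[e /= e0 He].
  have [s Ss sT] := sup_adherent e0 supS.
  have sleT : s <= T by apply: ub_le_sup => //; exists b.
  have [sab sB] := Ss.
  have := He s; rewrite /= ger0_norm ?subr_ge0// ltrBlDr -ltrBlDl => /(_ sT) /(_ sab) h.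
  have -> : g T - g a = (g T - g s) + (g s - g a) by rewrite addrA subrK.
  apply: (le_trans (nm_le_tri _ _)).
  rewrite (_ : B * (T - a) = B * (T - s) + B * (s - a)); last by rewrite -mulrDr addrA subrK.
  apply: lerD => //.
  have <- : nm (g s - g T) = nm (g T - g s) by rewrite /nm distrC.
  by rewrite -(ger0_norm (_ : 0 <= T - s)) ?subr_ge0// distrC.
have [<-|Tnb] := eqVneq T b; first by case: ST.
have Tltb : T < b by rewrite lt_neqAle Tnb.
have := H T; rewrite aT Tb => /(_ isT)/nbhs_normP[e /= e0 He].
pose s := T + Num.min (e / 2) (b - T).
have m0 : 0 < Num.min (e / 2) (b - T) by rewrite lt_min divr_gt0// subr_gt0 Tltb.
have Ts : T < s by rewrite ltrDl.
have sb : s <= b by rewrite -lerBrDl ge_min lexx orbT.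
have : S s.
  split; first by rewrite sb andbT (le_trans aT) ?ltW.
  have -> : g s - g a = (g s - g T) + (g T - g a) by rewrite addrA subrK.
  apply: (le_trans (nm_le_tri _ _)).
  rewrite (_ : B * (s - a) = B * (s - T) + B * (T - a)); last by rewrite -mulrDr addrA subrK.
  apply: lerD; last by case: ST.
  have sT0 : 0 <= s - T by rewrite subr_ge0 ltW.
  rewrite -[X in B * X](ger0_norm sT0); apply: (He s) => /=.
    rewrite distrC ger0_norm ?subr_ge0 1?ltW// /s addrC addKr gt_min.
    by rewrite ltr_pdivrMr// ltr_pMr// ltr1n.
  by rewrite sb andbT (le_trans aT) ?ltW.
move=> Ss; have : s <= T by apply: ub_le_sup => //; exists b.
by rewrite leNgt Ts.
Qed.

End ComplexTopology.

(* What the analysis needs of the field Cplx R. Working over an abstract K keeps unification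
   from unfolding the complex numbers. *)
Record complex_model (R : realType) (K : numClosedFieldType) := ComplexModel {
  cm_of : R -> K;
  cm_nm : K -> R;
  cm_of0 : cm_of 0 = 0;
  cm_of1 : cm_of 1 = 1;
  cm_ofD : {morph cm_of : t u / t + u};
  cm_ofB : {morph cm_of : t u / t - u};
  cm_ofM : {morph cm_of : t u / t * u};
  cm_of_le : {mono cm_of : t u / t <= u};
  cm_of_lt : {mono cm_of : t u / t < u};
  cm_of_norm : forall t, `|cm_of t| = cm_of `|t|;
  cm_nmE : forall z, `|z| = cm_of (cm_nm z);
  cm_ge0 : forall z, 0 <= z -> exists2 t, 0 <= t & z = cm_of t;
  cm_of_continuous : continuous cm_of;
  cm_cauchy : forall u : nat -> K,
    (forall e : K, 0 < e -> exists N, forall n, (N <= n)%N -> `|u n - u N| <= e) ->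
    cvg (u @ \oo);
  cm_circle : compact [set z : K | `|z| = 1];
  cm_disc : forall r, compact [set z : K | `|z| <= r];
  cm_segment : forall (g : R -> K) (a b B : R), a <= b -> 0 <= B ->
    (forall t, a <= t <= b -> \forall s \near t, a <= s <= b ->
       cm_nm (g s - g t) <= B * `|s - t|) ->
    cm_nm (g b - g a) <= B * (b - a)
}.

Definition Cplx_model (R : realType) : complex_model R (Cplx R) :=
  @ComplexModel R (Cplx R) (@ofR R) (@nm R) (@ofR0 R) (@ofR1 R) (@ofRD R) (@ofRB R)
    (@ofRM R) (@ofR_le R) (@ofR_lt R) (@ofR_norm R) (@nmE R) (@ge0_ofR R)
    (@continuous_ofR R) (@cauchy_cvgC R) (@compact_circle R 1) (@compact_disc R)
    (@segment_lipschitz R).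

(** * Holomorphic functions *)

Section StrictDifferentiability.
Variable K : numFieldType.

Definition bndlin (V W : normedModType K) (L : V -> W) :=
  (forall a u v, L (a *: u + v) = a *: L u + L v) /\
  exists2 C, 0 < C & forall v, `|L v| <= C * `|v|.

(* Strict differentiability, which has the continuity of the derivatives built in: on an open
   subset of C^2 it is equivalent to holo. *)
Definition is_sd (V W : normedModType K) (f : V -> W) (x : V) (L : V -> W) :=
  bndlin L /\ forall e, 0 < e ->
    \forall p \near (x, x), `|f p.1 - f p.2 - L (p.1 - p.2)| <= e * `|p.1 - p.2|.

Definition sd (V W : normedModType K) (f : V -> W) (x : V) := exists L, is_sd f x L.

Section Theory.
Variables (V W U : normedModType K).

Lemma bndlin0 (L : V -> W) : bndlin L -> L 0 = 0.
Proof.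
by move=> [l _]; have := l 1 0 0; rewrite !scale1r addr0 => /eqP; rewrite -subr_eq0 opprD addrA subrr sub0r oppr_eq0 => /eqP.
Qed.

Lemma bndlinD (L : V -> W) u v : bndlin L -> L (u + v) = L u + L v.
Proof. by move=> [l _]; have := l 1 u v; rewrite !scale1r. Qed.

Lemma bndlinZ (L : V -> W) a u : bndlin L -> L (a *: u) = a *: L u.
Proof. by move=> hl; have [l _] := hl; have := l a u 0; rewrite !addr0 bndlin0// addr0. Qed.

End Theory.

Lemma prod_norm_le (V W : normedModType K) (x : V * W) B :
  `|x.1| <= B -> `|x.2| <= B -> `|x| <= B.
Proof. by move=> h1 h2; rewrite prod_normE /Num.max; case: ifP. Qed.

Lemma prod_norm_lt (V W : normedModType K) (x : V * W) B :
  `|x.1| < B -> `|x.2| < B -> `|x| < B.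
Proof. by move=> h1 h2; rewrite prod_normE /Num.max; case: ifP. Qed.

Lemma norm_fst_le (V W : normedModType K) (x : V * W) : `|x.1| <= `|x|.
Proof. by rewrite prod_normE /Num.max; case: ifPn => // /ltW. Qed.

Lemma norm_snd_le (V W : normedModType K) (x : V * W) : `|x.2| <= `|x|.
Proof.
by rewrite prod_normE /Num.max; case: ifPn => //; rewrite -real_leNgt ?normr_real.
Qed.

Section Theory2.
Variables (V W U : normedModType K).

Lemma is_sd_lip (f : V -> W) x L : is_sd f x L ->
  exists2 C, 0 < C & \forall p \near (x, x), `|f p.1 - f p.2| <= C * `|p.1 - p.2|.
Proof.
move=> [[_ [C C0 LC]] /(_ 1 ltr01) H]; exists (C + 1); first by rewrite addr_gt0.
move: H; apply: filterS => p H.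
rewrite -[f p.1 - f p.2](subrK (L (p.1 - p.2))) mulrDl addrC.
by rewrite (le_trans (ler_normD _ _))// lerD.
Qed.

Lemma sd_continuous (f : V -> W) x : sd f x -> {for x, continuous f}.
Proof.
move=> [L /is_sd_lip[C C0 H]]; apply/cvgrPdist_le => e e0.
have : (x, y) @[y --> x] --> (x, x) by apply: cvg_pair; [exact: cvg_cst|exact: cvg_id].
move=> /(_ _ H) /= H1; near=> y; apply: (@le_trans _ _ (C * `|x - y|)).
  by near: y.
rewrite mulrC -ler_pdivlMr//; near: y.
by apply/nbhs_normP; exists (e / C); rewrite /= ?divr_gt0// => y /= /ltW.
Unshelve. all: by end_near. Qed.

Lemma near_pair_fst (x : V) (P : V -> Prop) :
  (\forall y \near x, P y) -> \forall p \near (x, x), P p.1.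
Proof. exact: (@cvg_fst _ _ (nbhs x) (nbhs x) _ P). Qed.

Lemma near_pair_snd (x : V) (P : V -> Prop) :
  (\forall y \near x, P y) -> \forall p \near (x, x), P p.2.
Proof. exact: (@cvg_snd _ _ (nbhs x) (nbhs x) _ P). Qed.

Lemma is_sd_near (f g : V -> W) x L :
  (\forall y \near x, f y = g y) -> is_sd f x L -> is_sd g x L.
Proof.
move=> fg [bL H]; split => // e /H He.
have fg1 : \forall p \near (x, x), f p.1 = g p.1 by exact: near_pair_fst fg.
have fg2 : \forall p \near (x, x), f p.2 = g p.2 by exact: near_pair_snd fg.
by move: fg1 fg2 He; apply: filterS3 => p -> ->.
Qed.

Lemma sd_near (f g : V -> W) x :
  (\forall y \near x, f y = g y) -> sd f x -> sd g x.
Proof. by move=> fg [L] H; exists L; exact: is_sd_near H. Qed.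

Lemma is_sd_lin (L : V -> W) x : bndlin L -> is_sd L x L.
Proof.
move=> bL; split => // e e0; apply: (@filterE _ _ (nbhs_filter (x, x))) => -[a b] /=.
have -> : L a - L b - L (a - b) = 0.
  have -> : L a = L (a - b) + L b by rewrite -bndlinD// subrK.
  by rewrite addrK subrr.
by rewrite normr0 mulr_ge0// ltW.
Qed.

Lemma is_sd_cst (c : W) (x : V) : is_sd (fun=> c) x (fun=> 0).
Proof.
split; first by split => [*|]; [rewrite scaler0 addr0|exists 1 => // v; rewrite normr0 mul1r].
by move=> e e0; apply: (@filterE _ _ (nbhs_filter (x, x))) => p; rewrite subrr subr0 normr0 mulr_ge0// ltW.
Qed.

Lemma sd_cst (c : W) (x : V) : sd (fun=> c) x.
Proof. by eexists; exact: is_sd_cst. Qed.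

Lemma is_sdD (f g : V -> W) x L M :
  is_sd f x L -> is_sd g x M -> is_sd (fun y => f y + g y) x (fun v => L v + M v).
Proof.
move=> [[l1 [C1 C10 b1]] Hf] [[l2 [C2 C20 b2]] Hg]; split.
  split => [a u v|]; first by rewrite l1 l2 scalerDr addrACA.
  exists (C1 + C2); first by rewrite addr_gt0.
  by move=> v; rewrite mulrDl (le_trans (ler_normD _ _))// lerD.
move=> e e0.
have e2 : 0 < e / 2 by rewrite divr_gt0.
move: (Hf _ e2) (Hg _ e2); apply: filterS2 => p h1 h2.
rewrite !opprD (addrACA (f p.1) (g p.1)) (addrACA (f p.1 - f p.2)) [e]splitr mulrDl.
by rewrite (le_trans (ler_normD _ _))// lerD.
Qed.

Lemma is_sd_comp (f : V -> W) (g : W -> U) x L M :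
  is_sd f x L -> is_sd g (f x) M -> is_sd (g \o f) x (M \o L).
Proof.
move=> Hf Hg; have [C C0 lip] := is_sd_lip Hf.
have fc : f y @[y --> x] --> f x by apply: sd_continuous; exists L.
move: Hf Hg => [[l1 [C1 C10 b1]] Hf] [[l2 [C2 C20 b2]] Hg]; split.
  split => [a u v|]; first by rewrite /= l1 l2.
  exists (C2 * C1) => [|v /=]; first by rewrite mulr_gt0.
  by rewrite (le_trans (b2 _))// -mulrA ler_pM2l.
move=> e e0.
have e1 : 0 < e / 2 / C by rewrite !divr_gt0.
have e2 : 0 < e / 2 / C2 by rewrite !divr_gt0.
have ff : (f p.1, f p.2) @[p --> (x, x)] --> (f x, f x).
  apply: cvg_pair.
    by apply: (@cvg_comp _ _ _ fst f _ _ _ cvg_fst); exact: fc.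
  by apply: (@cvg_comp _ _ _ snd f _ _ _ cvg_snd); exact: fc.
move: (ff _ (Hg _ e1)) (Hf _ e2) lip; rewrite /nbhs /=.
apply: filterS3 => p /= h1 h2 h3.
rewrite -[g (f p.1) - _](subrK (M (f p.1 - f p.2))) -addrA.
have -> : M (f p.1 - f p.2) - M (L (p.1 - p.2)) = M (f p.1 - f p.2 - L (p.1 - p.2)).
  have bM : bndlin M by split=> //; exists C2.
  have -> : M (f p.1 - f p.2) = M (f p.1 - f p.2 - L (p.1 - p.2)) + M (L (p.1 - p.2)).
    by rewrite -(bndlinD _ _ bM) subrK.
  by rewrite addrK.
rewrite (le_trans (ler_normD _ _))// [e]splitr mulrDl lerD//.
  by rewrite (le_trans h1)// -mulrA ler_pM2l ?divr_gt0// mulrC ler_pdivrMr// mulrC.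
by rewrite (le_trans (b2 _))// mulrC -ler_pdivlMr// (le_trans h2)// mulrAC.
Qed.

Lemma is_sd_pair (f : V -> W) (g : V -> U) x L M :
  is_sd f x L -> is_sd g x M ->
  is_sd (fun y => (f y, g y)) x (fun v => (L v, M v)).
Proof.
move=> [[l1 [C1 C10 b1]] Hf] [[l2 [C2 C20 b2]] Hg]; split.
  split => [a u v|]; first by rewrite l1 l2.
  exists (C1 + C2); first by rewrite addr_gt0.
  move=> v; apply: prod_norm_le => /=.
    by rewrite (le_trans (b1 _))// ler_wpM2r// lerDl ltW.
  by rewrite (le_trans (b2 _))// ler_wpM2r// lerDr ltW.
move=> e e0; move: (Hf _ e0) (Hg _ e0); apply: filterS2 => p h1 h2.
exact: prod_norm_le.
Qed.

Lemma sdD (f g : V -> W) x : sd f x -> sd g x -> sd (fun y => f y + g y) x.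
Proof. by move=> [L Hf] [M Hg]; eexists; exact: is_sdD Hf Hg. Qed.

Lemma sd_comp (f : V -> W) (g : W -> U) x : sd f x -> sd g (f x) -> sd (fun y => g (f y)) x.
Proof. by move=> [L Hf] [M Hg]; eexists; exact: is_sd_comp Hf Hg. Qed.

Lemma sd_pair (f : V -> W) (g : V -> U) x : sd f x -> sd g x -> sd (fun y => (f y, g y)) x.
Proof. by move=> [L Hf] [M Hg]; eexists; exact: is_sd_pair Hf Hg. Qed.

Lemma sd_lin (L : V -> W) x : bndlin L -> sd L x.
Proof. by exists L; exact: is_sd_lin. Qed.

End Theory2.

Section Theory3.
Variables (V W : normedModType K).

Lemma sd_fst (x : V * W) : sd fst x.
Proof.
apply: sd_lin; split => // ; exists 1 => // v; rewrite mul1r.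
exact: norm_fst_le.
Qed.

Lemma sd_snd (x : V * W) : sd snd x.
Proof.
apply: sd_lin; split => // ; exists 1 => // v; rewrite mul1r.
exact: norm_snd_le.
Qed.

Lemma sd_id (x : V) : sd id x.
Proof. by apply: sd_lin; split => //; exists 1 => // v; rewrite mul1r. Qed.

Lemma sdN (f : V -> W) x : sd f x -> sd (fun y => - f y) x.
Proof.
move=> Hf; apply: (sd_comp (g := -%R)) => //; apply: sd_lin; split => [a u v|].
  by rewrite opprD scalerN.
by exists 1 => // v; rewrite mul1r normrN.
Qed.

End Theory3.

Lemma is_sd_mulf (x : K * K) :
  is_sd (fun y : K * K => y.1 * y.2) x (fun v => x.1 * v.2 + x.2 * v.1).
Proof.
split.
  split => [a u v /=|].
    by rewrite !mulrDr !scalerDr addrACA !scalerAr.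
  exists (`|x.1| + `|x.2| + 1); first by rewrite ltr_wpDl// addr_ge0.
  move=> v; rewrite (le_trans (ler_normD _ _))// !normrM 2!mulrDl.
  rewrite mul1r -[leLHS]addr0; apply: lerD => //; apply: lerD; rewrite ler_wpM2l//.
    exact: norm_snd_le.
  exact: norm_fst_le.
move=> e e0; have e2 : 0 < e / 2 by rewrite divr_gt0.
have h1 : \forall p \near (x, x), `|p.1 - x| < e / 2.
  have : \forall y \near x, `|y - x| < e / 2.
    by apply/nbhs_normP; exists (e / 2) => //= y; rewrite distrC.
  exact: near_pair_fst.
have h2 : \forall p \near (x, x), `|p.2 - x| < e / 2.
  have : \forall y \near x, `|y - x| < e / 2.
    by apply/nbhs_normP; exists (e / 2) => //= y; rewrite distrC.
  exact: near_pair_snd.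
move: h1 h2; apply: filterS2 => -[[a b] [a' b']] /=.
move=> /ltW h1 /ltW h2.
have {}h1 : `|a - x.1| <= e / 2 by apply: le_trans h1; exact: (norm_fst_le ((a, b) - x)).
have {}h2 : `|b' - x.2| <= e / 2 by apply: le_trans h2; exact: (norm_snd_le ((a', b') - x)).
have -> : a * b - a' * b' - (x.1 * (b - b') + x.2 * (a - a')) =
  (a - x.1) * (b - b') + (b' - x.2) * (a - a').
  ring.
rewrite (le_trans (ler_normD _ _))// !normrM [e]splitr mulrDl.
apply: lerD; apply: ler_pM => //; first exact: (norm_snd_le ((a, b) - (a', b'))).
exact: (norm_fst_le ((a, b) - (a', b'))).
Qed.

Lemma sdM (V : normedModType K) (f g : V -> K) x :
  sd f x -> sd g x -> sd (fun y => f y * g y) x.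
Proof.
move=> Hf Hg; apply: (sd_comp (f := fun y => (f y, g y)) (g := fun y : K * K => y.1 * y.2)); first exact: sd_pair.
by eexists; exact: is_sd_mulf.
Qed.

Lemma near_neq0 (x : K) : x != 0 -> \forall y \near x, y != 0.
Proof.
move=> x0; apply/nbhs_normP; exists `|x|; rewrite /= ?normr_gt0// => y /=.
by apply: contraTneq => ->; rewrite subr0 ltxx.
Qed.

Lemma is_sd_inv (x : K) : x != 0 -> is_sd (fun y : K => y^-1) x (fun v => - (x ^- 2) * v).
Proof.
move=> x0; split.
  split => [a u v|]; first by rewrite mulrDr; congr (_ + _); rewrite /GRing.scale /= mulrCA.
  exists (`|x ^- 2|); first by rewrite normr_gt0 invr_eq0 expf_eq0.
  by move=> v; rewrite normrM normrN.
move=> e e0.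
have xn0 : \forall y \near x, y != 0 by exact: near_neq0.
have x1 : \forall p \near (x, x), p.1 != 0.
  exact: near_pair_fst xn0.
have x2 : \forall p \near (x, x), p.2 != 0.
  exact: near_pair_snd xn0.
have H : \forall p \near (x, x), `|(x ^- 2) - p.1^-1 * p.2^-1| <= e.
  have : (fun p : K * K => p.1^-1 * p.2^-1) p @[p --> (x, x)] --> x ^- 2.
    rewrite -exprVn expr2; apply: cvgM.
      by apply: cvgV => //; exact: cvg_fst.
    by apply: cvgV => //; exact: cvg_snd.
  by move/cvgrPdist_le/(_ _ e0).
move: x1 x2 H; apply: filterS3 => -[a b] /= a0 b0 H.
have -> : a^-1 - b^-1 - - x ^- 2 * (a - b) = (x ^- 2 - a^-1 * b^-1) * (a - b).
  by field; rewrite x0 a0 b0.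
by rewrite normrM ler_wpM2r.
Qed.

Lemma sdV (V : normedModType K) (f : V -> K) x :
  f x != 0 -> sd f x -> sd (fun y => (f y)^-1) x.
Proof.
move=> f0 Hf; apply: (sd_comp (f := f) (g := fun y : K => y^-1)) => //.
by eexists; exact: is_sd_inv.
Qed.

Lemma sdX (V : normedModType K) (f : V -> K) x n :
  sd f x -> sd (fun y => f y ^+ n) x.
Proof.
move=> Hf; elim: n => [|n IH]; first exact: sd_cst.
by under eq_fun do rewrite exprS; exact: sdM.
Qed.

Lemma sd_sum (V : normedModType K) (I : Type) (r : seq I) (f : I -> V -> K) x :
  (forall i, sd (f i) x) -> sd (fun y => \sum_(i <- r) f i y) x.
Proof.
move=> Hf; elim: r => [|i r IH].
  by under eq_fun do rewrite big_nil; exact: sd_cst.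
by under eq_fun do rewrite big_cons; exact: sdD.
Qed.

Lemma sd_fst_comp (V W U : normedModType K) (f : V -> W * U) x :
  sd f x -> sd (fun y => (f y).1) x.
Proof. by move=> Hf; apply: (sd_comp (f := f) (g := fst)) => //; exact: sd_fst. Qed.

Lemma sd_snd_comp (V W U : normedModType K) (f : V -> W * U) x :
  sd f x -> sd (fun y => (f y).2) x.
Proof. by move=> Hf; apply: (sd_comp (f := f) (g := snd)) => //; exact: sd_snd. Qed.

End StrictDifferentiability.

(** The shape of the function selects the rule. The nonvanishing conditions produced by [sdV] are
    left as goals. *)
Ltac sd_step := cbv beta; lazymatch goal with
  | |- is_true _ => fail
  | |- sd (fun y => y) _ => exact: sd_id
  | |- sd (fun y => (@?f y, @?g y)) _ => apply: (@sd_pair _ _ _ _ f g)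
  | |- sd (fun y => (@?f y).1) _ => apply: (@sd_fst_comp _ _ _ _ f)
  | |- sd (fun y => (@?f y).2) _ => apply: (@sd_snd_comp _ _ _ _ f)
  | |- sd (fun y => @?f y + @?g y) _ => apply: (@sdD _ _ _ f g)
  | |- sd (fun y => - @?f y) _ => apply: (@sdN _ _ _ f)
  | |- sd (fun y => @?f y * @?g y) _ => apply: (@sdM _ _ f g)
  | |- sd (fun y => @?f y ^+ ?n) _ => apply: (@sdX _ _ f)
  | |- sd (fun y => (@?f y)^-1) _ => apply: (@sdV _ _ f)
  | |- _ => exact: sd_cst
  end.

Ltac sd_auto := repeat sd_step.

(** * Strict differentiability and continuous derivatives *)

Section SdDifferential.
Variables (K : numFieldType) (V W : normedModType K).

Lemma diff_eps (f : V -> W) x e : differentiable f x -> 0 < e ->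
  \forall h \near 0, `|f (h + x) - f x - 'd f x h| <= e * `|h|.
Proof.
move=> /diff_locally/eqaddoP H e0; move: (H e e0); apply: filterS => h.
by rewrite /= !fctE /= opprD addrA.
Qed.

End SdDifferential.

Section SdDifferential2.
Variables (K : numFieldType) (V W : normedModType K).

Lemma near_translate (x v : V) (P : V * V -> Prop) :
  (\forall p \near (x, x), P p) -> \forall s \near (0 : K), P (x + s *: v, x).
Proof.
move=> H.
have c : {for (0 : K), continuous (fun s : K => (x + s *: v, x))}.
  apply: sd_continuous; apply: sd_pair; last exact: sd_cst.
  apply: sdD; first exact: sd_cst.
  apply: sd_lin; split; first by move=> a s t; rewrite scalerDl scalerA.
  by exists (`|v| + 1) => [|s]; rewrite ?ltr_wpDl// normrZ mulrC ler_wpM2r// lerDl.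
by apply: c; rewrite scale0r addr0.
Qed.

Lemma is_sd_dir (f : V -> W) x L v e : is_sd f x L -> 0 < e ->
  \forall s \near (0 : K), `|f (x + s *: v) - f x - s *: L v| <= e * (`|s| * `|v|).
Proof.
move=> [bL H] /H/(near_translate v); apply: filterS => s /=.
have -> : x + s *: v - x = s *: v by rewrite addrC addKr.
by rewrite (bndlinZ _ _ bL) normrZ.
Qed.

Lemma is_sd_diff (f : V -> W) x L : is_sd f x L ->
  differentiable f x /\ 'd f x = L :> (V -> W).
Proof.
move=> Hf; have [bL H] := Hf.
have linL : linear L by exact: bL.1.
pose l := GRing.isLinear.Build _ _ _ _ _ linL.
pose df : {linear V -> W} := HB.pack L l.
have dfc : continuous df by move=> y; apply: sd_continuous; exists L; exact: is_sd_lin.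
have E : f \o shift x = cst (f x) + df +o_0 id.
  apply/eqaddoP => e e0; have := H e e0.
  have c : {for (0 : V), continuous (fun h : V => (h + x, x))}.
    apply: sd_continuous; apply: sd_pair; last exact: sd_cst.
    by apply: sdD; [exact: sd_id|exact: sd_cst].
  rewrite -{1}[x]add0r.
  move=> /c H1; apply: (@filterS _ _ (nbhs_filter (0 : V)) _ _ _ H1) => h /=; rewrite addrK !fctE /=.
  by rewrite opprD addrA.
have dE := diff_unique dfc E; split => //.
by apply/diff_locallyP; rewrite dE.
Qed.

(** Strict differentiability at x controls the difference quotients at every base point y near x,
    with the same [L x]. Letting s tend to 0 in f (y + s v) - f y therefore bounds [L y v - L x v];
    this is the continuity of the partial derivatives. *)
Lemma is_sd_cvg (f : V -> W) x (L : V -> V -> W) v :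
  (\forall y \near x, is_sd f y (L y)) -> L y v @[y --> x] --> L x v.
Proof.
move=> Hf; have [bL H] := nbhs_singleton Hf.
apply/cvgrPdist_le => e e0.
have v1 : 0 < `|v| + 1 by rewrite ltr_wpDl.
have e1 : 0 < e / 2 / (`|v| + 1) by rewrite !divr_gt0.
have {}H : \forall y \near x, \forall p \near (y, y),
    `|f p.1 - f p.2 - L x (p.1 - p.2)| <= e / 2 / (`|v| + 1) * `|p.1 - p.2|.
  have := near_join (H _ e1) => H1.
  have c : {for x, continuous (fun y : V => (y, y))}.
    by apply: sd_continuous; apply: sd_pair; exact: sd_id.
  exact: (c _ H1).
move: Hf H; apply: filterS2 => y Hy Hx.
have H1 := is_sd_dir v Hy e1.
have {Hx}H2 := near_translate v Hx.
have : \forall s \near (0 : K)^', `|L x v - L y v| <= e.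
  have s0 : \forall s \near (0 : K)^', s != 0 by exact: nbhs_dnbhs_neq.
  move: (nbhs_dnbhs H1) (nbhs_dnbhs H2) s0; apply: filterS3 => s /= h1 h2 s0.
  rewrite -(ler_pM2l (_ : 0 < `|s|)) ?normr_gt0// -normrZ scalerBr.
  move: h2; have -> : y + s *: v - y = s *: v by rewrite addrC addKr.
  rewrite (bndlinZ _ _ bL) normrZ distrC => h2.
  rewrite -[s *: L x v](subrK (f (y + s *: v) - f y)) -addrA.
  rewrite (le_trans (ler_normD _ _))// (le_trans (lerD h2 h1))//.
  rewrite -mulrDl -mulrDl -splitr mulrCA ler_wpM2l//.
  by rewrite mulrAC ler_pdivrMr// ler_wpM2l ?(ltW e0)// lerDl.
by move=> /filter_ex[].
Qed.

End SdDifferential2.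

Section Holo.
Variables (R : realType) (K : numClosedFieldType) (E : complex_model R K).
Local Notation C2 := (K * K)%type.
Local Notation ofR := (cm_of E).
Local Notation nm := (cm_nm E).

Definition holoK (D : set C2) (f : C2 -> K) : Prop :=
  forall x, D x ->
    [/\ differentiable f x, {for x, continuous ('D_(1, 0) f)}
      & {for x, continuous ('D_(0, 1) f)}].


(** The mean value inequality is applied to f minus its linear part at x, along the segment from q
    to p. The derivative of this difference is the change of the two partial derivatives between x
    and the segment, which their continuity makes small. *)
Lemma holo_sd (D : set C2) (f : C2 -> K) : open D -> holoK D f ->
  forall x, D x -> sd f x.
Proof.
move=> oD hf x Dx; have [dx c1 c2] := hf x Dx.
have [A AE] : exists A, A = 'D_(1, 0) f by eexists.
have [B BE] : exists B, B = 'D_(0, 1) f by eexists.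
rewrite -AE in c1; rewrite -BE in c2.
have [l lE] : exists l : C2 -> C2 -> K, forall y v, l y v = v.1 * A y + v.2 * B y.
  by eexists.
have lP y a (u v : C2) : l y (a *: u + v) = a * l y u + l y v.
  by rewrite !lE /= /GRing.scale /=; ring.
have lZ y a (u : C2) : l y (a *: u) = a * l y u.
  by rewrite !lE /= /GRing.scale /=; ring.
have df y e : D y -> 0 < e -> \forall h \near (0 : C2), `|f (h + y) - f y - l y h| <= e * `|h|.
  move=> Dy e0; have [dy _ _] := hf y Dy.
  have dE v : 'd f y v = l y v.
    rewrite lE AE BE !deriveE//.
    have {1}-> : v = v.1 *: (1, 0) + v.2 *: (0, 1).
      case: v => a b; congr (_, _) => /=; rewrite /GRing.scale /=; ring.
    by rewrite linearD !linearZ.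
  by move: (diff_eps dy e0); apply: filterS => h; rewrite dE.
exists (l x); split.
  split; first exact: lP.
  exists (`|A x| + `|B x| + 1); first by rewrite ltr_wpDl// addr_ge0.
  move=> v; rewrite lE (le_trans (ler_normD _ _)) //.
  rewrite (normrM v.1) (normrM v.2) 2!mulrDl mul1r.
  rewrite -[leLHS]addr0; apply: lerD => //.
  by apply: lerD; rewrite mulrC ler_wpM2l//; [exact: norm_fst_le|exact: norm_snd_le].
move=> e e0.
(* Each partial derivative may change by e / 4, and the remainder of f at a point of the segment
   takes the other e / 2. *)
have e4 : 0 < e / 4 by rewrite divr_gt0.
have : \forall y \near x, [/\ D y, `|A x - A y| <= e / 4 & `|B x - B y| <= e / 4].
  move/cvgrPdist_le/(_ _ e4) : c1; move/cvgrPdist_le/(_ _ e4) : c2.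
  have : \forall y \near x, D y by exact: open_nbhs_nbhs.
  by apply: filterS3 => y *; split.
move=> /nbhs_normP[d /= d0 Hd].
have Hb : \forall y \near x, `|x - y| < d by apply/nbhs_normP; exists d.
move: (near_pair_fst Hb) (near_pair_snd Hb); apply: filterS2 => -[p q] /= hp hq.
have [v vE0] : exists v, v = p - q by eexists.
have [g gE'] : exists g : R -> K, forall t, g t = f (q + ofR t *: v) - ofR t * l x v.
  by eexists.
have gE : f p - f q - l x v = g 1 - g 0.
  have -> : f p = f (q + v) by rewrite vE0 [q + _]addrC subrK.
  rewrite !gE' (cm_of0 E) (cm_of1 E) scale1r scale0r mul0r mul1r subr0 addr0.
  by rewrite addrAC.
have [t0 t00 vE] : exists2 t0, 0 <= t0 & e * `|v| = ofR t0.
  by apply: (cm_ge0 E); rewrite mulr_ge0// ltW.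
rewrite -vE0 gE vE (cm_nmE E) (cm_of_le E) -[t0]mulr1 -[X in _ * X](subr0 1).
apply: (@cm_segment _ _ E g 0 1 t0) => //.
move=> t /andP[t1 t2].
have [y yE] : exists y, y = q + ofR t *: v by eexists.
have yd : `|x - y| < d.
  have -> : x - y = ofR (1 - t) *: (x - q) + ofR t *: (x - p).
    have gen (a b c : C2) : x - (q + (c - b)) = (x - q - (a - b)) + (a - c).
      by rewrite [- (a - b)]opprB (addrA (x - q) b (- a)) subrKA opprD opprB !addrA.
    by rewrite yE vE0 (cm_ofB E) (cm_of1 E) scalerBl scale1r !scalerBr; exact: gen.
  rewrite (le_lt_trans (ler_normD _ _))// !normrZ 2!(cm_of_norm E) !ger0_norm ?subr_ge0//.
  have -> : d = ofR (1 - t) * d + ofR t * d.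
    by rewrite -mulrDl -(cm_ofD E) subrK (cm_of1 E) mul1r.
  have [->|tn0] := eqVneq t 0.
    by rewrite subr0 (cm_of1 E) (cm_of0 E) !mul1r !mul0r !addr0.
  apply: ler_ltD; first by apply: ler_wpM2l; [rewrite -(cm_of0 E) (cm_of_le E) subr_ge0|exact: ltW].
  have t_gt0 : 0 < ofR t by rewrite -(cm_of0 E) (cm_of_lt E) lt_neqAle eq_sym tn0.
  by rewrite (ltr_pM2l t_gt0).
have [Dy hA hB] := Hd y yd.
have e2 : 0 < e / 2 by rewrite divr_gt0.
have c : ofR (s - t) *: v @[s --> t] --> (0 : C2).
  rewrite -(scale0r v); apply: cvgZl.
  have -> : 0 = ofR (t - t) by rewrite subrr (cm_of0 E).
  have H : continuous ofR := @cm_of_continuous _ _ E.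
  apply: (@cvg_comp _ _ _ (fun s => s - t) ofR _ (nbhs (t - t))); last exact: H.
  by apply: cvgB; [exact: cvg_id|exact: cvg_cst].
have H1 : \forall s \near t, `|f (ofR (s - t) *: v + y) - f y - l y (ofR (s - t) *: v)|
    <= e / 2 * `|ofR (s - t) *: v| by exact: (c _ (df _ _ Dy e2)).
move: H1; apply: filterS => s hs _.
rewrite -(cm_of_le E) -(cm_nmE E) (cm_ofM E) -vE -(cm_of_norm E).
have -> : g s - g t = (f (ofR (s - t) *: v + y) - f y - l y (ofR (s - t) *: v))
     + ofR (s - t) * (l y v - l x v).
  have -> : ofR (s - t) *: v + y = q + ofR s *: v.
    by rewrite yE addrCA -scalerDl -(cm_ofD E) subrK.
  by rewrite lZ !gE' -yE (cm_ofB E); ring.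
rewrite (le_trans (ler_normD _ _))//.
rewrite [e]splitr [_ * `|v|]mulrDl mulrDl; apply: lerD.
  by rewrite (le_trans hs)// normrZ mulrA mulrAC.
rewrite normrM mulrC; apply: ler_wpM2r => //; rewrite !lE.
have -> : v.1 * A y + v.2 * B y - (v.1 * A x + v.2 * B x) =
   - (v.1 * (A x - A y) + v.2 * (B x - B y)) by ring.
rewrite normrN (le_trans (ler_normD _ _))// (normrM v.1) (normrM v.2).
have -> : e / 2 * `|v| = `|v| * (e / 4) + `|v| * (e / 4) by field.
by apply: lerD; apply: ler_pM => //; [exact: norm_fst_le|exact: norm_snd_le].
Qed.

Lemma sd_holo (D : set C2) (f : C2 -> K) : open D ->
  (forall x, D x -> sd f x) -> holoK D f.
Proof.
move=> oD hf x Dx.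
have /choice[L HL] : forall y, exists l : C2 -> K, D y -> is_sd f y l.
  move=> y; have [/hf[l hl]|nDy] := pselect (D y); first by exists l.
  by exists (fun=> 0) => /nDy.
have nD : \forall y \near x, D y by exact: open_nbhs_nbhs.
have key v : {for x, continuous ('D_v f)}.
  have DE y : D y -> 'D_v f y = L y v.
    by move=> /HL/is_sd_diff[dy <-]; rewrite deriveE.
  rewrite /prop_for /continuous_at DE//.
  have H := @is_sd_cvg _ _ _ f x L v (filterS HL nD).
  have Hn : \forall y \near x, L y v = 'D_v f y.
    by move: nD; apply: filterS => y Dy; rewrite DE.
  have N := @near_eq_cvg _ _ (nbhs x) _ _ _ Hn.
  move=> P /H /N. exact.
split => //; exact: (is_sd_diff (HL x Dx)).1.
Qed.

End Holo.

(** * Averages over the circle and Cauchy's formula *)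

Section CircleAverage.
Variables (R : realType) (K : numClosedFieldType) (E : complex_model R K).
Implicit Types (f g : K -> K) (z w : K).

Definition sqrt_right z := if 0 <= 'Re (sqrtC z) then sqrtC z else - sqrtC z.

(** A root of unity of order 2^(n+1). Taking square roots in the right half plane forces convergence
    to 1. *)
Fixpoint dyadic_root n : K := if n is m.+1 then sqrt_right (dyadic_root m) else -1.
Local Notation rt := dyadic_root.

Lemma dyadic_root_sqr n : rt n.+1 ^+ 2 = rt n.
Proof. by rewrite /= /sqrt_right; case: ifP => _; rewrite ?sqrrN sqrtCK. Qed.

Lemma dyadic_root_norm n : `|rt n| = 1.
Proof.
elim: n => [|n IH]; first by rewrite /= normrN normr1.
by apply/eqP; rewrite -(@pexpr_eq1 _ _ 2)// -normrX dyadic_root_sqr IH.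
Qed.

Lemma dyadic_root_neq0 n : rt n != 0.
Proof. by rewrite -normr_gt0 dyadic_root_norm ltr01. Qed.

Lemma dyadic_root_neq1 n : rt n != 1.
Proof.
elim: n => [|n IH].
  by rewrite /= eq_sym -subr_eq0 opprK (_ : 1 + 1 = 2%:R)// pnatr_eq0.
by apply: contraNneq IH => h; rewrite -dyadic_root_sqr h expr1n.
Qed.

Lemma dyadic_root_Re n : 0 <= 'Re (rt n.+1).
Proof.
rewrite /= /sqrt_right; case: ifPn => //.
by rewrite raddfN /= oppr_ge0 -real_ltNge ?real0 ?Creal_Re// => /ltW.
Qed.

(** With w = [rt n.+1], factor w^2 - 1 = (w - 1)(w + 1). Here |w + 1|^2 = 2 + 2 Re w >= 2, and 4 / 3
    is a rational number below the square root of 2. *)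
Lemma dyadic_root_contract n : `|rt n.+1 - 1| <= 3 / 4 * `|rt n - 1|.
Proof.
have -> : rt n - 1 = (rt n.+1 - 1) * (rt n.+1 + 1).
  by rewrite -dyadic_root_sqr -subr_sqr expr1n.
rewrite normrM mulrCA ler_peMr//.
suff h : 4 / 3 <= `|rt n.+1 + 1|.
  apply: (@le_trans _ _ (3 / 4 * (4 / 3))); last by rewrite ler_wpM2l// divr_ge0.
  by rewrite le_eqVlt; apply/orP; left; apply/eqP; field.
rewrite -(@ler_pXn2r _ 2) ?nnegrE ?divr_ge0// normCK rmorphD rmorph1.
have -> : (rt n.+1 + 1) * ((rt n.+1)^* + 1) = 2 + 2 * 'Re (rt n.+1).
  have h : rt n.+1 * (rt n.+1)^* = 1 by rewrite -normCK dyadic_root_norm expr1n.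
  by rewrite ReE mulrDl !mulrDr h; field.
apply: (@le_trans _ _ 2); last by rewrite lerDl mulr_ge0// dyadic_root_Re.
rewrite -subr_ge0; have -> : 2 - (4 / 3) ^+ 2 = 2 / 9 :> K by field.
by rewrite divr_ge0.
Qed.

(* The tail of the series of the bounds 2 (3/4)^i for |rt i - 1|. *)
Definition bnd n : K := 8 * (3 / 4) ^+ n.

Lemma dyadic_root_bnd n : `|rt n - 1| <= bnd n - bnd n.+1.
Proof.
have e : bnd n - bnd n.+1 = 2 * (3 / 4) ^+ n by rewrite /bnd exprS; field.
rewrite e; elim: n {e} => [|n IH].
  by rewrite /= expr0 mulr1 -opprD normrN ger0_norm// addr_ge0.
rewrite (le_trans (dyadic_root_contract n))// exprS mulrCA ler_wpM2l//.
Qed.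

Lemma bnd_ge0 n : 0 <= bnd n.
Proof. by rewrite mulr_ge0// exprn_ge0// divr_ge0. Qed.

(* The mean of f over the 2^n-th roots of unity; its limit avg replaces the integral over the
   unit circle. *)
Fixpoint avgn n f : K :=
  if n is m.+1 then (avgn m f + avgn m (fun w => f (rt m * w))) / 2 else f 1.

Definition avg f : K := lim (avgn ^~ f @ \oo).

Lemma avgn_ext n f g : (forall w, `|w| = 1 -> f w = g w) -> avgn n f = avgn n g.
Proof.
elim: n f g => [|n IH] f g fg /=; first by rewrite fg ?normr1.
congr ((_ + _) / 2); apply: IH => // w w1.
by rewrite fg// normrM w1 dyadic_root_norm mulr1.
Qed.

Lemma avgnD n f g : avgn n (fun w => f w + g w) = avgn n f + avgn n g.
Proof.
elim: n f g => [|n IH] f g //=.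
by rewrite IH (IH (fun w => f (rt n * w))) -mulrDl addrACA.
Qed.

Lemma avgnZ n c f : avgn n (fun w => c * f w) = c * avgn n f.
Proof.
elim: n f => [|n IH] f //=.
by rewrite IH (IH (fun w => f (rt n * w))) -mulrDr mulrA.
Qed.

Lemma avgnB n f g : avgn n (fun w => f w - g w) = avgn n f - avgn n g.
Proof.
rewrite avgnD -mulN1r -avgnZ; congr (_ + _).
by apply: avgn_ext => w _; rewrite mulN1r.
Qed.

Lemma avgn_cst n c : avgn n (fun=> c) = c.
Proof. by elim: n => [|n IH] //=; rewrite IH; field. Qed.

Lemma avgn_le n f B : (forall w, `|w| = 1 -> `|f w| <= B) -> `|avgn n f| <= B.
Proof.
elim: n f => [|n IH] f fB /=; first by rewrite fB ?normr1.
rewrite normrM normfV (ger0_norm (_ : 0 <= 2))// ler_pdivrMr// mulr_natr mulr2n.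
rewrite (le_trans (ler_normD _ _))// lerD//; apply: IH => // w w1.
by apply: fB; rewrite normrM dyadic_root_norm w1 mulr1.
Qed.

(** The mean runs over a group that contains [rt n]. This invariance replaces the vanishing of the
    integral of a derivative over a closed curve. *)
Lemma avgn_rot n f : avgn n.+1 (fun w => f (rt n * w)) = avgn n.+1 f.
Proof.
elim: n f => [|n IH] f.
  by rewrite /= !mulr1 mulrNN mulr1 addrC.
have h : avgn n.+1 (fun w => f (rt n.+1 * (rt n.+1 * w))) = avgn n.+1 f.
  rewrite -[RHS]IH; apply: avgn_ext => w _.
  by rewrite mulrA -expr2 dyadic_root_sqr.
rewrite -[avgn n.+2 _]/((avgn n.+1 _ + avgn n.+1 _) / 2).
rewrite -[RHS]/((avgn n.+1 _ + avgn n.+1 _) / 2).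
by rewrite h addrC.
Qed.

Lemma avgn_rotV n f : avgn n.+1 (fun w => f ((rt n)^-1 * w)) = avgn n.+1 f.
Proof.
rewrite -avgn_rot; apply: avgn_ext => w _.
by rewrite mulKf// dyadic_root_neq0.
Qed.

Lemma avgn_inv n f : avgn n (fun w => f w^-1) = avgn n f.
Proof.
elim: n f => [|n IH] f /=; first by rewrite invr1.
rewrite IH; congr ((_ + _) / 2).
rewrite (_ : avgn n _ = avgn n (fun w => (fun v => f ((rt n)^-1 * v)) w^-1)); last first.
  by apply: avgn_ext => w _; rewrite invfM.
rewrite (IH (fun v => f ((rt n)^-1 * v))).
case: n IH => [_|n IH]; first by rewrite /= invrN invr1.
(* The inverse of [rt n.+1] is [rt n.+1] times the inverse of its square [rt n], and a rotation by
   the latter does not change [avgn n.+1]. *)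
rewrite -(avgn_rotV n (fun w => f (rt n.+1 * w))); apply: avgn_ext => w _.
congr (f _); rewrite mulrA; congr (_ * _).
by rewrite -[dyadic_root n]dyadic_root_sqr expr2 invfM mulrA mulfV ?dyadic_root_neq0// mul1r.
Qed.

Definition circle_cont f := forall w, `|w| = 1 -> {for w, continuous f}.

Lemma circle_sd_cont f : (forall w, `|w| = 1 -> sd f w) -> circle_cont f.
Proof. by move=> H w w1; apply: sd_continuous; exact: H. Qed.

Lemma circle_cont_cst c : circle_cont (fun=> c).
Proof. by apply: circle_sd_cont => w _; exact: sd_cst. Qed.

Lemma circle_contB f g : circle_cont f -> circle_cont g -> circle_cont (fun w => f w - g w).
Proof. by move=> cf cg w w1; exact: (cvgB (cf w w1) (cg w w1)). Qed.

Lemma circle_contD f g : circle_cont f -> circle_cont g -> circle_cont (fun w => f w + g w).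
Proof. by move=> cf cg w w1; exact: (cvgD (cf w w1) (cg w w1)). Qed.

Lemma circle_contZ c f : circle_cont f -> circle_cont (fun w => c * f w).
Proof.
move=> cf w w1; have h : {for w, continuous (fun=> c : K)} by exact: (circle_cont_cst w1).
exact: (cvgM h (cf w w1)).
Qed.

Lemma circle_cont_unif f e : circle_cont f -> 0 < e ->
  exists2 d, 0 < d & forall t w, `|w| = 1 -> `|t - 1| <= d -> `|f (t * w) - f w| <= e.
Proof.
move=> cf e0.
have /compact_near_coveringP H := cm_circle E.
have : \forall t \near (1 : K), [set w | `|w| = 1] `<=` (fun w => `|f (t * w) - f w| <= e).
  apply: (H K (nbhs (1 : K)) (fun t w => `|f (t * w) - f w| <= e) (nbhs_filter _)) => w /= w1.
  have e2 : 0 < e / 2 by rewrite divr_gt0.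
  have /cvgrPdist_le/(_ _ e2) fw := cf w w1.
  have c : {for (w, 1), continuous (fun p : K * K => p.2 * p.1)}.
    by apply: sd_continuous; apply: sdM; [exact: sd_snd|exact: sd_fst].
  have c' : {for (w, 1), continuous (fun p : K * K => p.1)}.
    by apply: sd_continuous; exact: sd_fst.
  have h1 : \forall p \near (w, (1 : K)), `|f w - f (p.2 * p.1)| <= e / 2.
    by have := c (fun u => `|f w - f u| <= e / 2); rewrite /= mul1r; apply.
  have h2 : \forall p \near (w, (1 : K)), `|f w - f p.1| <= e / 2 by exact: (c' (fun u => `|f w - f u| <= e / 2)).
  move: h1 h2; apply: filterS2 => -[v t] /= h1 h2.
  rewrite distrC [e]splitr (_ : f v - f (t * v) = (f w - f (t * v)) - (f w - f v)).
    by rewrite (le_trans (ler_normB _ _))// lerD.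
  by ring.
move=> /nbhs_normP[d /= d0 Hd]; exists (d / 2); first by rewrite divr_gt0.
move=> t w w1 td; apply: (Hd t _ w) => //=.
by rewrite distrC (le_lt_trans td)// ltr_pdivrMr// ltr_pMr// ltr1n.
Qed.

(** Each refinement of the mean doubles the nodes, one copy being turned by [rt (n + d)]. The factor
    t accumulates these turns, and their total stays within the telescoping sum
    [bnd n - bnd (n + d)], so every node of the finer mean is close to a node of the coarser one. *)
Lemma avgn_cauchy n d f e r : (forall t w, `|w| = 1 -> `|t - 1| <= r -> `|f (t * w) - f w| <= e) ->
  forall t, `|t| = 1 -> `|t - 1| + (bnd n - bnd (n + d)) <= r ->
  `|avgn (n + d) (fun w => f (t * w)) - avgn n f| <= e.
Proof.
move=> H; elim: d => [|d IH] t t1 ht.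
  rewrite addn0 -avgnB; apply: avgn_le => w w1; apply: H => //.
  by move: ht; rewrite addn0 subrr addr0.
rewrite addnS /=.
have -> : (avgn (n + d) (fun w => f (t * w)) + avgn (n + d) (fun w => f (t * (rt (n + d) * w)))) / 2
     - avgn n f =
  ((avgn (n + d) (fun w => f (t * w)) - avgn n f) +
   (avgn (n + d) (fun w => f (t * (rt (n + d) * w))) - avgn n f)) / 2 by field.
rewrite normrM normfV (ger0_norm (_ : 0 <= 2))// ler_pdivrMr// mulr_natr mulr2n.
have b1 := dyadic_root_bnd (n + d).
have b0 : 0 <= bnd (n + d) - bnd (n + d).+1 by apply: le_trans b1.
rewrite (le_trans (ler_normD _ _))// lerD//.
  apply: IH => //; apply: le_trans ht; rewrite lerD2l addnS.
  by rewrite lerD2l lerN2 -subr_ge0.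
rewrite (@avgn_ext _ _ (fun w => f ((t * rt (n + d)) * w))); last by move=> w _; rewrite mulrA.
apply: IH; first by rewrite normrM t1 dyadic_root_norm mulr1.
apply: le_trans ht; rewrite addnS.
have -> : t * rt (n + d) - 1 = t * (rt (n + d) - 1) + (t - 1) by ring.
rewrite (le_trans (lerD (ler_normD _ _) (lexx _)))// normrM t1 mul1r.
rewrite -subr_ge0 (_ : _ - _ = bnd (n + d) - bnd (n + d).+1 - `|rt (n + d) - 1|).
  by rewrite subr_ge0.
by move: `|rt _ - _| => u; ring.
Qed.

Lemma bnd_cvg : bnd n @[n --> \oo] --> 0.
Proof.
have ofn n : cm_of E n%:R = n%:R.
  by elim: n => [|n IH]; rewrite ?(cm_of0 E)// -natr1 (cm_ofD E) IH (cm_of1 E) natr1.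
have q : cm_of E (3 / 4) = 3 / 4.
  by apply: (mulIf (x := 4)); rewrite ?pnatr_eq0// divfK ?pnatr_eq0// -(ofn 4) -(cm_ofM E) divfK ?pnatr_eq0// ofn.
have e n : bnd n = cm_of E (8 * (3 / 4) ^+ n).
  rewrite (cm_ofM E) ofn /bnd; congr (_ * _).
  by elim: n => [|n IH]; rewrite ?expr0 ?(cm_of1 E)// !exprS (cm_ofM E) q IH.
rewrite (_ : bnd = (fun n => cm_of E (8 * (3 / 4) ^+ n))); last exact/funext.
rewrite -(cm_of0 E).
have H : continuous (cm_of E) := @cm_of_continuous _ _ E.
apply: (@cvg_comp _ _ _ _ (cm_of E) _ (nbhs (0 : R))); last exact: H.
suff : (8 * (3 / 4) ^+ n : R) @[n --> \oo] --> (8 * 0 : R) by rewrite mulr0.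
apply: cvgMr; apply: cvg_expr; rewrite ger0_norm ?divr_ge0// ltr_pdivrMr// mul1r ltr_nat.
by [].
Qed.

Lemma avg_cvg f : circle_cont f -> avgn ^~ f @ \oo --> avg f.
Proof.
move=> cf; apply: (cm_cauchy E) => e e0.
have [d d0 Hd] := circle_cont_unif cf e0.
have /cvgrPdist_le/(_ _ d0)[N _ HN] := bnd_cvg.
exists N => n Nn; rewrite -(subnKC Nn).
rewrite (@avgn_ext _ _ (fun w => f (1 * w))); last by move=> w _; rewrite mul1r.
apply: (avgn_cauchy Hd); first by rewrite normr1.
have := HN N (leqnn _); rewrite /= sub0r normrN (ger0_norm (bnd_ge0 _)).
by apply: le_trans; rewrite subrr normr0 add0r gerBl bnd_ge0.
Qed.

Lemma avg_lim f l : avgn ^~ f @ \oo --> l -> avg f = l.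
Proof. by move=> h; apply: cvg_lim; first exact: norm_hausdorff. Qed.

Lemma avg_ext f g : (forall w, `|w| = 1 -> f w = g w) -> avg f = avg g.
Proof.
move=> fg; rewrite /avg (_ : avgn ^~ f = avgn ^~ g)//.
by apply/funext => n; exact: avgn_ext.
Qed.

Lemma avg_inv f : avg (fun w => f w^-1) = avg f.
Proof.
rewrite /avg (_ : avgn ^~ (fun w => f w^-1) = avgn ^~ f)//.
by apply/funext => n; exact: avgn_inv.
Qed.

Lemma avg_cst c : avg (fun=> c) = c.
Proof. by apply: avg_lim; under eq_fun do rewrite avgn_cst; exact: cvg_cst. Qed.

Lemma avgD f g : circle_cont f -> circle_cont g ->
  avg (fun w => f w + g w) = avg f + avg g.
Proof.
move=> cf cg; apply: avg_lim; under eq_fun do rewrite avgnD.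
by apply: cvgD; exact: avg_cvg.
Qed.

Lemma avgB f g : circle_cont f -> circle_cont g ->
  avg (fun w => f w - g w) = avg f - avg g.
Proof.
move=> cf cg; apply: avg_lim; under eq_fun do rewrite avgnB.
by apply: cvgB; exact: avg_cvg.
Qed.

Lemma avgZ c f : circle_cont f -> avg (fun w => c * f w) = c * avg f.
Proof.
move=> cf; apply: avg_lim; under eq_fun do rewrite avgnZ.
by apply: cvgMr; exact: avg_cvg.
Qed.

(** Since the means converge, a bound along arbitrarily large n is enough. In [contour_avg_lip] the
    estimate is available only when [rt n] is close to 1. *)
Lemma avg_le_frequently f B : circle_cont f -> 0 <= B ->
  (forall N, exists2 n, (N <= n)%N & `|avgn n f| <= B) -> `|avg f| <= B.
Proof.
move=> cf B0 fB.
have [b b0 bE] := cm_ge0 E B0.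
rewrite (cm_nmE E) bE (cm_of_le E); apply/ler_addgt0Pr => e e0.
rewrite -(cm_of_le E) (cm_ofD E) -bE -(cm_nmE E).
have e0' : 0 < cm_of E e by rewrite -(cm_of0 E) (cm_of_lt E).
have := avg_cvg cf; move=> /cvgrPdist_le/(_ _ e0')[N _ HN].
have [n /HN/= h hB] := fB N.
by rewrite -[avg f](subrK (avgn n f)) addrC (le_trans (ler_normD _ _))// lerD.
Qed.

Lemma avg_le f B : circle_cont f -> (forall w, `|w| = 1 -> `|f w| <= B) -> `|avg f| <= B.
Proof.
move=> cf fB; have B0 : 0 <= B by apply: le_trans (fB 1 _); rewrite ?normr1.
by apply: avg_le_frequently => // N; exists N => //; exact: avgn_le.
Qed.

End CircleAverage.

Section Cauchy.
Variables (R : realType) (K : numClosedFieldType) (E : complex_model R K).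
Implicit Types (f : K -> K) (z w r : K).
Local Notation rt := (dyadic_root K).

Section Homotopy.
Variables (f : K -> K) (z r : K).
Hypothesis zr : `|z| < `|r|.

(* Cauchy's formula: the average of f (contour t w) * kern w does not depend on t in [0, 1],
   and contour 0 is the constant z. *)
Definition contour (t w : K) := z + t * (r * w - z).
Definition kern w := r * w / (r * w - z).

Lemma contour_neq0 w : `|w| = 1 -> r * w - z != 0.
Proof.
move=> w1; rewrite subr_eq0; apply/eqP => h; move: zr.
by rewrite -h normrM w1 mulr1 ltxx.
Qed.

Lemma sd_kern w : `|w| = 1 -> sd kern w.
Proof. move=> w1; rewrite /kern; sd_auto; exact: contour_neq0. Qed.

Lemma sd_contour t w : sd (contour t) w.
Proof. by rewrite /contour; sd_auto. Qed.

Lemma circle_cont_contour t : (forall w, `|w| = 1 -> sd f (contour t w)) ->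
  circle_cont (fun w => f (contour t w) * kern w).
Proof.
move=> H; apply: circle_sd_cont => w w1; apply: sdM; last exact: sd_kern.
by apply: (sd_comp (f := contour t) (g := f)); [exact: sd_contour|exact: H].
Qed.

(** Write s = p.1 and c = p.2. To first order both terms equal (s - t) t (c - 1) r w f'(contour t
    w): moving t produces the factor r w - z, turning w produces t r w, and [kern] is the ratio r w
    / (r w - z) that matches them. Compactness of the circle makes the estimate uniform in w. *)
Lemma contour_unif t e : (forall w, `|w| = 1 -> sd f (contour t w)) -> 0 < e ->
  \forall p \near (t, (1 : K)), forall w, `|w| = 1 ->
  `|t * (p.2 - 1) * ((f (contour p.1 w) - f (contour t w)) * kern w)
     - (p.1 - t) * (f (contour t (p.2 * w)) - f (contour t w))| <= e * (`|p.1 - t| * `|p.2 - 1|).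
Proof.
move=> fsd e0.
have /compact_near_coveringP H := cm_circle E.
pose P (p : K * K) w := `|t * (p.2 - 1) * ((f (contour p.1 w) - f (contour t w)) * kern w)
     - (p.1 - t) * (f (contour t (p.2 * w)) - f (contour t w))| <= e * (`|p.1 - t| * `|p.2 - 1|).
suff : \forall p \near (t, (1 : K)), [set w | `|w| = 1] `<=` P p by [].
apply: (H (K * K)%type (nbhs (t, (1 : K))) P (nbhs_filter _)) => w0 /= w1; rewrite {}/P.
have [L [bL Hf]] := fsd _ w1.
(* The remainders of the two increments of f contribute 2 |t| |r| each, as |w| <= 2 near the circle;
   the summand 1 keeps [d] positive. *)
have [d dE] : exists d, d = 4 * `|t| * `|r| + 1 by eexists.
have d0 : 0 < d by rewrite dE ltr_wpDl// !mulr_ge0.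
have e1 : 0 < e / d by rewrite divr_gt0.
have LE (v : K) : L v = v * L 1.
  by have := @bndlinZ K _ _ L v 1 bL; rewrite /GRing.scale /= mulr1.
have c1 : {for (w0, (t, 1)), continuous (fun q : K * (K * K) => (contour q.2.1 q.1, contour t q.1))}.
  by apply: sd_continuous; rewrite /contour; sd_auto.
have c2 : {for (w0, (t, 1)), continuous (fun q : K * (K * K) => (contour t (q.2.2 * q.1), contour t q.1))}.
  by apply: sd_continuous; rewrite /contour; sd_auto.
have h1 : \forall q \near (w0, (t, (1 : K))),
   `|f (contour q.2.1 q.1) - f (contour t q.1) - L (contour q.2.1 q.1 - contour t q.1)| <=
     e / d * `|contour q.2.1 q.1 - contour t q.1|.
  by have := c1 (fun p => `|f p.1 - f p.2 - L (p.1 - p.2)| <= e / d * `|p.1 - p.2|); apply; exact: Hf.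
have h2 : \forall q \near (w0, (t, (1 : K))),
   `|f (contour t (q.2.2 * q.1)) - f (contour t q.1) - L (contour t (q.2.2 * q.1) - contour t q.1)| <=
     e / d * `|contour t (q.2.2 * q.1) - contour t q.1|.
  have := c2 (fun p => `|f p.1 - f p.2 - L (p.1 - p.2)| <= e / d * `|p.1 - p.2|).
  by rewrite /= mul1r; apply; exact: Hf.
have h3 : \forall q \near (w0, (t, (1 : K))), r * q.1 - z != 0.
  have c3 : {for (w0, (t, (1 : K))), continuous (fun q : K * (K * K) => r * q.1 - z)}.
    by apply: sd_continuous; sd_auto.
  exact: (c3 (fun u => u != 0) (near_neq0 (contour_neq0 w1))).
have h4 : \forall q \near (w0, (t, (1 : K))), `|q.1| <= 2.
  have c3 : {for (w0, (t, (1 : K))), continuous (fun q : K * (K * K) => q.1)}.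
    by apply: sd_continuous; sd_auto.
  have : \forall u \near w0, `|u| <= 2.
    apply/nbhs_normP; exists 1; rewrite //= => u /= /ltW h.
    have -> : u = w0 - (w0 - u) by rewrite opprB addrC subrK.
    by rewrite (le_trans (ler_normB _ _))// w1 (_ : 2 = 1 + 1)// lerD2l.
  exact: (c3 (fun u => `|u| <= 2)).
have h34 : \forall q \near (w0, (t, (1 : K))), r * q.1 - z != 0 /\ `|q.1| <= 2.
  by move: h3 h4; apply: filterS2 => q; split.
move: h34 h1 h2; apply: filterS3 => -[w [s c]] /= [h3' h4'].
have -> : contour s w - contour t w = (s - t) * (r * w - z) by rewrite /contour; ring.
have -> : contour t (c * w) - contour t w = t * r * w * (c - 1) by rewrite /contour; ring.
rewrite (LE ((s - t) * _)) (LE (_ * (c - 1))) => h1 h2.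
have -> : t * (c - 1) * ((f (contour s w) - f (contour t w)) * kern w)
    - (s - t) * (f (contour t (c * w)) - f (contour t w)) =
    t * (c - 1) * kern w * (f (contour s w) - f (contour t w) - (s - t) * (r * w - z) * L 1)
    - (s - t) * (f (contour t (c * w)) - f (contour t w) - t * r * w * (c - 1) * L 1).
  by rewrite /kern; field.
rewrite (le_trans (ler_normB _ _))//.
have -> : e * (`|s - t| * `|c - 1|) = e / d * (4 * `|t| * `|r| + 1) * (`|s - t| * `|c - 1|).
  by rewrite -dE divfK// gt_eqF.
apply: (@le_trans _ _ (e / d * (2 * `|t| * `|r|) * (`|s - t| * `|c - 1|)
   + e / d * (2 * `|t| * `|r|) * (`|s - t| * `|c - 1|))); last first.
  rewrite -mulrDl -mulrDr; apply: ler_wpM2r; first by rewrite mulr_ge0.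
  apply: ler_wpM2l; first exact: ltW.
  by rewrite -subr_ge0 [X in 0 <= X](_ : _ = 1) ?ler01//; move: `|t| `|r| => a b; ring.
apply: lerD.
  have -> : e / d * (2 * `|t| * `|r|) * (`|s - t| * `|c - 1|) =
    `|t * (c - 1)| * (e / d * `|s - t| * (2 * `|r|)).
    by rewrite normrM; move: `|t| `|r| `|s - t| `|c - 1| => a b a' b'; ring.
  rewrite normrM normrM -mulrA; apply: ler_wpM2l => //.
  rewrite (le_trans (ler_wpM2l _ h1))//.
  have -> : `|kern w| * (e / d * `|(s - t) * (r * w - z)|) =
    e / d * `|s - t| * (`|kern w| * `|r * w - z|).
    by rewrite (normrM (s - t)); move: `|kern w| `|s - t| `|r * w - z| => a b a'; ring.
  apply: ler_wpM2l; first by rewrite mulr_ge0// ltW.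
  rewrite -normrM /kern divfK// normrM mulrC; exact: ler_wpM2r.
rewrite normrM.
have -> : e / d * (2 * `|t| * `|r|) * (`|s - t| * `|c - 1|) =
    `|s - t| * (e / d * (`|t| * `|r| * 2 * `|c - 1|)).
  by move: `|t| `|r| `|s - t| `|c - 1| => a b a' b'; ring.
apply: ler_wpM2l => //; rewrite (le_trans h2)//.
apply: ler_wpM2l; first exact: ltW.
rewrite !normrM; apply: ler_wpM2r => //; exact: ler_wpM2l.
Qed.

Definition contour_avg t := avg (fun w => f (contour t w) * kern w).

(** The derivative in t is zero: by [contour_unif], the increment multiplied by t (rt n - 1) is
    close to a difference between a function and its rotation by [rt n], whose mean is 0. Dividing
    by this factor requires t != 0. *)
Lemma contour_avg_lip t e : t != 0 -> (forall w, `|w| = 1 -> sd f (contour t w)) ->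
  0 < e -> \forall s \near t, (forall w, `|w| = 1 -> sd f (contour s w)) ->
  `|contour_avg s - contour_avg t| <= e * `|s - t|.
Proof.
move=> t0 ft e0.
have nt0 : 0 < `|t| by rewrite normr_gt0.
have et0 : 0 < e * `|t| by rewrite mulr_gt0.
have /nbhs_normP[d /= d0 Hd] := contour_unif ft et0.
apply/nbhs_normP; exists d => // s /= hs fs.
have cs := circle_cont_contour fs; have ct := circle_cont_contour ft.
rewrite /contour_avg -(avgB E)//.
apply: (avg_le_frequently E).
- exact: circle_contB.
- by rewrite mulr_ge0// ltW.
move=> N.
have /cvgrPdist_lt/(_ _ d0)[N' _ HN'] := bnd_cvg E.
exists (maxn N N').+1; first by rewrite leqW// leq_maxl.
set n := maxn N N'.
have c1 : rt n - 1 != 0 by rewrite subr_eq0 dyadic_root_neq1.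
have cd : `|rt n - 1| < d.
  apply: le_lt_trans (dyadic_root_bnd K n) _.
  have := HN' n (leq_maxr _ _); rewrite /= sub0r normrN ger0_norm ?bnd_ge0//.
  by apply: le_lt_trans; rewrite gerBl bnd_ge0.
have pd : `|(t, 1) - (s, rt n)| < d.
  by apply: prod_norm_lt => //=; rewrite distrC.
have H := Hd (s, rt n) pd.
have k0 : 0 < `|t| * `|rt n - 1| by rewrite mulr_gt0// normr_gt0.
rewrite -(ler_pM2l k0) -normrM -normrM -avgnZ.
have -> : `|t * (rt n - 1)| * (e * `|s - t|) = e * `|t| * (`|s - t| * `|rt n - 1|).
  by rewrite normrM; move: `|t| `|rt n - 1| `|s - t| => a b c; ring.
have rot0 : avgn n.+1 (fun w => (s - t) * (f (contour t (rt n * w)) - f (contour t w))) = 0.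
  by rewrite avgnZ avgnB (avgn_rot n (fun w => f (contour t w))) subrr mulr0.
rewrite -[avgn _ _]subr0 -rot0 -avgnB.
apply: avgn_le => w w1; have := H w w1; rewrite /=.
by rewrite -mulrBl.
Qed.

Lemma avg_homotopy_pos (a b : R) : 0 < a -> a <= b ->
  (forall t w, a <= t <= b -> `|w| = 1 -> sd f (contour (cm_of E t) w)) ->
  contour_avg (cm_of E b) = contour_avg (cm_of E a).
Proof.
move=> a0 ab fsd; apply/eqP; rewrite -subr_eq0 -normr_eq0 (cm_nmE E).
set N := cm_nm E _; suff : N <= 0.
  move=> N0; rewrite eq_le -{1}(cm_of0 E) (cm_of_le E) N0 /=.
  by rewrite /N -(cm_nmE E).
apply/ler_addgt0Pr => e e0; rewrite add0r.
have d0 : 0 < b - a + 1 by rewrite ltr_wpDl// subr_ge0.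
apply: (@le_trans _ _ (e / (b - a + 1) * (b - a))); last first.
  by rewrite mulrAC ler_pdivrMr// ler_wpM2l ?(ltW e0)// lerDl.
apply: (@cm_segment _ _ E (fun t => contour_avg (cm_of E t))) => //.
  by rewrite divr_ge0// ltW.
move=> t tab.
have t0 : cm_of E t != 0.
  have : 0 < cm_of E t.
    by rewrite -(cm_of0 E) (cm_of_lt E) (lt_le_trans a0)//; case/andP: tab.
  by rewrite lt0r => /andP[].
have e1 : 0 < cm_of E (e / (b - a + 1)) by rewrite -(cm_of0 E) (cm_of_lt E) divr_gt0.
have H := contour_avg_lip t0 (fun w => fsd t w tab) e1.
have c : continuous (cm_of E) := @cm_of_continuous _ _ E.
have : \forall s \near t, (forall w, `|w| = 1 -> sd f (contour (cm_of E s) w)) ->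
  `|contour_avg (cm_of E s) - contour_avg (cm_of E t)|
     <= cm_of E (e / (b - a + 1)) * `|cm_of E s - cm_of E t| by exact: (c t _ H).
apply: filterS => s Hs sab.
have {Hs} := Hs (fun w => fsd s w sab).
by rewrite -(cm_ofB E) (cm_of_norm E) -(cm_ofM E) (cm_nmE E) (cm_of_le E).
Qed.

Lemma contour_avg_le t c e :
  (forall w, `|w| = 1 -> sd f (contour t w)) ->
  (forall w, `|w| = 1 -> `|f (contour t w) - c| <= e) ->
  `|contour_avg t - c * avg kern| <= e * (`|r| / (`|r| - `|z|)).
Proof.
move=> fsd fe; have ck : circle_cont kern by apply: circle_sd_cont; exact: sd_kern.
have cf := circle_cont_contour fsd.
rewrite -(avgZ E)// /contour_avg -(avgB E)//; last first.
  by apply: circle_sd_cont => w w1; apply: sdM; [exact: sd_cst|exact: sd_kern].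
apply: (avg_le E).
  apply: circle_contB => //.
  by apply: circle_sd_cont => w w1; apply: sdM; [exact: sd_cst|exact: sd_kern].
move=> w w1; rewrite -mulrBl normrM; apply: ler_pM => //; first exact: fe.
rewrite /kern normrM normfV normrM w1 mulr1; apply: ler_wpM2l => //.
rewrite lef_pV2 ?posrE ?subr_gt0// ?normr_gt0 ?contour_neq0//.
have -> : `|r| = `|r * w| by rewrite normrM w1 mulr1.
exact: lerB_dist.
Qed.

(** The endpoint t = 0 of the homotopy is reached by continuity of f at z: for small t the contour
    is so close to z that f is nearly constant on it. *)
Lemma avg_homotopy : sd f z ->
  (forall t w, 0 <= t <= 1 -> `|w| = 1 -> sd f (contour (cm_of E t) w)) ->
  contour_avg 1 = f z * avg kern.
Proof.
move=> fz fsd.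
have cst t : 0 < t -> t <= 1 -> contour_avg 1 = contour_avg (cm_of E t).
  move=> t0 t1; rewrite -(cm_of1 E); apply: avg_homotopy_pos => // s w /andP[ts s1] w1.
  by apply: fsd => //; rewrite s1 (le_trans (ltW t0)).
apply/eqP; rewrite -subr_eq0 -normr_eq0 (cm_nmE E).
set N := cm_nm E _; suff : N <= 0.
  move=> N0; rewrite eq_le -{1}(cm_of0 E) (cm_of_le E) N0 /=.
  by rewrite /N -(cm_nmE E).
have B0 : 0 < `|r| - `|z| by rewrite subr_gt0.
have r0 : 0 < `|r| by apply: le_lt_trans zr.
apply/ler_addgt0Pr => e e0; rewrite add0r -(cm_of_le E) -(cm_nmE E).
have e1 : 0 < cm_of E e by rewrite -(cm_of0 E) (cm_of_lt E).
have e2 : 0 < cm_of E e / (`|r| / (`|r| - `|z|)) by rewrite !divr_gt0.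
have := sd_continuous fz; move=> /cvgrPdist_le/(_ _ e2)/nbhs_normP[d0 /= d00 Hd].
have rz0 : 0 < `|r| + `|z| by rewrite ltr_wpDr.
have [d dE] : exists d, d0 / (`|r| + `|z|) = cm_of E d.
  have [d dg dE] := cm_ge0 E (ltW (divr_gt0 d00 rz0)); by exists d.
have dp : 0 < d by rewrite -(cm_of_lt E) (cm_of0 E) -dE divr_gt0.
pose t := Num.min 1 (d / 2).
have t0 : 0 < t by rewrite lt_min ltr01 divr_gt0.
have t1 : t <= 1 by rewrite ge_min lexx.
rewrite (cst t)// -[leRHS](divfK (_ : `|r| / (`|r| - `|z|) != 0)); last first.
  by rewrite mulf_neq0 ?invr_eq0// gt_eqF.
apply: contour_avg_le => w w1; first by apply: fsd; rewrite // t1 ltW.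
rewrite distrC; apply: Hd => /=.
rewrite /contour opprD addrA subrr sub0r normrN normrM (cm_of_norm E) (ger0_norm (ltW t0)).
apply: (@le_lt_trans _ _ (cm_of E t * (`|r| + `|z|))).
  apply: ler_wpM2l; first by rewrite -(cm_of0 E) (cm_of_le E) ltW.
  by rewrite (le_trans (ler_normB _ _))// normrM w1 mulr1.
rewrite -ltr_pdivlMr// dE (cm_of_lt E).
by rewrite gt_min ltr_pdivrMr// ltr_pMr// ltr1n orbT.
Qed.

End Homotopy.

Lemma avg_mean f : (forall w, `|w| <= 1 -> sd f w) -> avg f = f 0.
Proof.
move=> fsd.
have z1 : `|0 : K| < `|1| by rewrite normr0 normr1 ltr01.
have cE t w : contour 0 1 t w = t * w by rewrite /contour mul1r subr0 add0r.
have kE w : `|w| = 1 -> kern 0 1 w = 1.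
  by move=> w1; rewrite /kern mul1r subr0 divff// -normr_gt0 w1.
have f0 : sd f 0 by apply: fsd; rewrite normr0.
have fc t w : 0 <= t <= 1 -> `|w| = 1 -> sd f (contour 0 1 (cm_of E t) w).
  move=> /andP[t0 t1] w1; rewrite cE; apply: fsd.
  by rewrite normrM w1 mulr1 (cm_of_norm E) ger0_norm// -(cm_of1 E) (cm_of_le E).
have := avg_homotopy z1 f0 fc.
rewrite (avg_ext (g := fun=> 1))// avg_cst mulr1 => <-.
by apply: avg_ext => w w1; rewrite cE kE// mulr1 mul1r.
Qed.

(** On the unit circle, [kern z r w] is 1 / (1 - (z / r) w^-1). As a function of w^-1 it is
    holomorphic on the closed unit disc with value 1 at 0, and averages are invariant under
    inversion. *)
Lemma avg_kern z r : `|z| < `|r| -> avg (kern z r) = 1.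
Proof.
move=> zr; have r0 : r != 0 by rewrite -normr_gt0; apply: le_lt_trans zr.
have nz w : `|w| <= 1 -> 1 - z / r * w != 0.
  move=> w1; rewrite subr_eq0; apply/eqP => h.
  have : `|z / r * w| < 1.
    rewrite normrM normf_div -[X in _ < X](mulr1 1).
    apply: (@le_lt_trans _ _ (`|z| / `|r| * 1)); first by apply: ler_wpM2l; rewrite ?divr_ge0.
    by rewrite !mulr1 ltr_pdivrMr ?mul1r// normr_gt0.
  by rewrite -h normr1 ltxx.
rewrite (avg_ext (g := fun w => (fun v => (1 - z / r * v)^-1) w^-1)); last first.
  move=> w w1; rewrite /kern.
  have w0 : w != 0 by rewrite -normr_gt0 w1.
  have h1 := contour_neq0 zr w1; field.
  by rewrite w0 r0 h1.
rewrite (avg_inv (fun v => (1 - z / r * v)^-1)) avg_mean; first by rewrite mulr0 subr0 invr1.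
by move=> w w1; sd_auto; first [exact: nz | exact: r0].
Qed.

Lemma cauchy_formula f z r : 0 < r -> `|z| < r -> (forall w, `|w| <= r -> sd f w) ->
  f z = avg (fun w => f (r * w) * (r * w / (r * w - z))).
Proof.
move=> r0 zr fsd.
have zr' : `|z| < `|r| by rewrite (ger0_norm (ltW r0)).
have fz : sd f z by apply: fsd; exact: ltW.
have fc t w : 0 <= t <= 1 -> `|w| = 1 -> sd f (contour z r (cm_of E t) w).
  move=> /andP[t0 t1] w1; apply: fsd.
  have -> : contour z r (cm_of E t) w = cm_of E (1 - t) * z + cm_of E t * (r * w).
    by rewrite /contour (cm_ofB E) (cm_of1 E); ring.
  rewrite (le_trans (ler_normD _ _))// !normrM w1 2!(cm_of_norm E).
  rewrite (ger0_norm (_ : 0 <= 1 - t)) ?subr_ge0// (ger0_norm t0) (ger0_norm (ltW r0)) mulr1.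
  apply: (@le_trans _ _ (cm_of E (1 - t) * r + cm_of E t * r)).
    apply: lerD => //; apply: ler_wpM2l; last exact: ltW.
    by rewrite -(cm_of0 E) (cm_of_le E) subr_ge0.
  by rewrite -mulrDl -(cm_ofD E) subrK (cm_of1 E) mul1r.
have := avg_homotopy zr' fz fc; rewrite avg_kern// mulr1 => <-.
by apply: avg_ext => w w1; rewrite /contour /kern mul1r addrC subrK.
Qed.

(** For z = 0 and r = 1 the contour at time t is the circle of radius t and the kernel is 1. *)
Lemma avg_annulus f (a b : R) : 0 < a -> a <= b ->
  (forall w, cm_of E a <= `|w| <= cm_of E b -> sd f w) ->
  avg (fun w => f (cm_of E b * w)) = avg (fun w => f (cm_of E a * w)).
Proof.
move=> a0 ab fsd.
have z1 : `|0 : K| < `|1| by rewrite normr0 normr1 ltr01.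
have cE t w : contour 0 1 t w = t * w by rewrite /contour mul1r subr0 add0r.
have kE w : `|w| = 1 -> kern 0 1 w = 1.
  by move=> w1; rewrite /kern mul1r subr0 divff// -normr_gt0 w1.
have fc t w : a <= t <= b -> `|w| = 1 -> sd f (contour 0 1 (cm_of E t) w).
  move=> /andP[t0 t1] w1; rewrite cE; apply: fsd.
  rewrite normrM w1 mulr1 (cm_of_norm E) ger0_norm; last by apply: le_trans t0; exact: ltW.
  by rewrite !(cm_of_le E) t0.
have := avg_homotopy_pos z1 a0 ab fc.
have cvE t : contour_avg f 0 1 t = avg (fun w => f (t * w)).
  by apply: avg_ext => w w1; rewrite cE kE// mulr1.
by rewrite !cvE.
Qed.

End Cauchy.

Lemma near_open_pre (K : numFieldType) (V W : normedModType K) (h : V -> W) (D : set W) x :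
  open D -> sd h x -> D (h x) -> \forall y \near x, D (h y).
Proof.
by move=> oD /sd_continuous c Dx; exact: (c D (open_nbhs_nbhs (conj oD Dx))).
Qed.

(** * Averages with parameters, division by u, Laurent's formula *)

Section Parametric.
Variables (R : realType) (K : numClosedFieldType) (E : complex_model R K).
Local Notation C2 := (K * K)%type.

Lemma near_circle (V : normedModType K) (x : V) (P : K * V -> Prop) :
  (forall w : K, `|w| = 1 -> \forall p \near (w, x), P p) ->
  \forall y \near x, forall w, `|w| = 1 -> P (w, y).
Proof.
move=> H; have /compact_near_coveringP Hc := cm_circle E.
suff : \forall y \near x, [set w : K | `|w| = 1] `<=` (fun w => P (w, y)) by [].
apply: (Hc V (nbhs x) (fun y w => P (w, y)) (nbhs_filter _)) => w /= w1.
by move: (H w w1); apply: filterS => -[].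
Qed.

Section AvgSd.
Variables (k : K * C2 -> K) (x : C2).
Hypothesis ksd : forall w : K, `|w| = 1 -> \forall p \near (w, x), sd k p.

(** Differentiation under the average. Strict differentiability of k at (w0, x) gives an estimate
    valid for all w near w0, and compactness of the circle makes it uniform; the differential is the
    average of the differentials in the second variable. *)
Lemma avg_sd : sd (fun y => avg (fun w => k (w, y))) x.
Proof.
have /choice[Lk HL] : forall p, exists l : K * C2 -> K, sd k p -> is_sd k p l.
  move=> p; have [[l hl]|ns] := pselect (sd k p); first by exists l.
  by exists (fun=> 0) => /ns.
have HL' w : `|w| = 1 -> \forall p \near (w, x), is_sd k p (Lk p).
  by move=> w1; move: (ksd w1); apply: filterS => p /HL.
have ccL v : circle_cont (fun w => Lk (w, x) v).
  move=> w w1; have H := is_sd_cvg (v := v) (HL' w w1).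
  have c : {for w, continuous (fun w : K => (w, x))}.
    by apply: sd_continuous; sd_auto.
  by move=> P HP; exact: (c _ (H P HP)).
pose e1 : K * C2 := (0, (1, 0)); pose e2 : K * C2 := (0, (0, 1)).
pose A := avg (fun w => Lk (w, x) e1); pose B := avg (fun w => Lk (w, x) e2).
have LE w : `|w| = 1 -> forall v : C2, Lk (w, x) (0, v) = v.1 * Lk (w, x) e1 + v.2 * Lk (w, x) e2.
  move=> w1 v; have [bL _] := nbhs_singleton (HL' w w1).
  have -> : (0, v) = v.1 *: e1 + v.2 *: e2 :> K * C2.
    by case: v => a b; rewrite /e1 /e2; congr (_, (_, _)); rewrite /= /GRing.scale /=; ring.
  by rewrite (bndlinD _ _ bL) !(bndlinZ _ _ bL).
exists (fun v => v.1 * A + v.2 * B); split.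
  split; first by move=> a u v; rewrite /= /GRing.scale /=; ring.
  exists (`|A| + `|B| + 1); first by rewrite ltr_wpDl// addr_ge0.
  move=> v; rewrite (le_trans (ler_normD _ _))// (normrM v.1) (normrM v.2) 2!mulrDl mul1r.
  rewrite -[leLHS]addr0; apply: lerD => //.
  by apply: lerD; rewrite mulrC ler_wpM2l//; [exact: norm_fst_le|exact: norm_snd_le].
move=> e e0; have e3 : 0 < e / 3 by rewrite divr_gt0.
have unif : \forall p \near (x, x), forall w : K, `|w| = 1 ->
   `|k (w, p.1) - k (w, p.2) - Lk (w, x) (0, p.1 - p.2)| <= e * `|p.1 - p.2|.
  have := @near_circle _ (x, x) (fun q : K * (C2 * C2) => `|q.1| = 1 ->
    `|k (q.1, q.2.1) - k (q.1, q.2.2) - Lk (q.1, x) (0, q.2.1 - q.2.2)| <= e * `|q.2.1 - q.2.2|).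
  move=> H; have {}H := H _; apply: (filterS _ (H _)) => [p Hp w w1|w0 w1]; first exact: Hp.
  have [bL Hw] := nbhs_singleton (HL' w0 w1).
  have c : {for (w0, (x, x)), continuous (fun q : K * (C2 * C2) => ((q.1, q.2.1), (q.1, q.2.2)))}.
    by apply: sd_continuous; sd_auto.
  have h1 : \forall q \near (w0, (x, x)),
     `|k (q.1, q.2.1) - k (q.1, q.2.2) - Lk (w0, x) ((q.1, q.2.1) - (q.1, q.2.2))| <=
        e / 3 * `|((q.1, q.2.1) : K * C2) - (q.1, q.2.2)|.
    exact: (c (fun p => `|k p.1 - k p.2 - Lk (w0, x) (p.1 - p.2)| <= e / 3 * `|p.1 - p.2|) (Hw _ e3)).
  have cf : {for (w0, (x, x)), continuous (fun q : K * (C2 * C2) => q.1)}.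
    by apply: sd_continuous; sd_auto.
  have cL v := ccL v w0 w1.
  have h2 : \forall q \near (w0, (x, x)), `|Lk (w0, x) e1 - Lk (q.1, x) e1| <= e / 3.
    have /cvgrPdist_le/(_ _ e3) := cL e1.
    exact: (cf (fun w => `|Lk (w0, x) e1 - Lk (w, x) e1| <= e / 3)).
  have h3 : \forall q \near (w0, (x, x)), `|Lk (w0, x) e2 - Lk (q.1, x) e2| <= e / 3.
    have /cvgrPdist_le/(_ _ e3) := cL e2.
    exact: (cf (fun w => `|Lk (w0, x) e2 - Lk (w, x) e2| <= e / 3)).
  move: h1 h2 h3; apply: filterS3 => -[w [p q]] /= h1 h2 h3 w1'.
  have [d dE] : exists d : C2, d = p - q by eexists.
  have dE' : ((w, p) : K * C2) - (w, q) = (0, d) by rewrite dE; congr (_, _); rewrite /= subrr.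
  rewrite dE' in h1; rewrite -dE.
  have -> : k (w, p) - k (w, q) - Lk (w, x) (0, d) =
    (k (w, p) - k (w, q) - Lk (w0, x) (0, d)) + (d.1 * (Lk (w0, x) e1 - Lk (w, x) e1)
      + d.2 * (Lk (w0, x) e2 - Lk (w, x) e2)).
    by rewrite (LE w)// (LE w0)//; ring.
  have -> : e * `|d| = e / 3 * `|d| + (e / 3 * `|d| + e / 3 * `|d|).
    by move: `|d| => n; field.
  rewrite (le_trans (ler_normD _ _))//; apply: lerD.
    rewrite (le_trans h1)//; apply: ler_wpM2l; first exact: ltW.
    by apply: prod_norm_le => //=; rewrite normr0.
  rewrite (le_trans (ler_normD _ _))// (normrM d.1) (normrM d.2) ![e / 3 * _]mulrC.
  by apply: lerD; apply: ler_pM => //; [exact: norm_fst_le|exact: norm_snd_le].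
have csd : \forall y \near x, circle_cont (fun w => k (w, y)).
  move: (near_circle ksd); apply: filterS => y Hy.
  apply: circle_sd_cont => w w1.
  by apply: (sd_comp (f := fun w => (w, y)) (g := k)); [sd_auto|exact: Hy].
move: (near_pair_fst csd) (near_pair_snd csd) unif; apply: filterS3 => -[p q] /= cp cq H.
have c1 : circle_cont (fun w => k (w, p) - k (w, q)) by exact: circle_contB.
have c2 : circle_cont (fun w => (p - q).1 * Lk (w, x) e1 + (p - q).2 * Lk (w, x) e2).
  by apply: circle_contD; apply: circle_contZ.
rewrite /A /B -!(avgZ E)// -(avgD E)//; [|exact: circle_contZ|exact: circle_contZ].
rewrite -(avgB E)// -(avgB E)//; apply: (avg_le E); first exact: circle_contB.
by move=> w w1; rewrite -(LE w w1 (p - q)); exact: H.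
Qed.

End AvgSd.
Lemma polydisc_nbhs (D : set C2) x : open D -> D x ->
  exists2 r, 0 < r & forall y, `|y.1 - x.1| <= r -> `|y.2 - x.2| <= r -> D y.
Proof.
move=> oD Dx.
have /nbhs_normP[r /= r0 Hr] : \forall y \near x, D y by exact: open_nbhs_nbhs.
exists (r / 2); first by rewrite divr_gt0.
have r2 : r / 2 < r by rewrite ltr_pdivrMr// ltr_pMr// ltr1n.
move=> y h1 h2; apply: Hr => /=; rewrite -[x - y]opprB normrN.
by apply: prod_norm_lt; apply: le_lt_trans r2.
Qed.

(** Subtracting Cauchy's formula at 0 from the one at u leaves the kernel r w / (r w - u) - 1 = u /
    (r w - u), in which the factor u is explicit. *)
Lemma division_local (D : set C2) (f : C2 -> K) z0 r : open D ->
  (forall x, D x -> sd f x) -> (forall z, D (z, 0) -> f (z, 0) = 0) -> 0 < r ->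
  (forall y : C2, `|y.1 - z0| <= r -> `|y.2| <= r -> D y) ->
  exists g : C2 -> K, forall y : C2, `|y.1 - z0| < r -> `|y.2| < r ->
    sd g y /\ f y = y.2 * g y.
Proof.
move=> oD fsd f0 r0 Dr.
pose k (p : K * C2) := f (p.2.1, r * p.1) / (r * p.1 - p.2.2).
exists (fun y => avg (fun w => k (w, y))) => y y1 y2.
have Dk w : `|w| <= 1 -> D (y.1, r * w).
  move=> w1; apply: Dr => /=; first exact: ltW.
  by rewrite normrM (ger0_norm (ltW r0)) -[leRHS]mulr1; apply: ler_wpM2l => //; exact: ltW.
have nz w : `|w| = 1 -> r * w - y.2 != 0.
  move=> w1; apply: contour_neq0 => //; by rewrite (ger0_norm (ltW r0)).
have sdk (w : K) (v : C2) : D (v.1, r * w) -> r * w - v.2 != 0 -> sd k (w, v).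
  move=> Dv nv; rewrite /k; apply: sdM; last by sd_auto.
  by apply: (sd_comp (f := fun p : K * C2 => (p.2.1, r * p.1)) (g := f)); [sd_auto|exact: fsd].
split.
  apply: (avg_sd (k := k)) => w w1.
  have h1 : \forall p \near (w, y), D ((p.2.1, r * p.1) : C2).
    apply: (near_open_pre (h := fun p : K * C2 => (p.2.1, r * p.1))) => //; first by sd_auto.
    by apply: Dk; rewrite w1.
  have h2 : \forall p \near (w, y), r * p.1 - p.2.2 != 0.
    have c : {for (w, y), continuous (fun p : K * C2 => r * p.1 - p.2.2)}.
      by apply: sd_continuous; sd_auto.
    exact: (c (fun u => u != 0) (near_neq0 (nz w w1))).
  by move: h1 h2; apply: filterS2 => -[w' v] /= h1 h2; exact: sdk.
have fy w : `|w| <= r -> sd (fun u => f (y.1, u)) w.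
  move=> wr; apply: (sd_comp (f := fun u => (y.1, u)) (g := f)); first by sd_auto.
  by apply: fsd; apply: Dr => //=; exact: ltW.
have e1 := cauchy_formula E r0 y2 fy.
have e2 := cauchy_formula E (z := 0) r0 _ fy.
rewrite normr0 in e2; have {}e2 := e2 r0.
have Dy0 : D (y.1, 0) by have := Dk 0; rewrite mulr0; apply; rewrite normr0.
have cf : circle_cont (fun w => f (y.1, r * w)).
  apply: circle_sd_cont => w w1.
  apply: (sd_comp (f := fun w => (y.1, r * w)) (g := f)); first by sd_auto.
  by apply: fsd; apply: Dk; rewrite w1.
have ck : circle_cont (fun w => k (w, y)).
  apply: circle_sd_cont => w w1; apply: (sd_comp (f := fun w => (w, y)) (g := k)); first by sd_auto.
  by apply: sdk; [apply: Dk; rewrite w1|exact: nz].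
have rw0 w : `|w| = 1 -> r * w != 0.
  by move=> w1; rewrite -normr_gt0 normrM w1 mulr1 normr_gt0 gt_eqF.
rewrite -(avgZ E)// -[LHS]subr0 -{1}(f0 _ Dy0) e2 {1}[y]surjective_pairing e1.
rewrite -(avgB E).
- apply: avg_ext => w w1; rewrite /k /= subr0.
  have w0 := rw0 w w1.
  by rewrite divff// mulr1; field; exact: nz.
- apply: circle_sd_cont => w w1; apply: sdM.
    apply: (sd_comp (f := fun w => (y.1, r * w)) (g := f)); first by sd_auto.
    by apply: fsd; apply: Dk; rewrite w1.
  by sd_auto; exact: nz.
- apply: circle_sd_cont => w w1; apply: sdM.
    apply: (sd_comp (f := fun w => (y.1, r * w)) (g := f)); first by sd_auto.
    by apply: fsd; apply: Dk; rewrite w1.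
  by sd_auto; rewrite subr0; exact: rw0.
Qed.

Lemma cvg_eq_dnbhs0 (g : K -> K) (c : K) : {for 0, continuous g} ->
  (\forall s \near (0 : K)^', g s = c) -> g 0 = c.
Proof.
move=> cg H; apply/eqP; rewrite -subr_eq0 -normr_eq0.
apply/negPn/negP => n0; have n1 : 0 < `|g 0 - c| by rewrite lt0r n0/=.
have /cvgrPdist_lt/(_ _ n1) h := cg.
have : \forall s \near (0 : K)^', False.
  move: (nbhs_dnbhs h) H; apply: filterS2 => s h1 h2.
  by move: h1; rewrite h2 ltxx.
by move/filter_ex => [].
Qed.

Lemma division (D : set C2) (f : C2 -> K) : open D -> (forall x, D x -> sd f x) ->
  (forall z, D (z, 0) -> f (z, 0) = 0) ->
  exists g : C2 -> K, forall x, D x -> sd g x /\ f x = x.2 * g x.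
Proof.
move=> oD fsd f0.
have /choice[G HG] : forall z0, exists g : C2 -> K, D (z0, 0) -> exists2 r, 0 < r &
    forall y : C2, `|y.1 - z0| < r -> `|y.2| < r -> [/\ D y, sd g y & f y = y.2 * g y].
  move=> z0; have [Dz|nD] := pselect (D (z0, 0)); last by exists (fun=> 0) => /nD.
  have [r r0 Hr] := polydisc_nbhs oD Dz.
  have Hr' (y : C2) : `|y.1 - z0| <= r -> `|y.2| <= r -> D y.
    by move=> h1 h2; apply: Hr => //=; rewrite subr0.
  have [g Hg] := division_local oD fsd f0 r0 Hr'; exists g => _; exists r => // y h1 h2.
  by have [] := Hg y h1 h2; split => //; apply: Hr'; exact: ltW.
pose g (x : C2) := if x.2 == 0 then G x.1 x else f x / x.2.
have gE z0 : D (z0, 0) -> exists2 r, 0 < r &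
  forall y : C2, `|y.1 - z0| < r -> `|y.2| < r -> g y = G z0 y /\ sd (G z0) y.
  move=> Dz; have [r r0 Hr] := HG z0 Dz; exists r => // -[z u] h1 h2.
  have [Dy sG fG] := Hr (z, u) h1 h2; split => //.
  rewrite /g /=; have [u0|u0] := eqVneq u 0; last by rewrite fG /= mulrAC divff// mul1r.
  rewrite {u}u0 in h1 h2 Dy sG fG *.
  have [r' r0' Hr'] := HG z Dy.
  have zz : `|z - z| < r' by rewrite subrr normr0.
  have z0' : `|(z, 0 : K).2| < r' by rewrite normr0.
  have [_ sG' _] := Hr' (z, 0) zz z0'.
  (* Two local quotients both equal f / u off the axis, so they agree on it by continuity. Hence the
     choice of quotient made by [g] does not affect its values. *)
  have e : G z (z, 0) - G z0 (z, 0) = 0.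
    apply: (@cvg_eq_dnbhs0 (fun s => G z (z, s) - G z0 (z, s))).
      apply: sd_continuous; apply: sdD.
        by apply: (sd_comp (f := fun s => (z, s)) (g := G z)); [sd_auto|exact: sG'].
      by apply: sdN; apply: (sd_comp (f := fun s => (z, s)) (g := G z0)); [sd_auto|exact: sG].
    have m0 (t : K) : 0 < t -> \forall s \near (0 : K)^', `|s| < t.
      by move=> t0; apply: nbhs_dnbhs; apply/nbhs_normP; exists t => // s /=; rewrite sub0r normrN.
    move: (m0 r r0) (m0 r' r0') (nbhs_dnbhs_neq (0 : K)); apply: filterS3 => s s1 s2 s0.
    have [_ _ f1] := Hr (z, s) h1 s1; have [_ _ f2] := Hr' (z, s) zz s2.
    apply: (mulfI s0); rewrite mulr0 mulrBr; rewrite /= in f1 f2.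
    by rewrite -f1 -f2 subrr.
  by apply/eqP; rewrite -subr_eq0 e.
exists g => x Dx; have [x20|x20] := eqVneq x.2 0.
  have xE : x = (x.1, 0) by rewrite -x20 -surjective_pairing.
  have Dx0 : D (x.1, 0) by rewrite -xE.
  have [r r0 Hr] := gE x.1 Dx0.
  have xr1 : `|x.1 - x.1| < r by rewrite subrr normr0.
  have xr2 : `|x.2| < r by rewrite x20 normr0.
  have [_ sG] := Hr x xr1 xr2; split; last by rewrite x20 mul0r xE f0.
  apply: sd_near sG.
  apply/nbhs_normP; exists r => // y /=; rewrite distrC => yr.
  symmetry; apply: (Hr y _ _).1; apply: le_lt_trans yr; first exact: (norm_fst_le (y - x)).
  by have := norm_snd_le (y - x); rewrite /= x20 subr0.
split; last by rewrite /g (negPf x20) mulrC divfK.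
apply: (@sd_near _ _ _ (fun y => f y / y.2)).
  have c : {for x, continuous (snd : C2 -> K)} by apply: sd_continuous; exact: sd_snd.
  have n : \forall y \near x, y.2 != 0 by exact: (c (fun u => u != 0) (near_neq0 x20)).
  move: n; apply: filterS => y /negPf y0.
  by rewrite /g y0.
by apply: sdM; [exact: fsd|sd_auto].
Qed.

Lemma avg_kern_out (z r : K) : r != 0 -> `|r| < `|z| -> avg (kern z r) = 0.
Proof.
move=> r0 rz; have z0 : z != 0 by rewrite -normr_gt0; apply: le_lt_trans rz.
have nz w : `|w| <= 1 -> r * w - z != 0.
  move=> w1; rewrite subr_eq0; apply/eqP => h; move: rz.
  by rewrite -h normrM => /lt_geF; rewrite -[X in _ <= X]mulr1 ler_wpM2l.
by rewrite (avg_mean E) ?/kern ?mulr0 ?mul0r// => w w1; sd_auto; exact: nz.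
Qed.

(** The function w (f w - f z) / (w - z) extends over w = z, so it has the same average on both
    circles. The part with f z contributes f z on the outer circle, where [kern] has average 1, and
    nothing on the inner one, where its average is 0. *)
Lemma laurent_formula (A : set K) (f : K -> K) (a b : R) z : open A ->
  (forall w, A w -> sd f w) -> 0 < a -> a < b ->
  (forall w, cm_of E a <= `|w| <= cm_of E b -> A w) ->
  cm_of E a < `|z| < cm_of E b ->
  f z = avg (fun w => f (cm_of E b * w) * kern z (cm_of E b) w)
      - avg (fun w => f (cm_of E a * w) * kern z (cm_of E a) w).
Proof.
move=> oA fsd a0 ab Aab /andP[az zb].
have of_gt0 t : 0 < t -> 0 < cm_of E t by move=> t0; rewrite -(cm_of0 E) (cm_of_lt E).
have b0 : 0 < b by apply: lt_trans ab.
have na := ger0_norm (ltW (of_gt0 a a0)); have nb := ger0_norm (ltW (of_gt0 b b0)).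
(* The division is by the second coordinate, which is w - z; the first coordinate is a dummy. *)
pose D : set C2 := [set x | A (z + x.2)].
have oD : open D.
  rewrite openE => x Dx.
  by apply: (near_open_pre (h := fun x : C2 => z + x.2)) => //; sd_auto.
have [g Hg] : exists g : C2 -> K, forall x, D x -> sd g x /\ f (z + x.2) - f z = x.2 * g x.
  apply: (division (f := fun x => f (z + x.2) - f z) oD) => [x Dx|u _ /=]; last by rewrite addr0 subrr.
  apply: sdD; last by sd_auto.
  by apply: (sd_comp (f := fun x : C2 => z + x.2) (g := f)); [sd_auto|exact: fsd].
pose F w := g (0, w - z) * w.
have Dw w : A w -> D (0, w - z) by rewrite /D /= addrC subrK.
have Fsd w : A w -> sd F w.
  move=> Aw; apply: sdM; last by sd_auto.
  apply: (sd_comp (f := fun w => (0, w - z)) (g := g)); first by sd_auto.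
  exact: (Hg _ (Dw w Aw)).1.
have FE w : A w -> w != z -> F w = (f w - f z) * (w / (w - z)).
  move=> Aw wz; have [_] := Hg _ (Dw w Aw); rewrite /= [z + _]addrC subrK => ->.
  by rewrite /F; field; rewrite subr_eq0.
have circ (r : R) : 0 < r -> a <= r <= b -> cm_of E r != `|z| ->
    avg (fun w => F (cm_of E r * w)) =
    avg (fun w => f (cm_of E r * w) * kern z (cm_of E r) w) - f z * avg (kern z (cm_of E r)).
  move=> r0 rab rz; have nr := ger0_norm (ltW (of_gt0 r r0)).
  have Ar w : `|w| = 1 -> A (cm_of E r * w).
    by move=> w1; apply: Aab; rewrite normrM w1 mulr1 nr !(cm_of_le E).
  have neq w : `|w| = 1 -> cm_of E r * w != z.
    by move=> w1; apply: contra_neq rz => <-; rewrite normrM w1 mulr1.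
  have ck : circle_cont (kern z (cm_of E r)).
    by apply: circle_sd_cont => w w1; rewrite /kern; sd_auto; rewrite subr_eq0 neq.
  rewrite -(avgZ E)// -(avgB E).
  - apply: avg_ext => w w1; rewrite FE//; [by rewrite mulrBl|exact: Ar|exact: neq].
  - apply: circle_sd_cont => w w1; apply: sdM.
      by apply: (sd_comp (f := fun w => cm_of E r * w) (g := f)); [sd_auto|exact/fsd/Ar].
    by rewrite /kern; sd_auto; rewrite subr_eq0 neq.
  - exact: circle_contZ.
have := avg_annulus a0 (ltW ab) (fun w h => Fsd w (Aab w h)).
rewrite (circ b)//; last 2 first.
- by rewrite lexx ltW.
- by rewrite gt_eqF.
rewrite (circ a)//; last 2 first.
- by rewrite lexx ltW.
- by rewrite lt_eqF.
rewrite (avg_kern E) ?nb// (avg_kern_out _ _) ?na ?gt_eqF ?of_gt0// mulr0 subr0 mulr1 => <-.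
by rewrite opprB addrC subrK.
Qed.

End Parametric.

(** * Entire functions *)

Section Entire.
Variables (R : realType) (K : numClosedFieldType) (E : complex_model R K).
Implicit Types f g : K -> K.

(** On a circle of radius r > |z|, the integrand of Cauchy's formula is a function of w^-1 that is
    holomorphic on the closed unit disc, so its average is its value at 0. The factor [0 ^+ n]
    treats two cases at once: f is the constant g 0 if n = 0, and f = 0 if n > 0. *)
Lemma liouville n f g : (forall z, sd f z) -> (forall z, sd g z) ->
  (forall z, z != 0 -> z ^+ n * f z = g z^-1) -> forall z, f z = 0 ^+ n * g 0.
Proof.
move=> fsd gsd H z.
have [r rE] : exists r : K, r = `|z| + 1 by eexists.
have zr : `|z| < r by rewrite rE ltrDl.
have r0 : 0 < r by apply: le_lt_trans zr.
have nr : r != 0 by rewrite gt_eqF.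
have nz v : `|v| <= 1 -> 1 - z * v / r != 0.
  move=> v1; rewrite subr_eq0; apply/eqP => h.
  have : `|z * v / r| < 1.
    rewrite normrM normfV (ger0_norm (ltW r0)) ltr_pdivrMr// mul1r normrM.
    by apply: le_lt_trans zr; rewrite -[leRHS]mulr1; exact: ler_wpM2l.
  by rewrite -h normr1 ltxx.
rewrite (cauchy_formula E r0 zr (fun w _ => fsd w)).
pose h v := (v / r) ^+ n * g (v / r) / (1 - z * v / r).
rewrite (avg_ext (g := fun w => h w^-1)).
  rewrite avg_inv (avg_mean E).
    by rewrite /h mulr0 !mul0r subr0 invr1 mulr1.
  move=> w w1; rewrite /h; apply: sdM; last by sd_auto => //; exact: nz.
  apply: sdM; first by sd_auto.
  by apply: (sd_comp (f := fun v : K => v / r) (g := g)); [sd_auto|exact: gsd].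
move=> w w1; have w0 : w != 0 by rewrite -normr_gt0 w1.
have rw0 : r * w != 0 by rewrite mulf_neq0.
have wV1 : `|w^-1| <= 1 by rewrite normfV w1 invr1.
have d1 := nz _ wV1.
have d2 : r * w - z != 0.
  apply: contra_neq d1 => hh; rewrite (_ : 1 - _ = (r * w - z) / (r * w)); last by field; rewrite nr w0.
  by rewrite hh mul0r.
have e : w^-1 / r = (r * w)^-1 by rewrite invfM mulrC.
rewrite /h e -H// exprVn mulKf ?expf_neq0//.
by congr (_ * _); field; rewrite nr w0 mulrC d2.
Qed.

(** Write the sum as z P. Then P + z^(k-1) f is entire, and z times it is g(1/z), so it vanishes by
    Liouville. Hence -f is a polynomial in 1/z without constant term, so f = 0, and P is a
    polynomial that vanishes identically. *)
Lemma laurent_gap k (a : nat -> K) f g : (forall z, sd f z) -> (forall z, sd g z) ->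
  (forall z, z != 0 -> \sum_(1 <= m < k) a m * z ^+ m = g z^-1 - z ^+ k * f z) ->
  forall m, (0 < m < k)%N -> a m = 0.
Proof.
move=> fsd gsd H m /andP[m0 mk].
case: k mk H => // k mk H.
pose P z := \sum_(0 <= i < k) a i.+1 * z ^+ i.
have sdP z : sd P z by rewrite /P; apply: sd_sum => i; sd_auto.
have PE z : \sum_(1 <= m < k.+1) a m * z ^+ m = z * P z.
  by rewrite /P big_distrr big_add1 /=; apply: eq_bigr => i _; rewrite exprS; ring.
have e1 z : P z + z ^+ k * f z = 0.
  have -> : 0 = 0 ^+ 1 * g 0 by rewrite expr1 mul0r.
  apply: (liouville (f := fun z => P z + z ^+ k * f z)) => // [z'|z' z0'].
    by apply: sdD => //; apply: sdM => //; sd_auto.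
  by rewrite expr1 mulrDr -PE H// exprS mulrA subrK.
pose Q z := \sum_(0 <= i < k) a i.+1 * z ^+ (k - i).
have f0 z : - f z = 0.
  have -> : 0 = 0 ^+ 0 * Q 0.
    rewrite expr0 mul1r /Q big1_seq// => i; rewrite mem_index_iota => /andP[_ /andP[_ ik]].
    by rewrite expr0n subn_eq0 leqNgt ik mulr0.
  apply: (liouville (f := fun z => - f z)) => [z'|z'|z' z0'].
  - exact: sdN.
  - by rewrite /Q; apply: sd_sum => i; sd_auto.
  have zk : z' ^+ k != 0 by rewrite expf_neq0.
  rewrite expr0 mul1r; apply: (mulfI zk); rewrite mulrN -[LHS]add0r -(e1 z') addrK.
  rewrite /P /Q big_distrr /= !big_nat; apply: eq_bigr => i /andP[_ ik].
  have -> : z' ^+ k = z' ^+ i * z' ^+ (k - i) by rewrite -exprD subnKC// ltnW.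
  by rewrite [RHS]mulrCA exprVn mulfK// expf_neq0.
have P0 z : P z = 0.
  by have := e1 z; rewrite -[f z]opprK f0 oppr0 mulr0 addr0.
pose p := \poly_(i < k) a i.+1.
have p0 : p = 0.
  apply: (@roots_geq_poly_eq0 _ _ [seq (i : nat)%:R | i <- iota 0 k]).
  - apply/allP => z _; apply/rootP; rewrite horner_poly.
    by rewrite -[RHS](P0 z) /P big_mkord.
  - by rewrite map_inj_uniq ?iota_uniq// => i j /eqP; rewrite eqr_nat => /eqP.
  - by rewrite size_map size_iota size_poly.
have : p`_m.-1 = 0 by rewrite p0 coef0.
by rewrite coef_poly; case: m m0 mk => // m _; rewrite ltnS => /= ->.
Qed.

End Entire.

(** * Cech cohomology of the bundle *)

Section Tube.
Variables (R : realType) (K : numClosedFieldType) (E : complex_model R K) (k : nat).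
Local Notation C2 := (K * K)%type.

Definition swap_chart (x : C2) : C2 := (x.1^-1, x.1 ^+ k * x.2).

(** The second condition is |v| < e seen from U, so the same formula describes this neighbourhood of
    l in both charts. *)
Definition tube (e : K) : set C2 := [set x | `|x.2| < e /\ `|x.1 ^+ k * x.2| < e].

Lemma open_norm_lt (V : normedModType K) (h : V -> K) (e : K) : (forall x, sd h x) ->
  open [set x | `|h x| < e].
Proof.
move=> hsd; rewrite openE => x /= hx.
have d0 : 0 < e - `|h x| by rewrite subr_gt0.
have := sd_continuous (hsd x); move=> /cvgrPdist_lt/(_ _ d0).
apply: filterS => y hy; rewrite /= -[h y](subrK (h x)) addrC.
rewrite (le_lt_trans (ler_normD _ _))// -ltrBrDl distrC//.
Qed.

Lemma open_tube e : open (tube e).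
Proof.
apply: openI.
  by apply: (open_norm_lt (h := fun x : C2 => x.2)) => x; sd_auto.
by apply: (open_norm_lt (h := fun x : C2 => x.1 ^+ k * x.2)) => x; sd_auto.
Qed.

Lemma open_neq0_fst : open [set x : C2 | x.1 != 0].
Proof.
rewrite openE => x /= x0.
have c : {for x, continuous (fst : C2 -> K)} by apply: sd_continuous; exact: sd_fst.
exact: (c (fun u => u != 0) (near_neq0 x0)).
Qed.

Lemma swap_chartK x : x.1 != 0 -> swap_chart (swap_chart x) = x.
Proof.
move=> x0; rewrite /swap_chart /= invrK exprVn mulKf ?expf_neq0//.
by rewrite -surjective_pairing.
Qed.

Lemma sd_swap_chart x : x.1 != 0 -> sd swap_chart x.
Proof. by move=> x0; rewrite /swap_chart; sd_auto. Qed.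

Lemma tube_swap_chart e x : x.1 != 0 -> tube e x -> tube e (swap_chart x).
Proof.
move=> x0 [h1 h2]; split => //=.
by rewrite exprVn mulKf ?expf_neq0.
Qed.

Lemma tube_le e e' x : e <= e' -> tube e x -> tube e' x.
Proof. by move=> ee [h1 h2]; split; apply: lt_le_trans ee. Qed.

Lemma tube_axis e z : 0 < e -> tube e (z, 0).
Proof. by move=> e0; split => /=; rewrite ?mulr0 normr0. Qed.

Lemma tube_small e (x : C2) b : `|x.1| <= b -> 1 <= b -> `|x.2| * b ^+ k < e -> tube e x.
Proof.
move=> xb b1 h; have b0 : 0 <= b by apply: le_trans b1.
split.
  apply: le_lt_trans h; rewrite -[leLHS]mulr1; apply: ler_wpM2l => //.
  by rewrite exprn_ege1.
rewrite normrM normrX mulrC; apply: le_lt_trans h; apply: ler_wpM2l => //.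
by rewrite lerXn2r// nnegrE.
Qed.

(** A Laurent splitting in z with u as parameter: the Cauchy averages over |z| = 2 and |z| = 1 give
    the parts that are regular at z = 0 and at infinity. The circle |z| = 2 lies in the tube when
    |u| < e / 2^k, hence the smaller tube. *)
Lemma cousin e (c : C2 -> K) : 0 < e -> (forall x, tube e x -> x.1 != 0 -> sd c x) ->
  exists f g : C2 -> K, forall x, tube (e / 2 ^+ k) x ->
    [/\ sd f x, sd g x & x.1 != 0 -> c x = f x + g (swap_chart x)].
Proof.
move=> e0 csd.
have k0 : 0 < 2 ^+ k :> K by rewrite exprn_gt0.
have [e' eE'] : exists e', e' = e / 2 ^+ k by eexists.
rewrite -eE'; have e'0 : 0 < e' by rewrite eE' divr_gt0.
have k1 : 1 <= 2 ^+ k :> K by rewrite exprn_ege1// ler1n.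
have e'e : e' <= e by rewrite eE' ler_pdivrMr//; apply: ler_peMr => //; exact: ltW.
pose D : set C2 := [set x | tube e x /\ x.1 != 0].
have oD : open D by apply: openI; [exact: open_tube|exact: open_neq0_fst].
have Dsd x : D x -> sd c x by move=> [h1 h2]; exact: csd.
have Dw b w u : b = 1 \/ b = 2 -> `|w| = 1 -> `|u| < e' -> D (b * w, u).
  move=> b12 w1 ue.
  have b1 : 1 <= b by case: b12 => ->; rewrite ?lexx// ler1n.
  have b2 : b <= 2 by case: b12 => ->; rewrite ?lexx// ler1n.
  have b0 : 0 < b by apply: lt_le_trans b1.
  split; last by rewrite /= -normr_gt0 normrM w1 mulr1 normr_gt0 gt_eqF.
  apply: (tube_small (b := 2)) => /=; rewrite ?ler1n//.
    by rewrite normrM w1 mulr1 ger0_norm// ltW.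
  by rewrite -ltr_pdivlMr// -eE'.
have param b (h : K * C2 -> K) (x : C2) : b = 1 \/ b = 2 -> `|x.2| < e' ->
    (forall w, `|w| = 1 -> \forall p \near (w, x), sd h p) ->
    sd (fun y => avg (fun w => c (b * w, y.2) * h (w, y))) x.
  move=> b12 x2 hsd; apply: (avg_sd E (k := fun p => c (b * p.1, p.2.2) * h p)) => w w1.
  have h1 : \forall p \near (w, x), D ((b * p.1, p.2.2) : C2).
    apply: (near_open_pre (h := fun p : K * C2 => (b * p.1, p.2.2))) => //; first by sd_auto.
    exact: Dw.
  move: (hsd w w1) h1; apply: filterS2 => p hp hD; apply: sdM => //.
  by apply: (sd_comp (f := fun p : K * C2 => (b * p.1, p.2.2)) (g := c)); [sd_auto|exact: Dsd].
pose fp (y : C2) := avg (fun w => c (2 * w, y.2) * kern y.1 2 w).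
pose G (y : C2) := avg (fun w => c (1 * w, y.2) * (w * y.1 / (1 - w * y.1))).
have fp_sd x : `|x.1| < 2 -> `|x.2| < e' -> sd fp x.
  move=> x1 x2; apply: (param 2 (fun p => kern p.2.1 2 p.1)) => //; first by right.
  move=> w w1.
  have n0 : 2 * w - x.1 != 0 by apply: contour_neq0 => //; rewrite (ger0_norm (_ : 0 <= 2 :> K)).
  have c1 : {for (w, x), continuous (fun p : K * C2 => 2 * p.1 - p.2.1)}.
    by apply: sd_continuous; sd_auto.
  have n : \forall p \near (w, x), 2 * p.1 - p.2.1 != 0 by exact: (c1 (fun u => u != 0) (near_neq0 n0)).
  by move: n; apply: filterS => p p0; rewrite /kern; sd_auto.
have G_sd x : `|x.1| < 1 -> `|x.2| < e' -> sd G x.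
  move=> x1 x2; apply: (param 1 (fun p => p.1 * p.2.1 / (1 - p.1 * p.2.1))) => //; first by left.
  move=> w w1.
  have n0 : 1 - w * x.1 != 0.
    rewrite subr_eq0; apply/eqP => h.
    have : `|w * x.1| < 1 by rewrite normrM w1 mul1r.
    by rewrite -h normr1 ltxx.
  have c1 : {for (w, x), continuous (fun p : K * C2 => 1 - p.1 * p.2.1)}.
    by apply: sd_continuous; sd_auto.
  have n : \forall p \near (w, x), 1 - p.1 * p.2.1 != 0 by exact: (c1 (fun u => u != 0) (near_neq0 n0)).
  by move: n; apply: filterS => p p0; sd_auto.
have overlap x : `|x.2| < e' -> 1 < `|x.1| < 2 -> c x = fp x + G (x.1^-1, x.2).
  move=> x2 /andP[x1 x1'].
  have n0 : x.1 != 0 by rewrite -normr_gt0; apply: lt_trans x1.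
  have of2 : cm_of E 2 = 2 by rewrite -[2]/(1 + 1) (cm_ofD E) (cm_of1 E).
  pose A : set K := [set w | D (w, x.2)].
  have oA : open A.
    rewrite openE => w Aw.
    by apply: (near_open_pre (h := fun w : K => (w, x.2))) => //; sd_auto.
  have Ac w : A w -> sd (fun w => c (w, x.2)) w.
    by move=> Aw; apply: (sd_comp (f := fun w : K => (w, x.2)) (g := c)); [sd_auto|exact: Dsd].
  have Aab w : cm_of E 1 <= `|w| <= cm_of E 2 -> A w.
    rewrite (cm_of1 E) of2 => /andP[w1 w2]; split.
      by apply: (tube_small (b := 2)) => //; rewrite ?ler1n// -ltr_pdivlMr// -eE'.
    by rewrite /= -normr_gt0; apply: lt_le_trans w1.
  have := laurent_formula (z := x.1) oA Ac ltr01 (_ : 1 < 2) Aab.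
  rewrite (cm_of1 E) of2 x1 x1' ltr1n => /(_ isT isT).
  rewrite -surjective_pairing => ->; rewrite /fp; congr (_ + _).
  have F : circle_cont (fun w => c (1 * w, x.2) * kern x.1 1 w).
    apply: circle_sd_cont => w w1; apply: sdM.
      apply: (sd_comp (f := fun w : K => (1 * w, x.2)) (g := c)); first by sd_auto.
      by apply: Dsd; apply: Dw => //; left.
    rewrite /kern; sd_auto; rewrite mul1r subr_eq0; apply: contraTneq x1 => <-.
    by rewrite w1 ltxx.
  rewrite -mulN1r -(avgZ E)//; apply: avg_ext => w w1.
  rewrite mulN1r -mulrN /=; congr (_ * _); rewrite /kern !mul1r.
  have wx : w - x.1 != 0.
    by rewrite subr_eq0; apply: contraTneq x1 => <-; rewrite w1 ltxx.
  by field; rewrite n0 wx -opprB oppr_eq0 wx.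
(* The two expressions agree for 1 < |z| < 2 by [overlap], so f is regular across |z| = 2. *)
pose f (x : C2) := if `|x.1| < 2 then fp x else c x - G (x.1^-1, x.2).
pose g (x : C2) := if x.1 == 0 then 0 else c (swap_chart x) - f (swap_chart x).
have fE (x : C2) : `|x.2| < e' -> 1 < `|x.1| -> f x = c x - G (x.1^-1, x.2).
  move=> x2 x1; rewrite /f; case: ifP => // x12.
  by rewrite (overlap x)// ?x1// addrK.
have near_norm (x : C2) (P : K -> Prop) : P `|x.1| -> (forall a : K, P `|a| -> \forall b \near a, P `|b|) ->
    \forall y \near x, P `|y.1|.
  move=> Px HP; have c1 : {for x, continuous (fst : C2 -> K)} by apply: sd_continuous; exact: sd_fst.
  exact: (c1 (fun a => P `|a|) (HP _ Px)).
have near_lt b (a : K) : `|a| < b -> \forall a' \near a, `|a'| < b.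
  move=> ab; have := open_norm_lt b (fun x => sd_id x : sd (id : K -> K) x).
  by rewrite openE => /(_ a ab).
have near_gt b (a : K) : b < `|a| -> \forall a' \near a, b < `|a'|.
  move=> ab; have d0 : 0 < `|a| - b by rewrite subr_gt0.
  apply/nbhs_normP; exists (`|a| - b) => // a' /= h.
  have := le_lt_trans (lerB_dist a a') h.
  by rewrite ltrD2l ltrN2.
have ot : open (tube e') by exact: open_tube.
have nt x : tube e' x -> \forall y \near x, tube e' y.
  by move=> tx; exact: (open_nbhs_nbhs (conj ot tx)).
have sd_f x : tube e' x -> sd f x.
  move=> tx; have [x1|x1] := boolP (`|x.1| < 2).
    apply: (@sd_near _ _ _ fp); last by apply: fp_sd => //; case: tx.
    by move: (near_norm x (fun a => a < 2) x1 (near_lt 2)); apply: filterS => y y1; rewrite /f y1.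
  have {}x1 : 2 <= `|x.1| by rewrite real_leNgt// ?ger0_real.
  have x1' : 1 < `|x.1| by apply: lt_le_trans x1; rewrite ltr1n.
  have n0 : x.1 != 0 by rewrite -normr_gt0; apply: lt_trans x1'.
  apply: (@sd_near _ _ _ (fun y => c y - G (y.1^-1, y.2))).
    move: (near_norm x (fun a => 1 < a) x1' (near_gt 1)) (nt x tx); apply: filterS2 => y y1 [y2 _].
    by rewrite fE.
  apply: sdD; first by apply: csd => //; apply: tube_le tx.
  apply: sdN; apply: (sd_comp (f := fun y : C2 => (y.1^-1, y.2)) (g := G)); first by sd_auto.
  apply: G_sd => /=; last by case: tx.
  by rewrite normfV invf_lt1// normr_gt0.
exists f, g => x tx; split; first exact: sd_f.
  (* Near xi = 0 one has |z| > 1, so f = c - G and what is left for g is [G] at (y.1, y.1^k y.2).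
     The value 0 given to g at xi = 0 is the right one, as the integrand of [G] vanishes there. *)
  have [x0|x0] := eqVneq x.1 0.
    apply: (@sd_near _ _ _ (fun y : C2 => G (y.1, y.1 ^+ k * y.2))); last first.
      apply: (sd_comp (f := fun y : C2 => (y.1, y.1 ^+ k * y.2)) (g := G)); first by sd_auto.
      by apply: G_sd => /=; [rewrite x0 normr0|case: tx].
    have h1 : `|x.1| < 2^-1 by rewrite x0 normr0.
    move: (near_norm x (fun a => a < 2^-1) h1 (near_lt _)) (nt x tx); apply: filterS2 => y y1 ty.
    rewrite /g; have [y0|y0] := eqVneq y.1 0.
      rewrite y0 /G (avg_ext (g := fun=> 0)) ?avg_cst// => w w1.
      by rewrite !(mulr0, mul0r).
    have [t1 t2] := tube_swap_chart y0 ty.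
    rewrite fE//= ?subKr ?invrK// normfV -[X in X < _]invr1 ltf_pV2 ?posrE ?normr_gt0//.
    by apply: lt_trans y1 _; rewrite invf_lt1// ltr1n.
  apply: (@sd_near _ _ _ (fun y : C2 => c (swap_chart y) - f (swap_chart y))).
    have n : \forall y \near x, y.1 != 0 by exact: (open_nbhs_nbhs (conj open_neq0_fst x0)).
    by move: n; apply: filterS => y /negPf y0; rewrite /g y0.
  have s0 : (swap_chart x).1 != 0 by rewrite /= invr_eq0.
  have ts := tube_swap_chart x0 tx.
  apply: sdD; last apply: sdN.
    apply: (sd_comp (f := swap_chart) (g := c)); first exact: sd_swap_chart.
    by apply: csd => //; apply: tube_le ts.
  by apply: (sd_comp (f := swap_chart) (g := f)); [exact: sd_swap_chart|exact: sd_f].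
move=> x0; have s0 : (swap_chart x).1 == 0 = false by rewrite /= invr_eq0 (negPf x0).
by rewrite /g s0 swap_chartK// addrC subrK.
Qed.

(** Applied in the chart V: the constant, the part depending on v alone and the multiple of xi
    behave differently under multiplication by a power of z. *)
Lemma tube_expand e (g : C2 -> K) : 0 < e -> (forall x, tube e x -> sd g x) ->
  exists (a : K) (b : K -> K) (h : C2 -> K),
    (forall v, `|v| < e -> sd b v) /\
    forall x, tube e x -> sd h x /\ g x = a + x.2 * b x.2 + x.1 * h x.
Proof.
move=> e0 gsd.
have t0 v : `|v| < e -> tube e (0, v).
  move=> ve; split => //=; case: (k) => [|n]; first by rewrite expr0 mul1r.
  by rewrite expr0n mul0r normr0.
have te : open (tube e) by exact: open_tube.
pose D : set C2 := [set y | tube e (y.2, y.1)].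
have oD : open D.
  rewrite openE => y Dy.
  by apply: (near_open_pre (h := fun y : C2 => (y.2, y.1))) => //; sd_auto.
have sd0 v : `|v| < e -> sd (fun v => g (0, v)) v.
  by move=> ve; apply: (sd_comp (f := fun v : K => (0, v)) (g := g)); [sd_auto|exact/gsd/t0].
have [h Hh] : exists h : C2 -> K, forall y, D y -> sd h y /\ g (y.2, y.1) - g (0, y.1) = y.2 * h y.
  apply: (division E (f := fun y : C2 => g (y.2, y.1) - g (0, y.1)) oD) => [y Dy|z _ /=]; last by rewrite subrr.
  apply: sdD.
    by apply: (sd_comp (f := fun y : C2 => (y.2, y.1)) (g := g)); [sd_auto|exact: gsd].
  apply: sdN; apply: (sd_comp (f := fun y : C2 => y.1) (g := fun v => g (0, v))); first by sd_auto.
  by apply: sd0; case: Dy.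
pose D' : set C2 := [set y | `|y.2| < e].
have oD' : open D' by apply: (open_norm_lt (h := fun y : C2 => y.2)) => y; sd_auto.
have [b Hb] : exists b : C2 -> K, forall y, D' y -> sd b y /\ g (0, y.2) - g (0, 0) = y.2 * b y.
  apply: (division E (f := fun y : C2 => g (0, y.2) - g (0, 0)) oD') => [y Dy|z _ /=]; last by rewrite subrr.
  apply: sdD; last by sd_auto.
  by apply: (sd_comp (f := fun y : C2 => y.2) (g := fun v => g (0, v))); [sd_auto|exact: sd0].
exists (g (0, 0)), (fun v => b (0, v)), (fun x => h (x.2, x.1)); split.
  move=> v ve; apply: (sd_comp (f := fun v : K => (0, v)) (g := b)); first by sd_auto.
  by have [] := Hb (0, v) ve.
move=> x tx; have Dx : D (x.2, x.1) by rewrite /D /= -surjective_pairing.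
have [h1 h2] := Hh _ Dx; have [_ h3] := Hb (0, x.2) (proj1 tx); split.
  by apply: (sd_comp (f := fun x : C2 => (x.2, x.1)) (g := h)); [sd_auto|].
rewrite /= -surjective_pairing in h2; rewrite /= in h3.
by rewrite -h2 -h3 [X in X + _]addrC subrK addrC subrK.
Qed.

Lemma line_bundle_cech e (c : C2 -> K) : (0 < k)%N -> 0 < e ->
  (forall x, tube e x -> x.1 != 0 -> sd c x) ->
  exists2 e', 0 < e' <= e & exists (f g : C2 -> K) (a : nat -> K), forall x, tube e' x ->
    [/\ sd f x, sd g x & x.1 != 0 ->
      c x = g (swap_chart x) - x.1 ^+ k * f x + \sum_(1 <= m < k) a m * x.1 ^+ m].
Proof.
move=> kp e0 csd.
have k0 : 0 < 2 ^+ k :> K by rewrite exprn_gt0.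
have k1 : 1 <= 2 ^+ k :> K by rewrite exprn_ege1// ler1n.
have cksd x : tube e x -> x.1 != 0 -> sd (fun x => c x / x.1 ^+ k) x.
  by move=> tx x0; apply: sdM; [exact: csd|sd_auto; rewrite expf_neq0].
have [f [g Hfg]] := cousin e0 cksd.
have [e' eE'] : exists e', e' = e / 2 ^+ k by eexists.
rewrite -eE' in Hfg; have e'0 : 0 < e' by rewrite eE' divr_gt0.
exists e'; first by rewrite e'0 eE' ler_pdivrMr//; apply: ler_peMr => //; exact: ltW.
(* Peels off one power of z at a time. In z^(n+1) (a0 + v b(v) + xi g1) the first term is a
   monomial, the second is z^k times a function on U because v = z^k u, and the third is z^n g1. *)
have main n (g' : C2 -> K) : (forall x, tube e' x -> sd g' x) -> exists (f h : C2 -> K) (a : nat -> K),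
    forall x, tube e' x -> [/\ sd f x, sd h x & x.1 != 0 -> x.1 ^+ n * g' (swap_chart x) =
      h (swap_chart x) + x.1 ^+ k * f x + \sum_(1 <= m < n.+1) a m * x.1 ^+ m].
  elim: n g' => [|n IH] g' g'sd.
    exists (fun=> 0), g', (fun=> 0) => x tx; split; [exact: sd_cst|exact: g'sd|move=> _].
    by rewrite big_geq// mulr0 !addr0 expr0 mul1r.
  have [a0 [b [g1 [bsd Hg1]]]] := tube_expand e'0 g'sd.
  have [f1 [h [a H]]] := IH g1 (fun x tx => (Hg1 x tx).1).
  exists (fun x => f1 x + x.1 ^+ n.+1 * x.2 * b (x.1 ^+ k * x.2)), h, (fun m => if m == n.+1 then a0 else a m).
  move=> x tx; have [f1sd hsd E1] := H x tx; split => //.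
    apply: sdD => //; apply: sdM; first by sd_auto.
    by apply: (sd_comp (f := fun x : C2 => x.1 ^+ k * x.2) (g := b)); [sd_auto|apply: bsd; case: tx].
  move=> x0; have ts := tube_swap_chart x0 tx.
  have [_ ->] := Hg1 _ ts.
  have -> : x.1 ^+ n.+1 * (a0 + (swap_chart x).2 * b (swap_chart x).2 + (swap_chart x).1 * g1 (swap_chart x))
    = x.1 ^+ n * g1 (swap_chart x) + x.1 ^+ k * (x.1 ^+ n.+1 * x.2 * b (x.1 ^+ k * x.2)) + a0 * x.1 ^+ n.+1.
    by rewrite /= exprS; field.
  rewrite E1// [in RHS]big_nat_recr//= eqxx.
  have -> : \sum_(1 <= m < n.+1) (if m == n.+1 then a0 else a m) * x.1 ^+ m =
     \sum_(1 <= m < n.+1) a m * x.1 ^+ m.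
    by apply: eq_big_nat => m /andP[_ mn]; rewrite ltn_eqF.
  ring.
have [f1 [h [a H]]] := main k g (fun x tx => let: And3 _ gs _ := Hfg x tx in gs).
(* [main] at n = k yields monomials up to z^k; the last one is a multiple of z^k and is absorbed by
   the function on U. *)
exists (fun x => - (f x + f1 x + a k)), h, a => x tx.
have [fsd gsd Hc] := Hfg x tx; have [f1sd hsd Hm] := H x tx; split => //.
  by apply: sdN; apply: sdD; [exact: sdD|exact: sd_cst].
move=> x0; have xk : x.1 ^+ k != 0 by rewrite expf_neq0.
have -> : c x = x.1 ^+ k * (c x / x.1 ^+ k) by rewrite mulrC divfK.
by rewrite Hc// mulrDr Hm// big_nat_recr//=; ring.
Qed.

End Tube.

(** * Neighbourhoods of points of X_k and splitting of cochains *)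

Section TubeBasis.
Variables (R : realType) (K : numClosedFieldType) (E : complex_model R K) (k : nat).
Local Notation C2 := (K * K)%type.

(** The discs |z| <= 1 and |xi| <= 1 cover l, and compactness gives a uniform fibre radius over each
    of them. A point with |z| > 1 is treated in the other chart. *)
Lemma tube_basis (W : bool -> set C2) : (forall i, open (W i)) ->
  (forall i x, x.1 != 0 -> (W i x <-> W (~~ i) (swap_chart k x))) ->
  (forall i z, W i (z, 0)) ->
  exists2 e : K, 0 < e & forall i, tube k e `<=` W i.
Proof.
move=> oW Wg Wl.
have cpt : compact [set z : K | `|z| <= 1] by have := cm_disc E (r := 1).
have /compact_near_coveringP Hc := cpt.
have loc i : exists2 d : K, 0 < d & forall z u, `|z| <= 1 -> `|u| < d -> W i (z, u).
  have : \forall u \near (0 : K), [set z : K | `|z| <= 1] `<=` (fun z => W i (z, u)).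
    apply: (Hc K (nbhs (0 : K)) (fun u z => W i (z, u)) (nbhs_filter _)) => z _.
    have : \forall x \near (z, (0 : K)), W i x by exact: (open_nbhs_nbhs (conj (oW i) (Wl i z))).
    by apply: filterS => -[].
  move=> /nbhs_normP[d /= d0 Hd]; exists d => // z u z1 ud.
  by apply: (Hd u) => //=; rewrite sub0r normrN.
have [d d0 Hd] := loc true; have [d' d0' Hd'] := loc false.
pose e := if d < d' then d else d'.
have e0 : 0 < e by rewrite /e; case: ifP.
have ed : e <= d.
  by rewrite /e; case: ifPn => //; rewrite -real_leNgt ?gtr0_real.
have ed' : e <= d' by rewrite /e; case: ifPn => // /ltW.
have He i z u : `|z| <= 1 -> `|u| < e -> W i (z, u).
  by move=> z1 ue; case: i; [apply: Hd => //; exact: lt_le_trans ed|apply: Hd' => //; exact: lt_le_trans ed'].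
exists e => // i x [x2 x12]; have [x1|x1] := boolP (`|x.1| <= 1).
  by rewrite (surjective_pairing x); exact: He.
have {}x1 : 1 < `|x.1| by rewrite real_ltNge// ?ger0_real.
have x0 : x.1 != 0 by rewrite -normr_gt0; apply: lt_trans x1.
by apply/Wg => //; apply: He => //; rewrite normfV invf_le1 ?normr_gt0// ltW.
Qed.

(** The notion [openX] over an abstract field. *)
Definition chart_open (W : bool -> set C2) :=
  [/\ forall i, open (W i),
      forall i x, x.1 != 0 -> (W i x <-> W (~~ i) (swap_chart k x))
    & forall i j a b, W i (a, 0) -> W j (b, 0)].

Lemma chart_open_tube e : 0 < e -> chart_open (fun=> tube k e).
Proof.
move=> e0; split=> [i|i x x0|i j a b _]; [exact: open_tube| |exact: tube_axis].
split=> H; first exact: tube_swap_chart.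
rewrite -(swap_chartK k x0); apply: tube_swap_chart => //.
by rewrite /= invr_eq0.
Qed.

Lemma chart_tube_sub (W : bool -> set C2) i z : chart_open W -> W i (z, 0) ->
  exists2 e, 0 < e & forall i, tube k e `<=` W i.
Proof.
move=> [oW Wg Wl] Wz.
exact: (tube_basis oW Wg (fun j b => Wl i j z b Wz)).
Qed.

Lemma open_neq0_snd : open [set x : C2 | x.2 != 0].
Proof.
rewrite openE => x /= x0.
have c : {for x, continuous (snd : C2 -> K)} by apply: sd_continuous; exact: sd_snd.
exact: (c (fun u => u != 0) (near_neq0 x0)).
Qed.

(* The part of W off l that is covered by the chart i, as seen in the chart j. *)
Definition punctured (W : bool -> set C2) (i : bool) (j : bool) : set C2 :=
  [set x | [/\ W j x, x.2 != 0 & (j != i -> x.1 != 0)]].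

Lemma chart_open_punctured W i : chart_open W -> chart_open (punctured W i).
Proof.
move=> [oW Wg _]; split.
- move=> j; have [ji|ji] := eqVneq j i.
    rewrite (_ : punctured W i j = W j `&` [set x | x.2 != 0]).
      by apply: openI => //; exact: open_neq0_snd.
    by apply/seteqP; split => x [] //= h1 h2; split => //; rewrite ji eqxx.
  rewrite (_ : punctured W i j = W j `&` ([set x | x.2 != 0] `&` [set x | x.1 != 0])).
    by apply: openI => //; apply: openI; [exact: open_neq0_snd|exact: open_neq0_fst].
  apply/seteqP; split => x [] //=; first by move=> h1 h2 h3; split=> //; split => //; exact: h3.
  by move=> h1 [h2 h3]; split.
- move=> j x x0; have xk : x.1 ^+ k != 0 by rewrite expf_neq0.
  have y0 : (swap_chart k x).1 != 0 by rewrite /= invr_eq0.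
  split=> -[h1 h2 h3]; split => //.
  + by apply/(Wg j x x0).
  + by rewrite /= mulf_neq0.
  + by apply/(Wg j x x0).
  + by move: h2; rewrite /= mulf_eq0 negb_or => /andP[].
- by move=> j j' a b [_]; rewrite /= eqxx.
Qed.

(* (c1, c2) is a coboundary for the transition matrix (z^k, z u; 0, z^-k). *)
Definition cech_trivial (W : bool -> set C2) (c1 c2 : C2 -> K) :=
  exists s1 s2 : bool -> C2 -> K,
  (forall i x, W i x -> sd (s1 i) x /\ sd (s2 i) x) /\
  (forall x, W true x -> x.1 != 0 ->
    c1 x = s1 false (swap_chart k x) - (x.1 ^+ k * s1 true x + x.1 * x.2 * s2 true x) /\
    c2 x = s2 false (swap_chart k x) - x.1 ^- k * s2 true x).

Definition cech_cochain (W : bool -> set C2) (c1 c2 : C2 -> K) :=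
  forall x, W true x -> x.1 != 0 -> sd c1 x /\ sd c2 x.

(** On a set covered by one chart, the component of the primitive in that chart can be taken to be
    0, and the other component is then read off from the cochain. For i = false this uses the
    inverse matrix (z^-k, - z u; 0, z^k). *)
Lemma cech_off_axis W c1 c2 i : chart_open W -> cech_cochain W c1 c2 ->
  cech_trivial (punctured W i) c1 c2.
Proof.
move=> [_ Wg _] csd; pose z := fun _ : C2 => 0 : K.
case: i.
  exists (fun j => if j then z else fun y => c1 (swap_chart k y)).
  exists (fun j => if j then z else fun y => c2 (swap_chart k y)); split.
    case=> y [Wy y2 y1]; first by split; exact: sd_cst.
    have {}y1 : y.1 != 0 by exact: y1.
    have g0 : (swap_chart k y).1 != 0 by rewrite /= invr_eq0.
    have [h1 h2] := csd (swap_chart k y) (proj1 (Wg false y y1) Wy) g0.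
    by split; apply: sd_comp => //; exact: sd_swap_chart.
  move=> y _ y0 /=; rewrite swap_chartK//.
  by rewrite !mulr0 addr0 !subr0.
exists (fun j => if j then fun y => - (c1 y / y.1 ^+ k) + y.1 * y.2 * c2 y else z).
exists (fun j => if j then fun y => - (y.1 ^+ k * c2 y) else z); split.
  case=> y [Wy y2 y1]; last by split; exact: sd_cst.
  have {}y1 : y.1 != 0 by exact: y1.
  have [h1 h2] := csd y Wy y1; split; last by apply: sdN; apply: sdM => //; sd_auto.
  apply: sdD; last by apply: sdM => //; sd_auto.
  by apply: sdN; apply: sdM => //; sd_auto; rewrite expf_neq0.
by move=> y _ y0 /=; rewrite /z; split; field; rewrite expf_neq0.
Qed.

(** The second component is unobstructed, by [cousin]. Its part on U enters the first row through
    the entry z u, and the first component so corrected is a cochain of the line bundle with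
    transition function z^k. *)
Lemma cech_axis W c1 c2 i z : (0 < k)%N -> chart_open W -> W i (z, 0) ->
  cech_cochain W c1 c2 -> exists2 e, 0 < e & (forall i, tube k e `<=` W i) /\
  exists a : nat -> K,
  cech_trivial (fun=> tube k e) (fun x => c1 x - \sum_(1 <= m < k) a m * x.1 ^+ m) c2.
Proof.
move=> kp oW Wz csd; have [e e0 eW] := chart_tube_sub oW Wz.
have c2sd x : tube k e x -> x.1 != 0 -> sd c2 x by move=> /(eW true) Wx x0; case: (csd x Wx x0).
have [f [g Hfg]] := cousin E e0 c2sd.
have [e1 e1E] : exists e1, e1 = e / 2 ^+ k by eexists.
rewrite -e1E in Hfg.
have k0 : 0 < 2 ^+ k :> K by rewrite exprn_gt0.
have e10 : 0 < e1 by rewrite e1E divr_gt0.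
have e1e : e1 <= e.
  by rewrite e1E ler_pdivrMr//; apply: ler_peMr; [exact: ltW|rewrite exprn_ege1// ler1n].
pose s2 (x : C2) := - (x.1 ^+ k * f x).
have s2sd x : tube k e1 x -> sd s2 x.
  by move=> tx; have [fsd _ _] := Hfg x tx; apply: sdN; apply: sdM => //; sd_auto.
have c1sd x : tube k e1 x -> x.1 != 0 -> sd (fun x => c1 x + x.1 * x.2 * s2 x) x.
  move=> tx x0; apply: sdD; last by apply: sdM; [sd_auto|exact: s2sd].
  by have [] := csd x (eW true x (tube_le e1e tx)) x0.
have [e2 /andP[e20 e21] [f1 [g1 [a H1]]]] := line_bundle_cech E kp e10 c1sd.
exists e2 => //; split.
  by move=> j x tx; apply: eW; apply: tube_le tx; apply: le_trans e1e.
exists a, (fun j => if j then f1 else g1), (fun j => if j then s2 else g); split.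
  move=> j x tx; have [f1sd g1sd _] := H1 x tx; have t1 := tube_le e21 tx.
  have [_ gsd _] := Hfg x t1.
  by case: j; split => //; exact: s2sd.
move=> x tx x0; have [_ _ /(_ x0) E1] := H1 x tx; have [_ _ /(_ x0) E2] := Hfg x (tube_le e21 tx).
split; last by rewrite E2 /s2; field; rewrite expf_neq0.
by rewrite opprD addrA -[LHS](addrK (x.1 * x.2 * s2 x)) [X in X - _]addrAC E1; ring.
Qed.

(** An open set that meets l contains all of l, and there the entry z u vanishes, so the first row
    restricted to l is the situation of [laurent_gap]. *)
Lemma cech_indep W (a : nat -> K) i z : chart_open W -> W i (z, 0) ->
  cech_trivial W (fun x => \sum_(1 <= m < k) a m * x.1 ^+ m) (fun=> 0) ->
  forall m, (0 < m < k)%N -> a m = 0.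
Proof.
move=> [_ _ Wl] Wz [s1 [s2 [ssd H]]].
have Wax j b : W j (b, 0) by exact: Wl Wz.
apply: (laurent_gap E (f := fun b => s1 true (b, 0)) (g := fun b => s1 false (b, 0))).
- move=> b; apply: (sd_comp (f := fun b : K => (b, 0)) (g := s1 true)); first by sd_auto.
  by case: (ssd true (b, 0) (Wax _ _)).
- move=> b; apply: (sd_comp (f := fun b : K => (b, 0)) (g := s1 false)); first by sd_auto.
  by case: (ssd false (b, 0) (Wax _ _)).
move=> b b0; have [/= -> _] := H (b, 0) (Wax _ _) b0.
by rewrite /swap_chart /= !mulr0 mul0r addr0.
Qed.

Lemma cech_trivialD W c1 c2 d1 d2 : cech_trivial W c1 c2 -> cech_trivial W d1 d2 ->
  cech_trivial W (fun x => c1 x + d1 x) (fun x => c2 x + d2 x).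
Proof.
move=> [s1 [s2 [ssd Hs]]] [t1 [t2 [tsd Ht]]].
exists (fun i x => s1 i x + t1 i x), (fun i x => s2 i x + t2 i x); split.
  by move=> i x Wx; have [? ?] := ssd i x Wx; have [? ?] := tsd i x Wx; split; exact: sdD.
move=> x Wx x0; have [-> ->] := Hs x Wx x0; have [-> ->] := Ht x Wx x0.
by split; ring.
Qed.

Lemma cech_trivialZ W (a : K) c1 c2 : cech_trivial W c1 c2 ->
  cech_trivial W (fun x => a * c1 x) (fun x => a * c2 x).
Proof.
move=> [s1 [s2 [ssd Hs]]].
exists (fun i x => a * s1 i x), (fun i x => a * s2 i x); split.
  by move=> i x Wx; have [? ?] := ssd i x Wx; split; apply: sdM => //; exact: sd_cst.
by move=> x Wx x0; have [-> ->] := Hs x Wx x0; split; ring.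
Qed.

Lemma cech_trivial_sub W W' c1 c2 : (forall i, W' i `<=` W i) ->
  cech_trivial W c1 c2 -> cech_trivial W' c1 c2.
Proof.
move=> sW [s1 [s2 [ssd Hs]]]; exists s1, s2; split => [i x /sW|x /sW]; [exact: ssd|exact: Hs].
Qed.

End TubeBasis.

(** * Reflexivity of the direct image *)

Section BidualFunctions.
Variables (R : realType) (K : numClosedFieldType) (E : complex_model R K) (k : nat).
Hypothesis k_gt1 : (1 < k)%N.
Local Notation C2 := (K * K)%type.
Implicit Types (W : bool -> set C2) (f g r s : bool -> C2 -> K).

Definition regular W f := (forall i x, W i x -> sd (f i) x) /\
  (forall i x, W i x -> x.1 != 0 -> f (~~ i) (swap_chart k x) = f i x).

Lemma regularU W f : chart_open k W -> (forall i x, W i x -> sd (f i) x) ->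
  (forall x, W true x -> x.1 != 0 -> f false (swap_chart k x) = f true x) -> regular W f.
Proof.
move=> [_ Wg _] fsd H; split=> // -[] x Wx x0; first exact: H.
have y0 : (swap_chart k x).1 != 0 by rewrite /= invr_eq0.
rewrite -[in RHS](swap_chartK k x0) -H//.
exact: (proj1 (Wg false x x0)).
Qed.

Lemma regularD W f g : regular W f -> regular W g -> regular W (fun i x => f i x + g i x).
Proof.
move=> [f1 f2] [g1 g2]; split=> i x Wx; first by apply: sdD; [exact: f1|exact: g1].
by move=> x0; rewrite f2// g2.
Qed.

Lemma regularM W f g : regular W f -> regular W g -> regular W (fun i x => f i x * g i x).
Proof.
move=> [f1 f2] [g1 g2]; split=> i x Wx; first by apply: sdM; [exact: f1|exact: g1].
by move=> x0; rewrite f2// g2.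
Qed.

Lemma regular_cst W (c : K) : regular W (fun _ _ => c).
Proof. by split => // i x _; exact: sd_cst. Qed.

(* Sections of the bundle E with transition matrix (z^k, z u; 0, z^-k), as columns (s1, s2), and
   of its dual, as rows (r1, r2). *)
Definition section_of W s1 s2 := (forall i x, W i x -> sd (s1 i) x /\ sd (s2 i) x) /\
  forall x, W true x -> x.1 != 0 ->
    s1 false (swap_chart k x) = x.1 ^+ k * s1 true x + x.1 * x.2 * s2 true x /\
    s2 false (swap_chart k x) = x.1 ^- k * s2 true x.

Definition cosection r1 r2 := (forall i x, sd (r1 i) x /\ sd (r2 i) x) /\
  forall x : C2, x.1 != 0 -> r1 true x = r1 false (swap_chart k x) * x.1 ^+ k /\
    r2 true x = r1 false (swap_chart k x) * (x.1 * x.2) + r2 false (swap_chart k x) * x.1 ^- k.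

Lemma regular_pairing W r1 r2 s1 s2 : chart_open k W -> cosection r1 r2 -> section_of W s1 s2 ->
  regular W (fun i x => r1 i x * s1 i x + r2 i x * s2 i x).
Proof.
move=> oW [rsd Hr] [ssd Hs]; apply: regularU => // [i x Wx|x Wx x0].
  have [? ?] := rsd i x; have [? ?] := ssd i x Wx.
  by apply: sdD; exact: sdM.
have [-> ->] := Hr x x0; have [-> ->] := Hs x Wx x0.
ring.
Qed.

(* The dual of E has the global sections A = (rowA1, rowA2), B = (0, rowB), C = (row01, row02),
   and E has e1 = (rowB, 0), e2 = (colE1, colE2). They satisfy u s = A(s) e1 + B(s) e2 and
   z^k u A + z u B = u C, so a section phi of the bidual is determined by phi(A) and phi(B). *)
Definition rowA1 (i : bool) (x : C2) : K := if i then 1 else x.1 ^+ k.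
Definition rowA2 (i : bool) (x : C2) : K := if i then 0 else - (x.1 ^+ k.-1 * x.2).
Definition rowB (i : bool) (x : C2) : K := x.2.
Definition row01 (i : bool) (x : C2) : K := if i then x.1 ^+ k else 1.
Definition row02 (i : bool) (x : C2) : K := if i then x.1 * x.2 else 0.
Definition zeroF (i : bool) (x : C2) : K := 0.
Definition colE1 (i : bool) (x : C2) : K := if i then 0 else x.1 ^+ k.-1 * x.2.
Definition colE2 (i : bool) (x : C2) : K := if i then 1 else x.1 ^+ k.
Definition monu (i : bool) (x : C2) : K := if i then x.2 else x.1 ^+ k * x.2.
Definition monzu (i : bool) (x : C2) : K := if i then x.1 * x.2 else x.1 ^+ k.-1 * x.2.
Definition monzku (i : bool) (x : C2) : K := if i then x.1 ^+ k * x.2 else x.2.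

Lemma predk x : x ^+ k = x * x ^+ k.-1 :> K.
Proof. by rewrite -exprS prednK// ltnW. Qed.

Lemma cosectionA : cosection rowA1 rowA2.
Proof.
split=> [[] x|x x0]; rewrite /rowA1 /rowA2 /=; [by split; sd_auto|by split; sd_auto|].
have xk : x.1 ^+ k.-1 != 0 by rewrite expf_neq0.
by rewrite !exprVn !predk; split; field; rewrite ?x0 ?xk.
Qed.

Lemma cosectionB : cosection zeroF rowB.
Proof.
split=> [[] x|x x0]; rewrite /rowB /zeroF /=; [by split; sd_auto|by split; sd_auto|].
by split; field; rewrite ?x0 ?expf_neq0.
Qed.

Lemma cosection0 : cosection row01 row02.
Proof.
split=> [[] x|x x0]; rewrite /row01 /row02 /=; [by split; sd_auto|by split; sd_auto|].
by split; ring.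
Qed.

Lemma section_e1 W : section_of W rowB zeroF.
Proof.
split=> [i x _|x _ x0]; rewrite /rowB /zeroF /=; first by split; sd_auto.
by split; ring.
Qed.

Lemma section_e2 W : section_of W colE1 colE2.
Proof.
split=> [[] x _|x _ x0]; rewrite /colE1 /colE2 /=; [by split; sd_auto|by split; sd_auto|].
have xk : x.1 ^+ k.-1 != 0 by rewrite expf_neq0.
by rewrite !exprVn !predk; split; field; rewrite ?x0 ?xk.
Qed.

Lemma regular_monu W : chart_open k W -> regular W monu.
Proof.
move=> oW; apply: regularU => // [[] x _|x _ x0]; rewrite /monu /=; [by sd_auto|by sd_auto|].
by rewrite exprVn; field; rewrite ?x0 ?expf_neq0.
Qed.

Lemma regular_monzu W : chart_open k W -> regular W monzu.
Proof.
move=> oW; apply: regularU => // [[] x _|x _ x0]; rewrite /monzu /=; [by sd_auto|by sd_auto|].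
have xk : x.1 ^+ k.-1 != 0 by rewrite expf_neq0.
by rewrite !exprVn !predk; field; rewrite ?x0 ?xk.
Qed.

Lemma regular_monzku W : chart_open k W -> regular W monzku.
Proof.
by move=> oW; apply: regularU => // -[] x _; rewrite /monzku; sd_auto.
Qed.

(** The diagonal line through x leaves both coordinate axes at once, so h vanishes at its points
    close to x and different from x. *)
Lemma eq_dense (D : set C2) (h : C2 -> K) x : open D -> D x -> sd h x ->
  (forall y, D y -> y.1 != 0 -> y.2 != 0 -> h y = 0) -> h x = 0.
Proof.
move=> oD Dx hsd H.
pose p (u : K) : C2 := (x.1 + u, x.2 + u).
have p0 : p 0 = x by rewrite /p !addr0 -surjective_pairing.
have psd : sd p 0 by rewrite /p; sd_auto.
have <- : h (p 0) = 0; last by rewrite p0.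
apply: (@cvg_eq_dnbhs0 K (fun u => h (p u))).
  by apply: sd_continuous; apply: sd_comp => //; rewrite p0.
have nD : \forall u \near (0 : K), D (p u) by apply: near_open_pre => //; rewrite p0.
have nz (a : K) : \forall u \near (0 : K)^', a + u != 0.
  have [->|a0] := eqVneq a 0.
    by have := nbhs_dnbhs_neq (0 : K); apply: filterS => u; rewrite add0r.
  apply: nbhs_dnbhs; have c : {for (0 : K), continuous (fun u : K => a + u)}.
    by apply: sd_continuous; sd_auto.
  apply: (c (fun u => u != 0)); apply: near_neq0; by rewrite addr0.
move: (nbhs_dnbhs nD) (nz x.1) (nz x.2); apply: filterS3 => u; exact: H.
Qed.

(** Here al, be and ga are the values of phi at A, C and B. Since A reads off the first coordinate
    on U, C reads it off on V, and B is the second coordinate times the fibre coordinate, it remains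
    to divide ga by the fibre coordinate. Off l this is immediate. *)
Lemma bidual_section W (al be ga : bool -> C2 -> K) i x : chart_open k W ->
  regular W al -> regular W be -> regular W ga ->
  (forall y, W true y -> monzku true y * al true y + monzu true y * ga true y = monu true y * be true y) ->
  W i x -> exists W', [/\ chart_open k W', forall j, W' j `<=` W j, W' i x &
    exists t, section_of W' (fun j => if j then al true else be false) t /\
      forall j y, W' j y -> ga j y = y.2 * t j y].
Proof.
move=> oW ral rbe rga rel Wx.
have [oWo Wg Wl] := oW.
have rel' y : W true y -> y.1 ^+ k * al true y + y.1 * ga true y = be true y.
  move=> Wy; apply/eqP; rewrite -subr_eq0; apply/eqP.
  apply: (eq_dense (h := fun y => y.1 ^+ k * al true y + y.1 * ga true y - be true y) (oWo true) Wy).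
    apply: sdD; last by apply: sdN; exact: (proj1 rbe true y Wy).
    apply: sdD; apply: sdM; [by sd_auto|exact: (proj1 ral true y Wy)|exact: sd_fst|exact: (proj1 rga true y Wy)].
  move=> v Wv v1 v2; apply: (mulfI v2); have := rel v Wv; rewrite /monzku /monzu /monu => h.
  by rewrite mulr0 mulrBr -h; ring.
have common W' t : chart_open k W' -> (forall j, W' j `<=` W j) ->
   (forall j y, W' j y -> sd (t j) y /\ ga j y = y.2 * t j y) ->
   section_of W' (fun j => if j then al true else be false) t.
  move=> oW' sW Ht; have [oWo' Wg' _] := oW'.
  split=> [j y Wy|y Wy y0].
    have [tsd _] := Ht j y Wy; split => //.
    by case: j Wy {tsd} => /sW Wy; [exact: (proj1 ral true y Wy)|exact: (proj1 rbe false y Wy)].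
  have Wy' := sW _ _ Wy; split.
    by rewrite (proj2 rbe true y Wy' y0) -rel'//; have [_ ->] := Ht true y Wy; ring.
  have WOy : open [set y | W' true y /\ y.1 != 0].
    by apply: openI => //; exact: open_neq0_fst.
  apply/eqP; rewrite -subr_eq0; apply/eqP.
  apply: (eq_dense (h := fun y => t false (swap_chart k y) - y.1 ^- k * t true y) WOy (conj Wy y0)).
    have sy := proj1 (Wg' true y y0) Wy.
    apply: sdD.
      by apply: (sd_comp (f := swap_chart k) (g := t false)); [exact: sd_swap_chart|case: (Ht false _ sy)].
    by apply: sdN; apply: sdM; [sd_auto; rewrite expf_neq0|case: (Ht true _ Wy)].
  move=> v [Wv _] v1 v2; have vk : v.1 ^+ k != 0 by rewrite expf_neq0.
  have sv := proj1 (Wg' true v v1) Wv.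
  have [_ e1] := Ht true v Wv; have [_ e2] := Ht false _ sv.
  have e3 := proj2 rga true v (sW _ _ Wv) v1.
  apply: (mulfI (mulf_neq0 vk v2)); rewrite mulr0 mulrBr -[X in X - _]e2 /= e3 e1.
  by field.
have [x20|x20] := eqVneq x.2 0; last first.
  exists (fun j => [set y | W j y /\ y.2 != 0]).
  have oW' : chart_open k (fun j => [set y | W j y /\ y.2 != 0]).
    split=> [j|j y y0|j j' a b [_]]; last by rewrite eqxx.
      by apply: openI => //; exact: open_neq0_snd.
    have yk : y.1 ^+ k != 0 by rewrite expf_neq0.
    split=> -[h1 h2]; split; [exact/(Wg j y y0)|by rewrite /= mulf_neq0|exact/(Wg j y y0)|].
    by move: h2; rewrite /= mulf_eq0 negb_or => /andP[].
  split=> //; first by move=> j y [].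
  pose t j (y : C2) := ga j y / y.2.
  have Ht j y : W j y /\ y.2 != 0 -> sd (t j) y /\ ga j y = y.2 * t j y.
    move=> [Wy y2]; split; last by rewrite /t mulrC divfK.
    by apply: sdM; [exact: (proj1 rga)|sd_auto].
  exists t; split; last by move=> j y /Ht[].
  by apply: common => // j y; case.
have xE : x = (x.1, 0) by rewrite -x20 -surjective_pairing.
have [e e0 eW] := chart_tube_sub E oW (eq_ind _ (W i) Wx _ xE).
have Wax j b : W j (b, 0) by apply: eW; exact: tube_axis.
have ga0 j b : ga j (b, 0) = 0.
  have axsd f (j' : bool) : regular W f -> forall b, sd (fun b => f j' (b, 0)) b.
    move=> rf b'; apply: (sd_comp (f := fun b : K => (b, 0)) (g := f j')); first by sd_auto.
    exact: (proj1 rf).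
  (* A regular function is constant on l, by Liouville. A nonzero constant c would make c z =
     be(1/z) - z^k al(z) on l, against [laurent_gap] for the exponent 1 < k. *)
  have gcst j' z : ga j' (z, 0) = ga (~~ j') (0, 0).
    have := @liouville _ _ E 0 (fun z => ga j' (z, 0)) (fun z => ga (~~ j') (z, 0)) (axsd _ _ rga) (axsd _ _ rga).
    rewrite expr0 mul1r; apply=> z' z0'.
    rewrite expr0 mul1r -(proj2 rga j' (z', 0) (Wax _ _) z0').
    by rewrite /swap_chart /= mulr0.
  suff c0 : ga true (0, 0) = 0.
    case: j => /=; last by rewrite gcst /=.
    by rewrite gcst /= gcst /= c0.
  pose a (m : nat) := if m == 1%N then ga true (0, 0) else 0.
  have := laurent_gap E (a := a) (axsd _ true ral) (axsd _ false rbe) (k := k).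
  move=> /(_ _ 1%N); rewrite /a eqxx k_gt1; apply => // z z0.
  rewrite big_ltn// eqxx expr1 big_nat big1 ?addr0; last first.
    by move=> m /andP[m1 _]; rewrite gtn_eqF// mul0r.
  have := proj2 rbe true (z, 0) (Wax _ _) z0; rewrite /swap_chart /= mulr0 => ->.
  rewrite -rel'; last exact: Wax.
  have gz : ga true (z, 0) = ga true (0, 0) by rewrite (gcst true z) (gcst false 0).
  by rewrite /= gz; ring.
have ot : open (tube k e) by exact: open_tube.
have /choice[t Ht] : forall j, exists t : C2 -> K, forall y, tube k e y -> sd t y /\ ga j y = y.2 * t y.
  move=> j; apply: (division E ot) => [y /eW Wy|z _]; [exact: (proj1 rga)|exact: ga0].
exists (fun=> tube k e).
have oW' := chart_open_tube k e0.
split=> //; first by rewrite xE; exact: tube_axis.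
exists t; split; last by move=> j y ty; have [] := Ht j y ty.
by apply: common => // j y /Ht.
Qed.

End BidualFunctions.

(** * The length of the first direct image *)

Section CechGeneric.
Variables (R : realType) (K : numClosedFieldType) (E : complex_model R K) (k : nat).
Local Notation C2 := (K * K)%type.
Implicit Types (W : bool -> set C2).

Lemma chart_openI W W' : chart_open k W -> chart_open k W' ->
  chart_open k (fun i => W i `&` W' i).
Proof.
move=> [W1 g1 l1] [W2 g2 l2]; split=> [i|i x x0|i j a b [h1 h2]].
- exact: openI.
- by split=> -[h1 h2]; split; [exact/(g1 i x x0)|exact/(g2 i x x0)|exact/(g1 i x x0)|exact/(g2 i x x0)].
- by split; [exact: l1 h1|exact: l2 h2].
Qed.

Lemma chart_openT : chart_open k (fun=> [set: C2]).
Proof. by split=> // i; exact: openT. Qed.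

Lemma cech_trivial_ext W c1 c2 d1 d2 : (forall x, c1 x = d1 x) -> (forall x, c2 x = d2 x) ->
  cech_trivial k W c1 c2 -> cech_trivial k W d1 d2.
Proof. by move=> /funext -> /funext ->. Qed.

Lemma cech_trivialB W c1 c2 d1 d2 : cech_trivial k W c1 c2 -> cech_trivial k W d1 d2 ->
  cech_trivial k W (fun x => c1 x - d1 x) (fun x => c2 x - d2 x).
Proof.
move=> h1 h2; apply: cech_trivial_ext (cech_trivialD h1 (cech_trivialZ (-1) h2)) => x;
by rewrite mulN1r.
Qed.

Lemma cech_trivial0 W : cech_trivial k W (fun=> 0) (fun=> 0).
Proof.
exists (fun _ _ => 0), (fun _ _ => 0); split=> [i x _|x _ _]; first by split; exact: sd_cst.
by split; rewrite !mulr0 ?addr0 subr0.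
Qed.

Definition mono_sum (a : nat -> K) (x : C2) := \sum_(1 <= m < k) a m * x.1 ^+ m.

Lemma sd_mono_sum a x : sd (mono_sum a) x.
Proof. by rewrite /mono_sum; apply: sd_sum => m; sd_auto. Qed.

Lemma mono_sumB a b x : mono_sum a x - mono_sum b x = mono_sum (fun m => a m - b m) x.
Proof. by rewrite /mono_sum -sumrB; apply: eq_bigr => m _; rewrite mulrBl. Qed.

Lemma cech_cochain_sub W W' c1 c2 : (forall i, W' i `<=` W i) ->
  cech_cochain W c1 c2 -> cech_cochain W' c1 c2.
Proof. by move=> sW H x /sW; exact: H. Qed.

Lemma cech_cochain_mono W c1 c2 a : cech_cochain W c1 c2 ->
  cech_cochain W (fun x => c1 x - mono_sum a x) c2.
Proof.
move=> H x Wx x0; have [h1 h2] := H x Wx x0; split => //.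
by apply: sdD => //; apply: sdN; exact: sd_mono_sum.
Qed.

(** The condition of [gsec] at one point, with the two components of the cochains kept apart;
    [cech_null] does the same for [gnul]. *)
Definition cech_germ (s1 s2 : bool -> C2 -> C2 -> K) i x :=
  exists W c1 c2, [/\ chart_open k W, W i x, cech_cochain W c1 c2 &
    forall j y, W j y -> exists W', [/\ chart_open k W', forall l, W' l `<=` W l, W' j y &
      cech_trivial k W' (fun z => s1 j y z - c1 z) (fun z => s2 j y z - c2 z)]].

Definition cech_null (s1 s2 : bool -> C2 -> C2 -> K) i x :=
  exists W, [/\ chart_open k W, W i x & cech_trivial k W (s1 i x) (s2 i x)].

(** The sheaf is concentrated at the singular point: the coefficients found on a neighbourhood of l
    account for all germs there, and off l every cochain is locally a coboundary. *)
Lemma cech_germs (s1 s2 : bool -> C2 -> C2 -> K) : (0 < k)%N ->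
  (forall i x, cech_germ s1 s2 i x) ->
  exists a, forall i x, cech_null (fun i x z => s1 i x z - mono_sum a z) s2 i x.
Proof.
move=> kp H; have [W [c1 [c2 [oW W0 cc HW]]]] := H true (0, 0).
have [e e0 [eW [a Ha]]] := cech_axis E kp oW W0 cc.
exists a => i x; have [x20|x20] := eqVneq x.2 0.
  have tx : tube k e x by rewrite (surjective_pairing x) x20; exact: tube_axis.
  have [W' [oW' sW' W'x HW']] := HW i x (eW i x tx).
  exists (fun j => W' j `&` tube k e); split=> //.
    by apply: chart_openI => //; exact: chart_open_tube.
  have t1 := cech_trivial_sub (W' := fun j => W' j `&` tube k e) (fun j y h => proj1 h) HW'.
  have t2 := cech_trivial_sub (W' := fun j => W' j `&` tube k e) (fun j y h => proj2 h) Ha.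
  apply: cech_trivial_ext (cech_trivialD t1 t2) => z; last by rewrite subrK.
  by rewrite addrA subrK.
have [W1 [d1 [d2 [oW1 W1x dd HW1]]]] := H i x.
have [W' [oW' sW' W'x HW']] := HW1 i x W1x.
have cd := cech_cochain_mono a (cech_cochain_sub sW' dd).
have tp := cech_off_axis i oW' cd.
exists (punctured W' i); split.
- exact: chart_open_punctured.
- by split => //; rewrite eqxx.
have t1 := cech_trivial_sub (W' := punctured W' i) (fun j y (h : punctured W' i j y) => let: And3 h _ _ := h in h) HW'.
apply: cech_trivial_ext (cech_trivialD t1 tp) => z; last by rewrite subrK.
by rewrite addrA subrK.
Qed.

Lemma cech_germs_uniq (s1 s2 : bool -> C2 -> C2 -> K) a b :
  cech_null (fun i x z => s1 i x z - mono_sum a z) s2 true (0, 0) ->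
  cech_null (fun i x z => s1 i x z - mono_sum b z) s2 true (0, 0) ->
  forall m, (0 < m < k)%N -> a m = b m.
Proof.
move=> [W [oW Wx H]] [W' [oW' Wx' H']] m mk.
have t1 := cech_trivial_sub (W' := fun j => W j `&` W' j) (fun j y h => proj1 h) H.
have t2 := cech_trivial_sub (W' := fun j => W j `&` W' j) (fun j y h => proj2 h) H'.
have := @cech_indep _ _ E k (fun j => W j `&` W' j) (fun m => b m - a m) true 0 (chart_openI oW oW') (conj Wx Wx').
have h : cech_trivial k (fun j => W j `&` W' j)
    (fun x => \sum_(1 <= m0 < k) (b m0 - a m0) * x.1 ^+ m0) (fun=> 0).
  apply: cech_trivial_ext (cech_trivialB t1 t2) => z; last by rewrite subrr.
  by rewrite opprB addrC addrA subrK mono_sumB.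
by move=> /(_ h m mk)/eqP; rewrite subr_eq0 eq_sym => /eqP.
Qed.

End CechGeneric.

Lemma mul_mx2 (K : pzRingType) (A : 'M[K]_2) (v : 'cV[K]_2) i :
  (A *m v) i 0 = A i 0 * v 0 0 + A i 1 * v 1 0.
Proof.
rewrite mxE !big_ord_recl big_ord0 addr0.
by congr (A i _ * v _ _ + A i _ * v _ _); apply/val_inj.
Qed.

Lemma ord2_cases (P : 'I_2 -> Prop) : P 0 -> P 1 -> forall i, P i.
Proof.
move=> P0 P1; case; case=> [|[|//]] h.
- by rewrite (_ : Ordinal h = 0)//; apply/val_inj.
- by rewrite (_ : Ordinal h = 1)//; apply/val_inj.
Qed.

Lemma colvec2P (K : pzRingType) (v w : 'cV[K]_2) :
  v 0 0 = w 0 0 -> v 1 0 = w 1 0 -> v = w.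
Proof. by move=> h0 h1; apply/colP; apply: ord2_cases. Qed.

Definition colvec2 (K : pzRingType) (a b : K) : 'cV[K]_2 :=
  \col_i (if i == 0 then a else b).

Lemma colvec2_0 (K : pzRingType) (a b : K) : colvec2 a b 0 0 = a.
Proof. by rewrite mxE. Qed.

Lemma colvec2_1 (K : pzRingType) (a b : K) : colvec2 a b 1 0 = b.
Proof. by rewrite mxE. Qed.

Section RowCoefficients.
Variable K : pzRingType.

(** The coefficient of z^m: entry i belongs to the exponent i + 1, and the empty sum gives 0 outside
    the range. *)
Definition coef_at n (p : 'rV[K]_n) (m : nat) : K := \sum_(i < n | i.+1 == m) p 0 i.

Lemma coef_atE n (p : 'rV[K]_n) (i : 'I_n) : coef_at p i.+1 = p 0 i.
Proof. by rewrite /coef_at (big_pred1 i) // => j; rewrite eqSS. Qed.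

End RowCoefficients.

Section CechClasses.
Variables (K : numClosedFieldType) (k : nat).
Local Notation C2 := (K * K)%type.
Local Notation V := (bool -> C2 -> C2 -> 'cV[K]_2).

Definition cech_class (m : nat) : V := fun _ _ z => colvec2 (z.1 ^+ m) 0.

Lemma mono_sum_row (a : nat -> K) z : mono_sum k a z = \sum_(i < k.-1) a i.+1 * z.1 ^+ i.+1.
Proof. by rewrite /mono_sum big_add1 big_mkord. Qed.

Lemma lin_comb_eval (n : nat) (c : 'rV[K]_n) (v : 'I_n -> V) (s : V) i x z j :
  (s - \sum_m c 0 m *: v m) i x z j 0 = s i x z j 0 - \sum_m c 0 m * v m i x z j 0.
Proof.
have e (u w : V) : (u - w) i x z j 0 = u i x z j 0 - w i x z j 0 by rewrite !fctE !mxE.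
rewrite e; congr (_ - _).
elim/big_rec2 : _ => [|m a b _ IH]; first by have -> : (0 : V) i x z = 0 by []; rewrite mxE.
have e' (u w : V) : (u + w) i x z j 0 = u i x z j 0 + w i x z j 0 by rewrite !fctE !mxE.
have e2 (r : K) (u : V) : (r *: u) i x z j 0 = r * u i x z j 0.
  by have -> : (r *: u) i x z = r *: u i x z by []; rewrite mxE.
by rewrite e' IH e2.
Qed.

Lemma cech_class_comb (c : 'rV[K]_(k.-1)) (s : V) i x z :
  (s - \sum_m c 0 m *: cech_class (m : 'I_(k.-1)).+1) i x z 0 0
    = s i x z 0 0 - mono_sum k (coef_at c) z /\
  (s - \sum_m c 0 m *: cech_class (m : 'I_(k.-1)).+1) i x z 1 0 = s i x z 1 0.
Proof.
rewrite !lin_comb_eval; split.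
  rewrite mono_sum_row; congr (_ - _); apply: eq_bigr => m _.
  by rewrite colvec2_0 coef_atE.
by rewrite big1 ?subr0// => m _; rewrite colvec2_1 mulr0.
Qed.

Lemma sub_eval (u w : C2 -> 'cV[K]_2) z j : (u - w) z j 0 = u z j 0 - w z j 0.
Proof. by rewrite !fctE !mxE. Qed.

Lemma cech_class_sd m i x z :
  sd (fun z => cech_class m i x z 0 0) z /\ sd (fun z => cech_class m i x z 1 0) z.
Proof.
split.
  by under eq_fun do rewrite colvec2_0; sd_auto.
by under eq_fun do rewrite colvec2_1; exact: sd_cst.
Qed.

Lemma cech_class_diff m i x j y z l : (cech_class m i x - cech_class m j y) z l 0 = 0.
Proof. by rewrite sub_eval subrr. Qed.

Lemma mono_sum_coef_at (a : nat -> K) z :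
  mono_sum k (coef_at (\row_(i < k.-1) a i.+1)) z = mono_sum k a z.
Proof.
by rewrite !mono_sum_row; apply: eq_bigr => i _; rewrite coef_atE mxE.
Qed.

End CechClasses.

Section Holo.
Variable R : realType.
Local Notation K := (Cplx R).

Lemma holo_sdP (D : set (C2 R)) (f : C2 R -> K) : open D ->
  holo D f <-> forall x, D x -> sd f x.
Proof.
move=> oD; split; first exact: (holo_sd (Cplx_model R) oD).
exact: (sd_holo oD).
Qed.

Lemma holoM_sdP m n (D : set (C2 R)) (M : C2 R -> 'M[K]_(m, n)) : open D ->
  holoM D M <-> forall x a b, D x -> sd (fun x => M x a b) x.
Proof.
move=> oD; split=> [H x a b Dx|H a b]; first by move/(holo_sdP _ oD): (H a b); apply.
by apply/holo_sdP => // x; exact: H.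
Qed.

End Holo.

Section CechCplx.
Variables (R : realType) (k : nat) (T : C2 R -> 'M[Cplx R]_2).
Hypothesis k_gt1 : (1 < k)%N.
Hypotheses (T00 : forall x, T x 0 0 = x.1 ^+ k) (T01 : forall x, T x 0 1 = x.1 * x.2)
  (T10 : forall x, T x 1 0 = 0) (T11 : forall x, T x 1 1 = x.1 ^- k).
Local Notation K := (Cplx R).

Lemma cechNP (W : chset R) (c : C2 R -> 'cV[K]_2) : openX k W ->
  cechN k T W c <-> cech_trivial k W (fun x => c x 0 0) (fun x => c x 1 0).
Proof.
move=> [oW _ _].
have e A (u v : 'cV[K]_2) i : (u - A *m v) i 0 = u i 0 - (A *m v) i 0 by rewrite !mxE.
split.
  move=> [s [sh H]]; exists (fun i x => s i x 0 0), (fun i x => s i x 1 0); split.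
    by move=> i x Wx; split; apply: (proj1 (holoM_sdP _ (oW i)) (sh i) x _ _ Wx).
  move=> x Wx x0; rewrite (H x Wx x0) !e !mul_mx2 T00 T01 T10 T11.
  by split => //; rewrite mul0r add0r.
move=> [s1 [s2 [ssd H]]]; exists (fun i x => colvec2 (s1 i x) (s2 i x)); split.
  move=> i; apply/holoM_sdP => // x a b Wx; have [h1 h2] := ssd i x Wx.
  rewrite (_ : (fun x => _) = if a == 0 then s1 i else s2 i).
    by case: ifP.
  by apply/funext => y; rewrite mxE; case: ifP.
move=> x Wx x0; have [h1 h2] := H x Wx x0.
apply: colvec2P; rewrite e mul_mx2 ?T00 ?T01 ?T10 ?T11 !colvec2_0 !colvec2_1.
  by rewrite h1.
by rewrite h2 mul0r add0r.
Qed.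

Lemma cechSP (W : chset R) (c : C2 R -> 'cV[K]_2) : openX k W ->
  cechS W c <-> cech_cochain W (fun x => c x 0 0) (fun x => c x 1 0).
Proof.
move=> [oW _ _]; have oW1 : open [set x : C2 R | W true x /\ x.1 != 0].
  by apply: openI => //; exact: (@open_neq0_fst K).
split.
  move=> /(holoM_sdP _ oW1) H x Wx x0.
  by split; apply: (H x _ _ (conj Wx x0)).
move=> H; apply/(holoM_sdP _ oW1) => x a b [Wx x0].
have [h1 h2] := H x Wx x0; have -> : b = 0 by apply/val_inj; case: b => -[].
exact: (ord2_cases (P := fun a => sd (fun x => c x a 0) x) h1 h2 a).
Qed.

Lemma cech_nullP (s : bool -> C2 R -> C2 R -> 'cV[K]_2) (c : 'rV[K]_(k.-1)) i x :
  (exists W, [/\ openX k W, W i x &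
     cechN k T W ((s - \sum_m c 0 m *: @cech_class K (m : 'I_(k.-1)).+1) i x)]) <->
  cech_null k (fun i x z => s i x z 0 0 - mono_sum k (coef_at c) z)
    (fun i x z => s i x z 1 0) i x.
Proof.
split=> -[W [oW Wx H]]; exists W; split => //.
  move/(cechNP _ oW) : H; apply: cech_trivial_ext => z.
    exact: (proj1 (cech_class_comb c s i x z)).
  exact: (proj2 (cech_class_comb c s i x z)).
apply/(cechNP _ oW); apply: cech_trivial_ext H => z.
  exact: (esym (proj1 (cech_class_comb c s i x z))).
exact: (esym (proj2 (cech_class_comb c s i x z))).
Qed.

Lemma h0_cech : h0 (V := (C2 R -> 'cV[K]_2 : lmodType K)) k (@cechS R) (cechN k T) k.-1.
Proof.
exists (fun m : 'I_(k.-1) => @cech_class K m.+1); split.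
  move=> m i x; exists (fun=> setT), (@cech_class K m.+1 i x).
  have oT : openX k (fun=> [set: C2 R]) by exact: (@chart_openT K k).
  split => //.
    apply/(cechSP _ oT) => z _ z0; exact: (cech_class_sd m.+1 i x z).
  move=> j y _; exists (fun=> setT); split=> //.
  apply/(cechNP _ oT); apply: cech_trivial_ext (cech_trivial0 k _) => z.
    exact: (esym (cech_class_diff _ _ _ _ _ _ _)).
  exact: (esym (cech_class_diff _ _ _ _ _ _ _)).
move=> s Hs.
have germs i x : cech_germ k (fun j y z => s j y z 0 0) (fun j y z => s j y z 1 0) i x.
  have [W [c [oW Wx Sc H]]] := Hs i x.
  exists W, (fun z => c z 0 0), (fun z => c z 1 0); split => //; first exact: (proj1 (cechSP c oW) Sc).
  move=> j y Wy; have [W' [oW' sW W'y N]] := H j y Wy; exists W'; split=> //.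
  move/(cechNP _ oW') : N; apply: cech_trivial_ext => z; exact: sub_eval.
have [a Ha] := cech_germs (Cplx_model R) (ltnW k_gt1) germs.
exists (\row_i a i.+1); split.
  move=> i x; apply/cech_nullP; have [W [oW Wx H]] := Ha i x; exists W; split=> //.
  apply: cech_trivial_ext H => z //.
  exact: (congr1 (fun u => s i x z 0 0 - u) (esym (mono_sum_coef_at k a z))).
(* Uniqueness is read off from the germ at the singular point, where the monomials are
   independent. *)
move=> c Hc; apply/rowP => i; rewrite mxE -coef_atE.
have H1 := proj1 (cech_nullP s c true (0, 0)) (Hc true (0, 0)).
apply: (cech_germs_uniq (Cplx_model R) (Ha true (0, 0)) H1).
by rewrite /= -ltn_predRL.
Qed.

End CechCplx.

(** * The bidual of the direct image *)

Section Generic.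
Variables (R : realType) (K : numClosedFieldType) (E : complex_model R K) (k : nat).
Hypothesis k_gt1 : (1 < k)%N.
Local Notation C2 := (K * K)%type.
Local Notation V := (bool -> C2 -> 'cV[K]_2).

Lemma regular_eq (W : bool -> set C2) (f g : bool -> C2 -> K) : chart_open k W ->
  regular k W f -> regular k W g ->
  (forall x, W true x -> x.1 != 0 -> x.2 != 0 -> f true x = g true x) ->
  forall i x, W i x -> f i x = g i x.
Proof.
move=> [oW Wg _] [fsd fg] [gsd gg] H.
have U x : W true x -> f true x = g true x.
  move=> Wx; apply/eqP; rewrite -subr_eq0; apply/eqP.
  apply: (eq_dense (h := fun x => f true x - g true x) (oW true) Wx).
    by apply: sdD; [exact: fsd|apply: sdN; exact: gsd].
  by move=> y Wy y1 y2; rewrite H// subrr.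
case=> x Wx; first exact: U.
apply/eqP; rewrite -subr_eq0; apply/eqP.
apply: (eq_dense (h := fun x => f false x - g false x) (oW false) Wx).
  by apply: sdD; [exact: fsd|apply: sdN; exact: gsd].
move=> y Wy y1 y2; rewrite -(fg false y Wy y1) -(gg false y Wy y1) /= U ?subrr//.
exact: (proj1 (Wg false y y1) Wy).
Qed.

Definition scaleF (f : bool -> C2 -> K) (s : V) : V := fun i x => f i x *: s i x.

Lemma scaleF_eval f (s t : V) i x j : (scaleF f s + t) i x j 0 = f i x * s i x j 0 + t i x j 0.
Proof.
have -> : (scaleF f s + t) i x = f i x *: s i x + t i x by [].
by rewrite !mxE.
Qed.

Definition is_sec (W : bool -> set C2) (s : V) :=
  section_of k W (fun i x => s i x 0 0) (fun i x => s i x 1 0).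

Lemma section_ext W (s1 s2 t1 t2 : bool -> C2 -> K) : (forall i x, s1 i x = t1 i x) ->
  (forall i x, s2 i x = t2 i x) -> section_of k W s1 s2 -> section_of k W t1 t2.
Proof.
move=> h1 h2.
have -> : s1 = t1 by apply/funext => i; apply/funext => x.
by have -> : s2 = t2 by apply/funext => i; apply/funext => x.
Qed.

Lemma section_sub (W W' : bool -> set C2) s1 s2 : (forall i, W' i `<=` W i) ->
  section_of k W s1 s2 -> section_of k W' s1 s2.
Proof. by move=> sW [h1 h2]; split => [i x /sW|x /sW]; [exact: h1|exact: h2]. Qed.

Lemma is_sec_lin W f (s t : V) : regular k W f -> is_sec W s -> is_sec W t ->
  is_sec W (scaleF f s + t).
Proof.
move=> [fsd fg] [ssd Hs] [tsd Ht].
apply: (@section_ext W (fun i x => f i x * s i x 0 0 + t i x 0 0)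
    (fun i x => f i x * s i x 1 0 + t i x 1 0)); try by move=> i x; rewrite scaleF_eval.
split=> [i x Wx|x Wx x0].
  have [? ?] := ssd i x Wx; have [? ?] := tsd i x Wx; have ? := fsd i x Wx.
  by split; apply: sdD => //; exact: sdM.
have [-> ->] := Hs x Wx x0; have [-> ->] := Ht x Wx x0.
by have /= -> := fg true x Wx x0; split; ring.
Qed.

Lemma is_sec0 W : is_sec W 0.
Proof.
apply: (@section_ext W (fun _ _ => 0) (fun _ _ => 0)); try by move=> i x; rewrite mxE.
split=> [i x _|x _ _]; first by split; exact: sd_cst.
by rewrite !mulr0 addr0.
Qed.

Definition colF (s1 s2 : bool -> C2 -> K) : V := fun i x => colvec2 (s1 i x) (s2 i x).

Lemma is_sec_colF W s1 s2 : section_of k W s1 s2 -> is_sec W (colF s1 s2).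
Proof.
by apply: section_ext => i x; rewrite ?colvec2_0 ?colvec2_1.
Qed.

Definition rowF (r1 r2 : bool -> C2 -> K) (s : V) : bool -> C2 -> K :=
  fun i x => r1 i x * s i x 0 0 + r2 i x * s i x 1 0.

Lemma rowF_lin r1 r2 f (s t : V) i x :
  rowF r1 r2 (scaleF f s + t) i x - (f i x * rowF r1 r2 s i x + rowF r1 r2 t i x) = 0.
Proof. by rewrite /rowF !scaleF_eval; ring. Qed.

Lemma monu_id (s : V) i x :
  monu k i x *: s i x = rowF (rowA1 k) (rowA2 k) s i x *: colF (@rowB K) (@zeroF K) i x
    + rowF (@zeroF K) (@rowB K) s i x *: colF (colE1 k) (colE2 k) i x.
Proof.
apply: colvec2P; rewrite !mxE /= /rowF /rowA1 /rowA2 /rowB /zeroF /colE1 /colE2 /monu;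
  case: i => /=; rewrite ?(predk k_gt1 x.1); ring.
Qed.

Lemma row_relation (s : V) i x :
  - (1 : K) * (monzku k i x * rowF (rowA1 k) (rowA2 k) s i x
     + (monzu k i x * rowF (@zeroF K) (@rowB K) s i x + 0))
  + (monu k i x * rowF (row01 k) (@row02 K) s i x + 0) = 0.
Proof.
rewrite /rowF /rowA1 /rowA2 /rowB /zeroF /row01 /row02 /monu /monzu /monzku.
by case: i; rewrite ?(predk k_gt1 x.1); ring.
Qed.

Lemma subr_eq0P (a b : K) : a = b -> a - b = 0.
Proof. by move=> ->; rewrite subrr. Qed.

Lemma unary_rel (a b : K) : -1 * (a * b + (0 * b + 0)) + (a * b + 0) = 0.
Proof. by rewrite mul0r !addr0 mulN1r addNr. Qed.

Lemma binary_rel (a b c d m p : K) : m * p = a * c + b * d ->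
  -1 * (a * c + (b * d + 0)) + (m * p + 0) = 0.
Proof. by move=> ->; rewrite !addr0 mulN1r addNr. Qed.

Lemma rel_combine (w a b c d m p : K) : w = m * p + 0 * p -> w = a * c + b * d ->
  m * p = a * c + b * d.
Proof. by move=> -> <-; rewrite mul0r addr0. Qed.

Lemma vec_unary_rel (a : K) (v : 'cV[K]_2) : -1 *: (a *: v + (0 *: v + 0)) + (a *: v + 0) = 0.
Proof. by rewrite scale0r !addr0 scaleN1r addNr. Qed.

Lemma vec_binary_rel (a b m : K) (v w u : 'cV[K]_2) : m *: u = a *: v + b *: w ->
  -1 *: (a *: v + (b *: w + 0)) + (m *: u + 0) = 0.
Proof. by move=> ->; rewrite !addr0 scaleN1r addNr. Qed.

(** For m = u, p = phi(psi) and q = psi(t), with a and b the values of psi at e1 and e2: both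
    products by u are the same combination. *)
Lemma cancel_rel (m p q a b c d t x : K) : m * p = a * c + b * d ->
  m * q = a * (1 * c + 0 * t) + b * (0 * c + x * t) -> d = x * t -> m != 0 -> p = q.
Proof.
move=> h1 h2 h3 m0; apply: (mulfI m0).
by rewrite h1 h2 h3; ring.
Qed.

Lemma lin2_solve (a b c d e g h : K) : a - (b * c + d) = 0 -> d - (e * g + h) = 0 -> h = 0 ->
  forall y w : K, y - (-1 * a + w) = 0 -> y = 0 -> w = b * c + e * g.
Proof.
move=> /eqP; rewrite subr_eq0 => /eqP -> /eqP; rewrite subr_eq0 => /eqP -> -> y w /eqP.
rewrite subr_eq0 => /eqP -> /eqP; rewrite mulN1r addrC subr_eq0 addr0 => /eqP -> //.
Qed.

Lemma lin_comb_id (f a b g c a' b' c' : K) : a - (g * b + c) = 0 -> a' - (g * b' + c') = 0 ->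
  f * a + a' - (g * (f * b + b') + (f * c + c')) = 0.
Proof.
move=> /eqP; rewrite subr_eq0 => /eqP -> /eqP; rewrite subr_eq0 => /eqP ->; ring.
Qed.

Lemma addr_mul1_subK (a b : K) : 1 * (a - b) + b = a.
Proof. by rewrite mul1r subrK. Qed.

Lemma sum_of_witnesses (a c s0 t u : K) :
  a - c - s0 = 0 -> c - t = 0 -> u - (1 * s0 + t) = 0 -> a - u = 0.
Proof.
move=> /subr0_eq h1 /subr0_eq h2 /subr0_eq ->.
by rewrite mul1r -h1 -h2 subrK subrr.
Qed.

Lemma sub_comb_id (f a b a' b' : K) : a - b = 0 -> a' - b' = 0 ->
  f * a + a' - (f * b + b') = 0.
Proof.
move=> /eqP; rewrite subr_eq0 => /eqP -> /eqP; rewrite subr_eq0 => /eqP ->; ring.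
Qed.

End Generic.

(** * Linearity of sections of the dual sheaf *)

Section DualModule.
Variables (R : realType) (k : nat) (M : omod R).
Local Notation K := (Cplx R).

Lemma openX_subX_trans (W W' W'' : chset R) : subX W'' W' -> subX W' W -> subX W'' W.
Proof. by move=> h1 h2 i x /h1/h2. Qed.

Lemma dual_sec_sub (W W' : chset R) (phi : car (dual k M)) :
  subX W' W -> sec W phi -> sec W' phi.
Proof.
by move=> sW H W'' oW'' sW''; apply: H => //; exact: openX_subX_trans sW.
Qed.

Lemma secO_regular (W : chset R) f : openX k W -> secO k W f <-> regular k W f.
Proof.
move=> [oW1 _ _]; split=> -[h1 h2]; split=> //.
  by move=> i; apply: (proj1 (holo_sdP _ (oW1 i)) (h1 i)).
by move=> i; apply/(holo_sdP _ (oW1 i)); exact: h1.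
Qed.

Lemma dual_sec_lin (W : chset R) (f : chfun R) (phi psi : car (dual k M)) :
  secO k W f -> sec W phi -> sec W psi -> sec W (act f phi + psi).
Proof.
move=> Of Hp Hq W' oW' sW'.
have [a1 b1 c1 d1] := Hp W' oW' sW'; have [a2 b2 c2 d2] := Hq W' oW' sW'.
have Of' : regular k W' f.
  have /(secO_regular _ oW') : secO k W' f; last by [].
  split; last by move=> i x Wx; apply: (proj2 Of); exact: sW'.
  by move=> i y Wy; apply: (proj1 Of); exact: sW'.
have reg g : secO k W' g <-> regular k W' g by exact: secO_regular.
split.
- move=> s Ss; apply/reg.
  exact: (regularD (regularM Of' (proj1 (reg _) (a1 s Ss))) (proj1 (reg _) (a2 s Ss))).
- move=> s Ss Ns i x Wx.
  have e1 := b1 s Ss Ns i x Wx; have e2 := b2 s Ss Ns i x Wx.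
  have -> : (act f phi + psi) W' s i x = f i x * phi W' s i x + psi W' s i x by [].
  by rewrite e1 e2 mulr0 addr0.
- move=> g s t Og Ss St i x Wx.
  exact: (lin_comb_id (f i x) (c1 g s t Og Ss St i x Wx) (c2 g s t Og Ss St i x Wx)).
- move=> W'' s oW'' sW'' Ss i x Wx.
  exact: (sub_comb_id (f i x) (d1 W'' s oW'' sW'' Ss i x Wx) (d2 W'' s oW'' sW'' Ss i x Wx)).
Qed.

(* A dual section phi respects the relation w = f s + g t, which is only required to hold
   in the quotient of sections by null representatives. *)
Lemma dual_lin2 (W W' : chset R) (phi : car (dual k M)) (f g : chfun R) (s t w : car M) :
  sec W phi -> openX k W' -> subX W' W ->
  (forall h (u v : car M), secO k W' h -> sec W' u -> sec W' v -> sec W' (act h u + v)) ->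
  sec W' (0 : car M) -> nul W' (0 : car M) ->
  secO k W' f -> secO k W' g -> sec W' s -> sec W' t -> sec W' w ->
  nul W' (act (fun _ _ => -1) (act f s + (act g t + 0)) + w) ->
  forall i x, W' i x -> phi W' w i x = f i x * phi W' s i x + g i x * phi W' t i x.
Proof.
move=> Hp oW' sW' closed S0 N0 Of Og Ss St Sw N i x Wx.
have [a1 b1 c1 d1] := Hp W' oW' sW'.
have O1 : secO k W' (fun _ _ => -1) by apply/(secO_regular _ oW'); exact: (regular_cst k W' (-1)).
have Sgt := closed _ _ _ Og St S0.
have Sx := closed _ _ _ Of Ss Sgt.
have Sy := closed _ _ _ O1 Sx Sw.
exact: (lin2_solve (c1 _ _ _ Of Ss Sgt i x Wx) (c1 _ _ _ Og St S0 i x Wx) (b1 _ S0 N0 i x Wx)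
  (c1 _ _ _ O1 Sx Sw i x Wx) (b1 _ Sy N i x Wx)).
Qed.

End DualModule.

Section Bidual.
Variables (R : realType) (k : nat) (T : C2 R -> 'M[Cplx R]_2).
Hypothesis k_gt1 : (1 < k)%N.
Hypotheses (T00 : forall x, T x 0 0 = x.1 ^+ k) (T01 : forall x, T x 0 1 = x.1 * x.2)
  (T10 : forall x, T x 1 0 = 0) (T11 : forall x, T x 1 1 = x.1 ^- k).
Local Notation K := (Cplx R).
Local Notation M := (tauE k T).
Local Notation V := (bool -> C2 R -> 'cV[K]_2).

Lemma tauE_secP (W : chset R) (s : V) : openX k W -> sec (o := M) W s <-> is_sec k W s.
Proof.
move=> [oW _ _]; split.
  move=> [sh H]; split.
    by move=> i x Wx; split; apply: (proj1 (holoM_sdP _ (oW i)) (sh i) x _ _ Wx).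
  move=> x Wx x0; rewrite (H x Wx x0) !mul_mx2 T00 T01 T10 T11.
  by split => //; rewrite mul0r add0r.
move=> [ssd H]; split.
  move=> i; apply/(holoM_sdP _ (oW i)) => x a b Wx; have [h1 h2] := ssd i x Wx.
  have -> : b = 0 by apply/val_inj; case: b => -[].
  exact: (ord2_cases (P := fun a => sd (fun x => s i x a 0) x) h1 h2 a).
move=> x Wx x0; have [h1 h2] := H x Wx x0.
apply: colvec2P; rewrite mul_mx2 ?T00 ?T01 ?T10 ?T11; first exact: h1.
by rewrite mul0r add0r; exact: h2.
Qed.

Lemma tauE_closed (W : chset R) (h : chfun R) (u v : car M) : openX k W ->
  secO k W h -> sec W u -> sec W v -> sec W (act h u + v).
Proof.
move=> oW /(secO_regular _ oW) Oh /(tauE_secP _ oW) Su /(tauE_secP _ oW) Sv.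
by apply/(tauE_secP _ oW); exact: (is_sec_lin Oh Su Sv).
Qed.

Lemma tauE_sec0 (W : chset R) : openX k W -> sec W (0 : car M).
Proof. by move=> oW; apply/(tauE_secP _ oW); exact: (@is_sec0 K k W). Qed.

Lemma tauE_nul0 (W : chset R) : nul W (0 : car M).
Proof. by move=> i x Wx. Qed.

Definition row_section (r1 r2 : bool -> C2 R -> K) : car (dual k M) :=
  fun _ s => rowF r1 r2 s.

Lemma row_section_sec (W : chset R) r1 r2 : cosection k r1 r2 -> sec W (row_section r1 r2).
Proof.
move=> Hr W' oW' sW'; split.
- move=> s /(tauE_secP _ oW') Ss; apply/(secO_regular _ oW').
  exact: (regular_pairing oW' Hr Ss).
- move=> s _ Ns i x Wx; have -> : row_section r1 r2 W' s i x = r1 i x * s i x 0 0 + r2 i x * s i x 1 0 by [].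
  by rewrite (Ns i x Wx) !mxE !mulr0 addr0.
- move=> f s t _ _ _ i x Wx; exact: (@rowF_lin K r1 r2 f s t i x).
- by move=> W'' s _ _ _ i x Wx; rewrite subrr.
Qed.

Lemma dual_sec0 (W : chset R) : sec W (0 : car (dual k M)).
Proof.
move=> W' oW' sW'; split.
- by move=> s Ss; apply/(secO_regular _ oW'); exact: (regular_cst k W' 0).
- by move=> s _ _ i x Wx.
- move=> f s t _ _ _ i x Wx.
  have -> : (0 : car (dual k M)) W' (act f s + t) i x = 0 by [].
  have -> : (0 : car (dual k M)) W' s i x = 0 by [].
  have -> : (0 : car (dual k M)) W' t i x = 0 by [].
  by rewrite mulr0 addr0 subrr.
- by move=> W'' s _ _ _ i x Wx; rewrite subrr.
Qed.

Lemma dual_nul0 (W : chset R) : nul W (0 : car (dual k M)).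
Proof. by move=> W' s oW' sW' Ss i x Wx. Qed.

(** The candidate t comes from [bidual_section]. For phi(psi) = psi(t), multiply by u: u psi is a
    combination of A and B, so u phi(psi) is the same combination of phi(A) = A(t) and phi(B) =
    B(t). Cancelling u is possible off l, and density gives the rest. *)
Lemma bidual_reflexive (W : chset R) (phi : car (dual k (dual k M))) i x :
  openX k W -> sec W phi -> W i x -> exists W' (t : car M),
    [/\ openX k W', subX W' W, W' i x, sec W' t & nul W' (phi - bidual_map t)].
Proof.
move=> oW Hp Wx.
pose A := row_section (rowA1 k) (rowA2 k); pose B := row_section (@zeroF K) (@rowB K).
pose C := row_section (row01 k) (@row02 K).
have sA W' : sec W' A by exact: (row_section_sec (cosectionA K k_gt1)).
have sB W' : sec W' B by exact: (row_section_sec (cosectionB K k)).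
have sC W' : sec W' C by exact: (row_section_sec (cosection0 K k)).
have WW : subX W W by move=> j y.
have dclosed W' : openX k W' -> forall h (u v : car (dual k M)),
    secO k W' h -> sec W' u -> sec W' v -> sec W' (act h u + v).
  by move=> _ h u v; exact: dual_sec_lin.
have [a0 _ _ _] := Hp W oW WW.
have rA := proj1 (secO_regular _ oW) (a0 A (sA W)).
have rB := proj1 (secO_regular _ oW) (a0 B (sB W)).
have rC := proj1 (secO_regular _ oW) (a0 C (sC W)).
have O1 (W' : chset R) : openX k W' -> secO k W' (monu k).
  by move=> oW'; apply/(secO_regular _ oW'); exact: (regular_monu oW').
have rel y : W true y -> monzku k true y * phi W A true y + monzu k true y * phi W B true y
    = monu k true y * phi W C true y.
  move=> Wy; have S0 := @dual_sec0 W; have N0 := @dual_nul0 W.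
  have Om := O1 W oW; have Oz : secO k W (fun _ _ => 0).
    by apply/(secO_regular _ oW); exact: (regular_cst k W 0).
  have Ok : secO k W (monzku k).
    by apply/(secO_regular _ oW); exact: (regular_monzku oW).
  have Oz1 : secO k W (monzu k).
    by apply/(secO_regular _ oW); exact: (regular_monzu k_gt1 oW).
  have Sw := dclosed W oW _ _ _ Om (sC W) S0.
  (* The section u C + 0 is expanded in two ways, as u times C and through A and B; comparing its
     values under phi gives the relation. *)
  have N1 : nul W (act (fun _ _ => -1) (act (monu k) C + (act (fun _ _ => 0) C + 0)) + (act (monu k) C + 0)).
    by move=> W1 s _ _ _ j z _; exact: (unary_rel (monu k j z) (C W1 s j z)).
  have N2 : nul W (act (fun _ _ => -1) (act (monzku k) A + (act (monzu k) B + 0)) + (act (monu k) C + 0)).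
    by move=> W1 s _ _ _ j z _; exact: (row_relation k_gt1 s j z).
  have e1 := dual_lin2 Hp oW WW (dclosed W oW) S0 N0 Om Oz (sC W) (sC W) Sw N1 Wy.
  have e2 := dual_lin2 Hp oW WW (dclosed W oW) S0 N0 Ok Oz1 (sA W) (sB W) Sw N2 Wy.
  exact: (esym (rel_combine e1 e2)).
have [W' [oW' sW' W'x [t [St gt]]]] := bidual_section (Cplx_model R) k_gt1 oW rA rC rB rel Wx.
exists W', (colF (fun j => if j then phi W A true else phi W C false) t).
have Stau : sec (o := M) W' (colF (fun j => if j then phi W A true else phi W C false) t).
  by apply/(tauE_secP _ oW'); exact: is_sec_colF.
split => //.
move=> W'' psi oW'' sW'' Spsi.
have sW2 := openX_subX_trans sW'' sW'.
have WW'' : subX W'' W'' by move=> j y.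
have S0 := @dual_sec0 W''; have N0 := @dual_nul0 W''.
have Om := O1 W'' oW''; have Oz (W3 : chset R) : openX k W3 -> secO k W3 (fun _ _ => 0).
  by move=> oW3; apply/(secO_regular _ oW3); exact: (regular_cst k W3 0).
pose e1 : car M := colF (@rowB K) (@zeroF K); pose e2 : car M := colF (colE1 k) (colE2 k).
have Se1 (W3 : chset R) : openX k W3 -> sec W3 e1.
  by move=> oW3; apply/(tauE_secP _ oW3); apply: is_sec_colF; exact: (section_e1 k W3).
have Se2 (W3 : chset R) : openX k W3 -> sec W3 e2.
  by move=> oW3; apply/(tauE_secP _ oW3); apply: is_sec_colF; exact: (section_e2 k_gt1 W3).
have [pa pb pc pd] := Spsi W'' oW'' WW''.
(* This is psi applied to u s = A(s) e1 + B(s) e2. *)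
have psi_id (W3 : chset R) (s : car M) : openX k W3 -> subX W3 W'' -> sec W3 s -> forall j y, W3 j y ->
    monu k j y * psi W3 s j y =
    psi W'' e1 j y * A W3 s j y + psi W'' e2 j y * B W3 s j y.
  move=> oW3 sW3 Ss j y Wy.
  have O3 := O1 W3 oW3; have OA : secO k W3 (A W3 s).
    by have [h _ _ _] := sA W3 W3 oW3 (fun _ _ h => h); exact: h.
  have OB : secO k W3 (B W3 s).
    by have [h _ _ _] := sB W3 W3 oW3 (fun _ _ h => h); exact: h.
  have Z0 := tauE_sec0 oW3; have ZN := @tauE_nul0 W3.
  have cl h (u v : car M) : secO k W3 h -> sec W3 u -> sec W3 v -> sec W3 (act h u + v).
    by move=> *; exact: tauE_closed.
  have Sw := cl _ _ _ O3 Ss Z0.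
  have N1 : nul W3 (act (fun _ _ => -1) (act (monu k) s + (act (fun _ _ => 0) s + 0)) + (act (monu k) s + 0)).
    by move=> j' z _; exact: (vec_unary_rel (monu k j' z) (s j' z)).
  have N2 : nul W3 (act (fun _ _ => -1) (act (A W3 s) e1 + (act (B W3 s) e2 + 0)) + (act (monu k) s + 0)).
    by move=> j' z _; exact: (vec_binary_rel (monu_id k_gt1 s j' z)).
  have h1 := dual_lin2 Spsi oW3 sW3 cl Z0 ZN O3 (Oz W3 oW3) Ss Ss Sw N1 Wy.
  have h2 := dual_lin2 Spsi oW3 sW3 cl Z0 ZN OA OB (Se1 W3 oW3) (Se2 W3 oW3) Sw N2 Wy.
  have d1 := subr0_eq (pd W3 e1 oW3 sW3 (Se1 W'' oW'') j y Wy).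
  have d2 := subr0_eq (pd W3 e2 oW3 sW3 (Se2 W'' oW'') j y Wy).
  rewrite (rel_combine h1 h2) d1 d2.
  by congr (_ + _); exact: mulrC.
have [fa _ _ _] := Hp W'' oW'' sW2.
have [_ _ _ fd] := Hp W oW WW.
pose tt : car M := colF (fun j => if j then phi W A true else phi W C false) t.
have Stt : sec W'' tt.
  apply/(tauE_secP _ oW''); apply: (section_sub sW'').
  exact: (proj1 (tauE_secP _ oW') Stau).
suff H : forall j y, W'' j y -> phi W'' psi j y = psi W'' tt j y.
  move=> j y Wy; exact: (subr_eq0P (H j y Wy)).
apply: (regular_eq oW'').
- exact: (proj1 (secO_regular _ oW'') (fa psi Spsi)).
- exact: (proj1 (secO_regular _ oW'') (pa tt Stt)).
move=> y Wy y1 y2.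
have Sw := dclosed W'' oW'' _ _ _ Om Spsi S0.
have N1 : nul W'' (act (fun _ _ => -1) (act (monu k) psi + (act (fun _ _ => 0) psi + 0)) + (act (monu k) psi + 0)).
  by move=> W1 s _ _ _ j z _; exact: (unary_rel (monu k j z) (psi W1 s j z)).
have N2 : nul W'' (act (fun _ _ => -1) (act (psi W'' e1) A + (act (psi W'' e2) B + 0)) + (act (monu k) psi + 0)).
  by move=> W1 s oW1 sW1 Ss j z Wz; exact: (binary_rel (psi_id W1 s oW1 sW1 Ss j z Wz)).
have h1 := dual_lin2 Hp oW'' sW2 (dclosed W'' oW'') S0 N0 Om (Oz W'' oW'') Spsi Spsi Sw N1 Wy.
have h2 := dual_lin2 Hp oW'' sW2 (dclosed W'' oW'') S0 N0 (pa e1 (Se1 W'' oW'')) (pa e2 (Se2 W'' oW''))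
   (sA W'') (sB W'') Sw N2 Wy.
have h3 := rel_combine h1 h2.
have dA := subr0_eq (fd W'' A oW'' sW2 (sA W) true y Wy).
have dB := subr0_eq (fd W'' B oW'' sW2 (sB W) true y Wy).
rewrite dA dB in h3.
have h4 := psi_id W'' tt oW'' WW'' Stt true y Wy.
have cE1 : colF (fun j => if j then phi W A true else phi W C false) t true y 0 0 = phi W A true y.
  exact: colvec2_0.
have cE2 : colF (fun j => if j then phi W A true else phi W C false) t true y 1 0 = t true y.
  exact: colvec2_1.
have tA : A W'' tt true y = 1 * phi W A true y + 0 * t true y.
  by rewrite -cE1 -cE2.
have tB : B W'' tt true y = 0 * phi W A true y + y.2 * t true y.
  by rewrite -cE1 -cE2.
rewrite tA tB in h4.
exact: (cancel_rel h3 h4 (gt true y (sW'' true y Wy)) y2).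
Qed.

(** Near each point a germ differs from a section c of the bidual by some s0 coming from tau_* E,
    and c itself comes from some t; hence the germ comes from s0 + t and is null. *)
Lemma h0_bidu : h0 k (biduS (k := k) (T := T)) (biduN (k := k) (T := T)) 0.
Proof.
exists (fun i => 0); split; first by case.
move=> s gs; exists 0; split; last by move=> c _; rewrite [c]thinmx0.
move=> i x; rewrite big_ord0 subr0.
have [W [c [oW Wx Sc H]]] := gs i x.
have [W1 [oW1 sW1 W1x [S1 [s0 [Ss0 N0]]]]] := H i x Wx.
have [W2 [t [oW2 sW2 W2x St Nt]]] := bidual_reflexive oW Sc Wx.
pose W3 : chset R := fun j => W1 j `&` W2 j.
have oW3 : openX k W3 by exact: (chart_openI oW1 oW2).
have s31 : subX W3 W1 by move=> j y [].
have s32 : subX W3 W2 by move=> j y [].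
have cl (W4 W5 : chset R) (s1 : car M) : openX k W4 -> openX k W5 -> subX W5 W4 -> sec W4 s1 -> sec W5 s1.
  move=> oW4 oW5 s54 /(tauE_secP _ oW4) h; apply/(tauE_secP _ oW5).
  exact: (section_sub s54 h).
have cst1 (W4 : chset R) : openX k W4 -> secO k W4 (fun _ _ => 1).
  by move=> oW4; apply/(secO_regular _ oW4); exact: (regular_cst k W4 1).
have St3 := cl _ _ _ oW2 oW3 s32 St.
have Ss3 := cl _ _ _ oW1 oW3 s31 Ss0.
pose u : car M := act (fun _ _ => 1) s0 + t.
have Su : sec W3 u by exact: (tauE_closed oW3 (cst1 _ oW3) Ss3 St3).
exists W3; split => //; split.
  have -> : s i x = act (fun _ _ => 1) (s i x - c : car (dual k (dual k M))) + c.
    apply/funext => W4; apply/funext => psi; apply/funext => j; apply/funext => y.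
    exact: (esym (addr_mul1_subK _ _)).
  apply: (dual_sec_lin (cst1 _ oW3)); first exact: (dual_sec_sub s31 S1).
  by apply: (dual_sec_sub _ Sc) => j y /s31/sW1.
exists u; split => // W4 psi oW4 s43 Spsi j y Wy.
have [_ _ psiL _] := Spsi W4 oW4 (fun j y h => h).
have h1 := N0 W4 psi oW4 (openX_subX_trans s43 s31) Spsi j y Wy.
have h2 := Nt W4 psi oW4 (openX_subX_trans s43 s32) Spsi j y Wy.
have h3 := psiL (fun _ _ => 1) s0 t (cst1 _ oW4) (cl _ _ _ oW3 oW4 s43 Ss3) (cl _ _ _ oW3 oW4 s43 St3) j y Wy.
exact: (sum_of_witnesses h1 h2 h3).
Qed.

End Bidual.

(** * Rigidity of the quantum gluing *)

Section Bracket.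
Variables (R : realType) (K : numClosedFieldType) (E : complex_model R K).
Local Notation C2 := (K * K)%type.
Implicit Types (f g : C2 -> K).

Lemma axis_liouville n f g : (forall x, sd f x) -> (forall x, sd g x) ->
  (forall z, z != 0 -> z ^+ n * f (z, 0) = g (z^-1, 0)) ->
  (forall z, f (z, 0) = 0 ^+ n * g (0, 0)) /\ (forall z, g (z, 0) = 0 ^+ n * g (0, 0)).
Proof.
move=> fsd gsd H.
have fz z : sd (fun w => f (w, 0)) z.
  by apply: (sd_comp (f := fun w : K => (w, 0 : K)) (g := f)); [sd_auto|exact: fsd].
have gz z : sd (fun w => g (w, 0)) z.
  by apply: (sd_comp (f := fun w : K => (w, 0 : K)) (g := g)); [sd_auto|exact: gsd].
have fE := liouville E fz gz H; split => // z.
have gE w : w != 0 -> g (w, 0) = 0 ^+ n * g (0, 0).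
  move=> w0; rewrite -{1}[w]invrK -H ?invr_neq0// fE mulrA.
  by clear H fE; case: n => [|n]; [rewrite !expr0 mul1r|rewrite expr0n/= mulr0 mul0r].
have [->|] := eqVneq z 0; last exact: gE.
apply: (@cvg_eq_dnbhs0 K (fun w => g (w, 0))); first exact: sd_continuous.
by rewrite near_withinE; apply: (@filterE _ _ (nbhs_filter (0 : K))) => w; exact: gE.
Qed.

(** Extracts the coefficient of u from an equation modulo u^2 on a fibre. Only continuity is
    required, which is what is known of the brackets. *)
Lemma cancel_var (F H : K -> K) : {for 0, continuous F} -> {for 0, continuous H} ->
  (forall u, u * F u = u ^+ 2 * H u) -> F 0 = 0.
Proof.
move=> Fc Hc FH.
have : F 0 - 0 * H 0 = 0; last by rewrite mul0r subr0.
apply: (@cvg_eq_dnbhs0 K (fun u => F u - u * H u)).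
  have c1 : u * H u @[u --> (0 : K)] --> 0 * H 0 by apply: cvgM Hc; exact: cvg_id.
  by apply: cvgB c1; exact: Fc.
rewrite near_withinE; apply: (@filterE _ _ (nbhs_filter (0 : K))) => u u0.
by apply: (mulfI u0); rewrite mulr0 mulrBr FH expr2 mulrA subrr.
Qed.

Lemma fiber_shift1 (h z : K) : h *: (1, 0) + (z, 0) = (h + z, 0) :> C2.
Proof.
apply: injective_projections => /=.
  by rewrite [h *: _]mulr1.
by rewrite [h *: _]mulr0 addr0.
Qed.

Lemma fiber_shift2 (h z : K) : h *: (0, 1) + (z, 0) = (z, h) :> C2.
Proof.
apply: injective_projections => /=.
  by rewrite [h *: _]mulr0 add0r.
by rewrite [h *: _]mulr1 addr0.
Qed.

Lemma cst_dderiv f (x v : C2) (c : K) :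
  (\forall h \near (0 : K)^', f (h *: v + x) = c) -> f x = c -> 'D_v f x = 0.
Proof.
move=> H fx; apply/cvg_lim; first exact: norm_hausdorff.
apply: cvg_near_cst; move: H; apply: filterS => h /= ->.
by rewrite fx subrr scaler0.
Qed.

Lemma axis_dderiv1 f (z c : K) : z != 0 -> (forall w, w != 0 -> f (w, 0) = c) ->
  'D_(1, 0) f (z, 0) = 0.
Proof.
move=> z0 H; apply: (cst_dderiv (c := c)); last exact: H.
have cz : {for (0 : K), continuous (fun h : K => h + z)}.
  exact: (cvgD cvg_id (cvg_cst z)).
have nz0 : \forall w \near 0 + z, w != 0 by rewrite add0r; exact: near_neq0.
have nz : \forall h \near (0 : K), h + z != 0 by exact: (cz _ nz0).
 rewrite near_withinE; move: nz; apply: filterS => h hz _.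
rewrite fiber_shift1.
exact: H.
Qed.

Lemma axis_dderiv2 f g (z : K) : {for 0, continuous (fun u => g (z, u))} ->
  (forall u, f (z, u) = u * g (z, u)) -> 'D_(0, 1) f (z, 0) = g (z, 0).
Proof.
move=> gc fg; apply/cvg_lim; first exact: norm_hausdorff.
have h : g (z, u) @[u --> (0 : K)^'] --> g (z, 0).
  by apply: cvg_trans gc; apply: cvg_app; exact: cvg_within.
apply: cvg_trans h; apply: near_eq_cvg.
rewrite near_withinE; apply: (@filterE _ _ (nbhs_filter (0 : K))) => u u0.
have e : (f \o shift (z, 0)) (u *: (0, 1)) = f (z, u) by rewrite -(fiber_shift2 u z).
rewrite e.
by rewrite !fg mul0r subr0 [_ *: _]mulKf.
Qed.

Lemma continuous2B (F G : K -> K) z : {for z, continuous F} -> {for z, continuous G} ->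
  {for z, continuous (fun u => F u - G u)}.
Proof.
move=> Fc Gc; have c1 : F u @[u --> z] --> F z by exact: Fc.
by apply: cvgB c1 _; exact: Gc.
Qed.

Lemma continuous2D (F G : K -> K) z : {for z, continuous F} -> {for z, continuous G} ->
  {for z, continuous (fun u => F u + G u)}.
Proof.
move=> Fc Gc; have c1 : F u @[u --> z] --> F z by exact: Fc.
by apply: cvgD c1 _; exact: Gc.
Qed.

Definition std_bracket f g (x : C2) : K :=
  'D_(1, 0) f x * 'D_(0, 1) g x - 'D_(0, 1) f x * 'D_(1, 0) g x.

Lemma fiber_continuous (z : K) : {for 0, continuous (fun u : K => (z, u))}.
Proof. by apply: sd_continuous; sd_auto. Qed.

Lemma continuous_fiber f (z : K) : {for (z, 0), continuous f} ->
  {for 0, continuous (fun u => f (z, u))}.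
Proof. by move=> fc; apply: (continuous_comp (@fiber_continuous z) fc). Qed.

Lemma std_bracket_continuous (D : set C2) f g x : open D -> D x ->
  (forall y, D y -> sd f y) -> (forall y, D y -> sd g y) ->
  {for x, continuous (std_bracket f g)}.
Proof.
move=> oD Dx /(sd_holo oD)/(_ x Dx)[_ f1 f2] /(sd_holo oD)/(_ x Dx)[_ g1 g2].
have h1 : 'D_(1, 0) f y * 'D_(0, 1) g y @[y --> x] --> 'D_(1, 0) f x * 'D_(0, 1) g x.
  by apply: cvgM; [exact: f1|exact: g2].
have h2 : 'D_(0, 1) f y * 'D_(1, 0) g y @[y --> x] --> 'D_(0, 1) f x * 'D_(1, 0) g x.
  by apply: cvgM; [exact: f2|exact: g1].
by apply: cvgB h2; exact: h1.
Qed.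

End Bracket.

Section Rigidity.
Variables (R : realType) (K : numClosedFieldType) (E : complex_model R K) (k : nat).
Hypothesis k_gt2 : (2 < k)%N.
Local Notation C2 := (K * K)%type.
Local Notation swap := (@swap_chart K k).
Local Notation bracket := std_bracket.

Definition sd_mx (D : set C2) (M : C2 -> 'M[K]_2) :=
  forall x a b, D x -> sd (fun y => M y a b) x.

Definition bracket_mx (s : C2 -> K) (X Y : C2 -> 'M[K]_2) (x : C2) : 'M[K]_2 :=
  \matrix_(a, b) \sum_c s x *
    ('D_(1, 0) (fun y => X y a c) x * 'D_(0, 1) (fun y => Y y c b) x -
     'D_(0, 1) (fun y => X y a c) x * 'D_(1, 0) (fun y => Y y c b) x).

Lemma sum_ord2 (F : 'I_2 -> K) : \sum_i F i = F 0 + F 1.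
Proof.
rewrite !big_ord_recl big_ord0 addr0.
by congr (F _ + F _); apply/val_inj.
Qed.

Lemma mulmx2E (A B : 'M[K]_2) i j : (A *m B) i j = A i 0 * B 0 j + A i 1 * B 1 j.
Proof. by rewrite mxE sum_ord2. Qed.

Lemma mx_subE (A B : 'M[K]_2) i j : (A - B) i j = A i j - B i j.
Proof. by rewrite !mxE. Qed.

Lemma mx_addE (A B : 'M[K]_2) i j : (A + B) i j = A i j + B i j.
Proof. by rewrite !mxE. Qed.

Lemma mx_scaleE (c : K) (A : 'M[K]_2) i j : (c *: A) i j = c * A i j.
Proof. by rewrite mxE. Qed.

Lemma bracket_mxE s X Y x a b : bracket_mx s X Y x a b =
  s x * bracket (fun y => X y a 0) (fun y => Y y 0 b) x +
  s x * bracket (fun y => X y a 1) (fun y => Y y 1 b) x.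
Proof. by rewrite mxE sum_ord2. Qed.

Variables (T : C2 -> 'M[K]_2).
Hypotheses (T00 : forall x, T x 0 0 = x.1 ^+ k) (T01 : forall x, T x 0 1 = x.1 * x.2)
  (T10 : forall x, T x 1 0 = 0) (T11 : forall x, T x 1 1 = x.1 ^- k).

(** On l the matrix T is diag(z^k, z^-k). The diagonal entries of A and B then agree under z -> 1/z,
    so they are constant, and the upper right ones satisfy z^(2k) A01(z) = B01(1/z), so they
    vanish. *)
Lemma axis_gluing (A B : C2 -> 'M[K]_2) : sd_mx setT A -> sd_mx setT B ->
  (forall z, z != 0 -> B (swap (z, 0)) *m T (z, 0) = T (z, 0) *m A (z, 0)) ->
  exists a d : K, forall z,
    [/\ A (z, 0) 0 0 = a, B (z, 0) 0 0 = a, A (z, 0) 1 1 = d & B (z, 0) 1 1 = d] /\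
    A (z, 0) 0 1 = 0 /\ B (z, 0) 0 1 = 0.
Proof.
move=> Asd Bsd H; exists (B (0, 0) 0 0), (B (0, 0) 1 1).
have e (z : K) : swap (z, 0) = (z^-1, 0) by rewrite /swap_chart /= mulr0.
have G i j z : z != 0 -> B (z^-1, 0) i 0 * T (z, 0) 0 j + B (z^-1, 0) i 1 * T (z, 0) 1 j =
    T (z, 0) i 0 * A (z, 0) 0 j + T (z, 0) i 1 * A (z, 0) 1 j.
  by move=> /H; rewrite e => /matrixP/(_ i j); rewrite !mulmx2E.
have sdA i j x := Asd x i j I; have sdB i j x := Bsd x i j I.
have zk (z : K) : z != 0 -> z ^+ k != 0 by move=> z0; rewrite expf_neq0.
have [a1 a2] : (forall z, A (z, 0) 0 0 = 0 ^+ 0 * B (0, 0) 0 0) /\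
    (forall z, B (z, 0) 0 0 = 0 ^+ 0 * B (0, 0) 0 0).
  apply: (axis_liouville E (sdA 0 0) (sdB 0 0)) => z z0.
  have := G 0 0 z z0; rewrite T00 T10 T01 /= !mulr0 mul0r !addr0 expr0 mul1r mulrC.
  by move/(mulfI (zk z z0)).
have [d1 d2] : (forall z, A (z, 0) 1 1 = 0 ^+ 0 * B (0, 0) 1 1) /\
    (forall z, B (z, 0) 1 1 = 0 ^+ 0 * B (0, 0) 1 1).
  apply: (axis_liouville E (sdA 1 1) (sdB 1 1)) => z z0.
  have := G 1 1 z z0; rewrite T01 T11 T10 /= !mulr0 mul0r !add0r expr0 mul1r mulrC.
  by move/(mulfI (invr_neq0 (zk z z0))).
have [b1 b2] : (forall z, A (z, 0) 0 1 = 0 ^+ (k + k) * B (0, 0) 0 1) /\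
    (forall z, B (z, 0) 0 1 = 0 ^+ (k + k) * B (0, 0) 0 1).
  apply: (axis_liouville E (sdA 0 1) (sdB 0 1)) => z z0.
  have := G 0 1 z z0; rewrite T01 T11 T00 /= !mulr0 mul0r !(addr0, add0r) => h.
  by rewrite exprD -mulrA -h mulrCA mulfV ?zk// mulr1.
have kk : 0 ^+ (k + k) = 0 :> K by rewrite expr0n; case: k k_gt2.
by move=> z; rewrite a1 a2 b1 b2 d1 d2 kk expr0 !mul0r !mul1r.
Qed.

Lemma sd_swap_comp (f : C2 -> K) x : (forall y, sd f y) -> x.1 != 0 ->
  sd (fun y => f (swap y)) x.
Proof.
move=> fsd x0; apply: (sd_comp (f := swap) (g := f)); last exact: fsd.
exact: sd_swap_chart.
Qed.

Lemma division_axis (f : C2 -> K) : (forall x, sd f x) -> (forall z, f (z, 0) = 0) ->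
  exists2 g : C2 -> K, (forall x, sd g x) & forall x, f x = x.2 * g x.
Proof.
move=> fsd f0; have [g H] := division E (@openT _) (fun x _ => fsd x) (fun z _ => f0 z).
by exists g => x; have [] := H x I.
Qed.

Lemma continuous_sd_fiber (f : C2 -> K) z : sd f (z, 0) ->
  {for 0, continuous (fun u => f (z, u))}.
Proof. by move=> fsd; apply: continuous_fiber; exact: sd_continuous. Qed.

Lemma swap_fiber z (u : K) : swap (z, u) = (z^-1, z ^+ k * u).
Proof. by []. Qed.

Lemma fiber_solve (c d z b w : K) : c * z + b - w - z * d = 0 -> (d - c) * z = b - w.
Proof.
move/subr0_eq => h; rewrite mulrBl [d * z]mulrC -h; ring.
Qed.

(* The hypothesis is the entry (0, 1) of B T - T A = O(u^2), with u al and v b01 for the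
   entries (0, 1) of A and B; the proof compares the coefficients of u. *)
Lemma fiber_order0 (a11 al b00 b01 h : C2 -> K) (c d : K) :
  (forall x, sd a11 x) -> (forall x, sd al x) -> (forall x, sd b00 x) -> (forall x, sd b01 x) ->
  (forall x, x.1 != 0 -> sd h x) ->
  (forall z, b00 (z, 0) = c) -> (forall z, a11 (z, 0) = d) ->
  (forall x, x.1 != 0 -> b00 (swap x) * (x.1 * x.2) + (swap x).2 * b01 (swap x) * x.1 ^- k -
    (x.1 ^+ k * (x.2 * al x) + x.1 * x.2 * a11 x) = x.2 ^+ 2 * h x) ->
  c = d /\ (forall z, al (z, 0) = 0 /\ b01 (z, 0) = 0).
Proof.
move=> a11sd alsd b00sd b01sd hsd b00c a11d H.
have k0 : (0 < k)%N by apply: leq_trans k_gt2.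
have F z : z != 0 -> c * z + b01 (z^-1, 0) - z ^+ k * al (z, 0) - z * d = 0.
  move=> z0.
  have := @cancel_var K (fun u => b00 (swap (z, u)) * z + b01 (swap (z, u)) - z ^+ k * al (z, u) - z * a11 (z, u))
    (fun u => h (z, u)).
  rewrite swap_fiber mulr0 b00c a11d; apply.
  - apply: (@continuous_sd_fiber (fun x => b00 (swap x) * x.1 + b01 (swap x) - x.1 ^+ k * al x - x.1 * a11 x)).
    have s1 := sd_swap_comp (x := (z, 0)) b00sd z0.
    have s2 := sd_swap_comp (x := (z, 0)) b01sd z0.
    have s3 := sdM (@sd_fst K K K (z, 0)) (a11sd (z, 0)).
    have s4 := sdM (sdX k (@sd_fst K K K (z, 0))) (alsd (z, 0)).
    have s5 := sdM s1 (@sd_fst K K K (z, 0)).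
    exact: (sdD (sdD (sdD s5 s2) (sdN s4)) (sdN s3)).
  - by apply: continuous_sd_fiber; exact: hsd.
  move=> u; have zk : z ^+ k != 0 by rewrite expf_neq0.
  have := H (z, u) z0; rewrite /= => <-.
  by field.
have [fsd gsd] : (forall z, sd (fun w => al (w, 0)) z) /\ (forall z, sd (fun w => b01 (w, 0)) z).
  split=> z.
    by apply: (sd_comp (f := fun w : K => (w, 0 : K)) (g := al)); [sd_auto|exact: alsd].
  by apply: (sd_comp (f := fun w : K => (w, 0 : K)) (g := b01)); [sd_auto|exact: b01sd].
(* By [F], the monomial (d - c) z is of the form excluded by [laurent_gap]. *)
have cd : d - c = 0.
  apply: (@laurent_gap R K E k (fun m => if m == 1%N then d - c else 0) _ _ fsd gsd _ 1%N);
    last by rewrite /= (leq_trans _ k_gt2).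
  move=> z z0; rewrite big_ltn ?(leq_trans _ k_gt2)//= big_nat big1 ?addr0; last first.
    by move=> [|[|i]]//= _; rewrite mul0r.
  by rewrite expr1 (fiber_solve (F z z0)).
have dc : c = d by rewrite -[d](subrK c) cd add0r.
split => //.
have G z : z != 0 -> z ^+ k * al (z, 0) = b01 (z^-1, 0).
  by move=> /F/fiber_solve; rewrite dc subrr mul0r => /esym/subr0_eq.
have [e1 e2] := axis_liouville E alsd b01sd G.
by move=> z; rewrite e1 e2 expr0n gtn_eqF// mul0r.
Qed.

Lemma fiber_solve1 (c z b w d' p q t : K) :
  c * q + t * z + b - w - z * d' - p * c = 0 -> c * (q - p) + (t - d') * z = b * -1 - w * -1.
Proof. by move/subr0_eq => h; rewrite mulrBr [c * p]mulrC -h; ring. Qed.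

Lemma poly_sum_lin (c e : K) (p1 p2 : nat -> K) z :
  c * (\sum_(1 <= m < k) p2 m * z ^+ m - \sum_(1 <= m < k) p1 m * z ^+ m) + e * z =
  \sum_(1 <= m < k) (c * (p2 m - p1 m) + if m == 1%N then e else 0) * z ^+ m.
Proof.
under [RHS]eq_bigr do rewrite mulrDl.
rewrite big_split -sumrB mulr_sumr; congr (_ + _).
  by apply: eq_bigr => m _; rewrite -mulrBl mulrA.
rewrite big_ltn ?(leq_trans _ k_gt2)//= big_nat big1 ?addr0 ?expr1//.
by move=> [|[|i]]//= _; rewrite mul0r.
Qed.

(* The same entry at order 1 in hbar; br collects the four brackets, and sigma = u tau. *)
Lemma fiber_order1 (a11 a11' al' b00 b00' b01' tau br h : C2 -> K) (c c' d' : K)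
    (p1 p2 : nat -> K) (c1 c2 : K -> K) :
  (forall x, sd a11 x) -> (forall x, sd a11' x) -> (forall x, sd al' x) ->
  (forall x, sd b00 x) -> (forall x, sd b00' x) -> (forall x, sd b01' x) ->
  (forall x, sd tau x) -> (forall x, x.1 != 0 -> sd h x) ->
  (forall z, z != 0 -> {for 0, continuous (fun u => br (z, u))} /\ br (z, 0) = 0) ->
  (forall z, c1 z = \sum_(1 <= m < k) p1 m * z ^+ m) ->
  (forall z, c2 z = \sum_(1 <= m < k) p2 m * z ^+ m) ->
  (forall z, b00 (z, 0) = c) -> (forall z, a11 (z, 0) = c) ->
  (forall z, b00' (z, 0) = c') -> (forall z, a11' (z, 0) = d') -> c != 0 ->
  (forall x, x.1 != 0 ->
    b00 (swap x) * (c2 x.1 * x.2) +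
      (b00' (swap x) * (x.1 * x.2) + (swap x).2 * b01' (swap x) * x.1 ^- k) +
      x.2 * tau x * br x -
    (x.1 ^+ k * (x.2 * al' x) + x.1 * x.2 * a11' x + c1 x.1 * x.2 * a11 x) = x.2 ^+ 2 * h x) ->
  forall m, (1 < m < k)%N -> p2 m = p1 m.
Proof.
move=> a11sd a11'sd al'sd b00sd b00'sd b01'sd tausd hsd brH c1E c2E b00c a11c b00'c a11'c c0 H.
have F z : z != 0 -> c * c2 z + c' * z + b01' (z^-1, 0) - z ^+ k * al' (z, 0) - z * d' - c1 z * c = 0.
  move=> z0; have [brc br0] := brH z z0.
  have := @cancel_var K (fun u => (b00 (swap (z, u)) * c2 z + b00' (swap (z, u)) * z + b01' (swap (z, u))
      - z ^+ k * al' (z, u) - z * a11' (z, u) - c1 z * a11 (z, u)) + tau (z, u) * br (z, u))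
    (fun u => h (z, u)).
  rewrite swap_fiber mulr0 b00c a11c b00'c a11'c br0 mulr0 addr0; apply.
  - have s1 : sd (fun x => b00 (swap x) * c2 z + b00' (swap x) * x.1 + b01' (swap x)
      - x.1 ^+ k * al' x - x.1 * a11' x - c1 z * a11 x) (z, 0).
      have s1 := sdM (sd_swap_comp (x := (z, 0)) b00sd z0) (@sd_cst K _ _ (c2 z) (z, 0)).
      have s2 := sd_swap_comp (x := (z, 0)) b01'sd z0.
      have s3 := sdM (@sd_fst K K K (z, 0)) (a11'sd (z, 0)).
      have s4 := sdM (sdX k (@sd_fst K K K (z, 0))) (al'sd (z, 0)).
      have s5 := sdM (sd_swap_comp (x := (z, 0)) b00'sd z0) (@sd_fst K K K (z, 0)).
      have s6 := sdM (@sd_cst K _ _ (c1 z) (z, 0)) (a11sd (z, 0)).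
      exact: (sdD (sdD (sdD (sdD (sdD s1 s5) s2) (sdN s4)) (sdN s3)) (sdN s6)).
    have c1' := continuous_sd_fiber s1; have c2' := continuous_sd_fiber (tausd (z, 0)).
    have c3 : tau (z, u) * br (z, u) @[u --> (0 : K)] --> tau (z, 0) * br (z, 0) by apply: cvgM brc; exact: c2'.
    by apply: cvgD c3; exact: c1'.
  - by apply: continuous_sd_fiber; exact: hsd.
  move=> u; have zk : z ^+ k != 0 by rewrite expf_neq0.
  have := H (z, u) z0; rewrite /= => <-.
  by field.
have [fsd gsd] : (forall z, sd (fun w => al' (w, 0) * -1) z) /\ (forall z, sd (fun w => b01' (w, 0) * -1) z).
  split=> z; apply: sdM; try exact: sd_cst.
    by apply: (sd_comp (f := fun w : K => (w, 0 : K)) (g := al')); [sd_auto|exact: al'sd].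
  by apply: (sd_comp (f := fun w : K => (w, 0 : K)) (g := b01')); [sd_auto|exact: b01'sd].
move=> m /andP[m1 mk].
(* The diagonal entries at order hbar contribute (c' - d') z, which only affects m = 1; this is the
   freedom to add a multiple of p to p'. *)
have := @laurent_gap R K E k (fun m => c * (p2 m - p1 m) + if m == 1%N then c' - d' else 0) _ _ fsd gsd.
move=> /(_ _ m); rewrite (gtn_eqF m1) addr0 => G.
apply: subr0_eq; apply: (mulfI c0); rewrite mulr0; apply: G; last by rewrite mk (ltnW m1).
move=> z z0; rewrite -poly_sum_lin -c1E -c2E mulrA.
exact: (fiber_solve1 (F z z0)).
Qed.

(* Here k >= 3 is used: z^(k-2) sigma_U(z, 0) is a function of 1/z. *)
Lemma poisson_axis (su sv : C2 -> K) : (forall x, sd su x) -> (forall x, sd sv x) ->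
  (forall x, x.1 != 0 -> sv (swap x) = - (x.1 ^- 2 * x.1 ^+ k) * su x) ->
  forall z, su (z, 0) = 0.
Proof.
move=> susd svsd H z.
have [n kn] : exists n, k = n.+3 by case: k k_gt2 => [|[|[|n]]]// _; exists n.
have h w : w != 0 -> w ^+ n.+1 * - su (w, 0) = sv (w^-1, 0).
  move=> w0; have := H (w, 0) w0; rewrite swap_fiber mulr0 => ->.
  by rewrite /= kn (exprD w 2 n.+1) mulKf ?expf_neq0// mulrN mulNr.
have [e _] := axis_liouville E (fun x => sdN (susd x)) svsd h.
by move/eqP: (e z); rewrite expr0n mul0r oppr_eq0 => /eqP.
Qed.

Lemma fiber_factor (f g : C2 -> K) z : (forall x, x.1 != 0 -> f x = x.2 * g x) -> z != 0 ->
  sd g (z, 0) -> 'D_(0, 1) f (z, 0) = g (z, 0).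
Proof.
move=> fg z0 gsd; apply: axis_dderiv2; first exact: continuous_sd_fiber.
by move=> u; exact: (fg (z, u) z0).
Qed.

Lemma quantum_rigidity (A A' B B' C T1 T2 H0 H1 : C2 -> 'M[K]_2) (su sv : C2 -> K)
    (p1 p2 : nat -> K) :
  sd_mx setT A -> sd_mx setT A' -> sd_mx setT B -> sd_mx setT B' ->
  sd_mx [set x | x.1 != 0] H0 -> sd_mx [set x | x.1 != 0] H1 ->
  (forall x, sd su x) -> (forall x, sd sv x) ->
  (forall x, x.1 != 0 -> sv (swap x) = - (x.1 ^- 2 * x.1 ^+ k) * su x) ->
  (forall x, T1 x 0 0 = 0 /\ T1 x 1 0 = 0 /\ T1 x 1 1 = 0) ->
  (forall x, T2 x 0 0 = 0 /\ T2 x 1 0 = 0 /\ T2 x 1 1 = 0) ->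
  (forall x, T1 x 0 1 = (\sum_(1 <= m < k) p1 m * x.1 ^+ m) * x.2) ->
  (forall x, T2 x 0 1 = (\sum_(1 <= m < k) p2 m * x.1 ^+ m) * x.2) ->
  (forall x, A x *m C x = 1%:M) ->
  (forall x, x.1 != 0 -> B (swap x) *m T x - T x *m A x = x.2 ^+ 2 *: H0 x) ->
  (forall x, x.1 != 0 ->
    (B (swap x) *m T2 x + B' (swap x) *m T x + bracket_mx su (fun y => B (swap y)) T x) -
    (T x *m A' x + T1 x *m A x + bracket_mx su T A x) = x.2 ^+ 2 *: H1 x) ->
  forall m, (1 < m < k)%N -> p2 m = p1 m.
Proof.
move=> Asd A'sd Bsd B'sd H0sd H1sd susd svsd svE T10_ T20_ T11_ T21_ AC G0 G1.
have su0 := poisson_axis susd svsd svE.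
have T1z z : T1 (z, 0) = 0.
  apply/matrixP => i j; have [h1 [h2 h3]] := T10_ (z, 0); have h4 := T11_ (z, 0).
  move: i; apply: ord2_cases; move: j; apply: ord2_cases; rewrite mxE //.
  by rewrite h4 mulr0.
have T2z z : T2 (z, 0) = 0.
  apply/matrixP => i j; have [h1 [h2 h3]] := T20_ (z, 0); have h4 := T21_ (z, 0).
  move: i; apply: ord2_cases; move: j; apply: ord2_cases; rewrite mxE //.
  by rewrite h4 mulr0.
(* As sigma vanishes on l, the equation at order hbar restricts there to the same equation as at
   order 0, so [axis_gluing] applies to both orders. *)
have brz X Y z : bracket_mx su X Y (z, 0) = 0.
  by apply/matrixP => i j; rewrite bracket_mxE su0 !mul0r addr0 mxE.
have u0 z (M : 'M[K]_2) : (z, 0 : K).2 ^+ 2 *: M = 0 by rewrite /= expr0n scale0r.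
have [c [d cd]] : exists a d : K, forall z,
    [/\ A (z, 0) 0 0 = a, B (z, 0) 0 0 = a, A (z, 0) 1 1 = d & B (z, 0) 1 1 = d] /\
    A (z, 0) 0 1 = 0 /\ B (z, 0) 0 1 = 0.
  by apply: axis_gluing => // z z0; apply: subr0_eq; rewrite (G0 (z, 0) z0) u0.
have [c' [d' cd']] : exists a d : K, forall z,
    [/\ A' (z, 0) 0 0 = a, B' (z, 0) 0 0 = a, A' (z, 0) 1 1 = d & B' (z, 0) 1 1 = d] /\
    A' (z, 0) 0 1 = 0 /\ B' (z, 0) 0 1 = 0.
  apply: axis_gluing => // z z0; apply: subr0_eq; have := G1 (z, 0) z0.
  by rewrite u0 T1z T2z !brz mulmx0 mul0mx !addr0 add0r.
have A01 z : A (z, 0) 0 1 = 0 by have [_ []] := cd z.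
have B01 z : B (z, 0) 0 1 = 0 by have [_ []] := cd z.
have A'01 z : A' (z, 0) 0 1 = 0 by have [_ []] := cd' z.
have B'01 z : B' (z, 0) 0 1 = 0 by have [_ []] := cd' z.
have [al alsd alE] := division_axis (fun x => Asd x 0 1 I) A01.
have [be besd beE] := division_axis (fun x => Bsd x 0 1 I) B01.
have [al' al'sd al'E] := division_axis (fun x => A'sd x 0 1 I) A'01.
have [be' be'sd be'E] := division_axis (fun x => B'sd x 0 1 I) B'01.
have [tau tausd tauE] := division_axis susd su0.
have A00 z : A (z, 0) 0 0 = c by have [[]] := cd z.
have B00 z : B (z, 0) 0 0 = c by have [[]] := cd z.
have A11 z : A (z, 0) 1 1 = d by have [[]] := cd z.
have A'11 z : A' (z, 0) 1 1 = d' by have [[]] := cd' z.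
have B'00 z : B' (z, 0) 0 0 = c' by have [[]] := cd' z.
have c0 : c != 0.
  apply/eqP => c0; have /matrixP/(_ 0 0) := AC (0, 0).
  by rewrite mulmx2E A00 A01 c0 !mul0r addr0 mxE => /eqP; rewrite eq_sym oner_eq0.
have [cdE albe] : c = d /\ (forall z, al (z, 0) = 0 /\ be (z, 0) = 0).
  apply: (fiber_order0 (h := fun x => H0 x 0 1) (fun x => Asd x 1 1 I) alsd
    (fun x => Bsd x 0 0 I) besd _ B00 A11) => [x x0|x x0]; first exact: H0sd.
  have /matrixP/(_ 0 1) := G0 x x0.
  rewrite mx_subE mx_scaleE !mulmx2E => <-.
  by rewrite T01 T11 T00 beE alE.
have al0 z : al (z, 0) = 0 by have [] := albe z.
have be0 z : be (z, 0) = 0 by have [] := albe z.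
have oD := @open_neq0_fst K.
have Tsd : sd_mx [set x | x.1 != 0] T.
  move=> x i j x0; move: i; apply: ord2_cases; move: j; apply: ord2_cases.
  - by rewrite (funext T00); exact: (sdX k (@sd_fst K K K x)).
  - by rewrite (funext T01); exact: (sdM (@sd_fst K K K x) (@sd_snd K K K x)).
  - by rewrite (funext T10); exact: sd_cst.
  - rewrite (funext T11); apply: sdV; first exact: expf_neq0.
    exact: (sdX k (@sd_fst K K K x)).
have Bssd : sd_mx [set x | x.1 != 0] (fun x => B (swap x)).
  by move=> x i j x0; apply: (sd_swap_comp (f := fun y => B y i j)) => // y; exact: Bsd.
have b1z z : z != 0 -> bracket (fun x => B (swap x) 0 0) (fun x => T x 0 1) (z, 0) = 0.
  move=> z0; rewrite /bracket (axis_dderiv1 (c := c) z0) => [|w w0]; last by rewrite swap_fiber mulr0.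
  rewrite [X in _ - _ * X](axis_dderiv1 (c := 0) z0) => [|w w0]; last by rewrite T01 mulr0.
  by rewrite mulr0 mul0r subrr.
(* The z-derivative of z^-k does not vanish on l, but it is multiplied by the u-derivative of B01,
   which is 0 by [be0]. In [b3z] the same happens with z^k and A01. *)
have b2z z : z != 0 -> bracket (fun x => B (swap x) 0 1) (fun x => T x 1 1) (z, 0) = 0.
  move=> z0; rewrite /bracket (axis_dderiv1 (c := 0) z0) => [|w w0]; last by rewrite swap_fiber mulr0.
  rewrite [X in _ - X * _](fiber_factor (g := fun x => x.1 ^+ k * be (swap x)) _ z0) => [|x x0|].
  - by rewrite swap_fiber mulr0 be0 mulr0 !mul0r subrr.
  - by rewrite beE mulrA [x.2 * _]mulrC.
  - exact: (sdM (sdX k (@sd_fst K K K (z, 0))) (sd_swap_comp (x := (z, 0)) besd z0)).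
have b3z z : z != 0 -> bracket (fun x => T x 0 0) (fun x => A x 0 1) (z, 0) = 0.
  move=> z0; rewrite /bracket [X in _ - _ * X](axis_dderiv1 (c := 0) z0) //.
  rewrite [X in _ * X - _](fiber_factor (g := al) _ z0) //.
  by rewrite al0 !mulr0 subrr.
have b4z z : z != 0 -> bracket (fun x => T x 0 1) (fun x => A x 1 1) (z, 0) = 0.
  move=> z0; rewrite /bracket (axis_dderiv1 (c := 0) z0) => [|w w0]; last by rewrite T01 mulr0.
  rewrite [X in _ - _ * X](axis_dderiv1 (c := d) z0) => [|w w0]; last exact: A11.
  by rewrite mul0r mulr0 subrr.
pose br x := (bracket (fun x => B (swap x) 0 0) (fun x => T x 0 1) x +
  bracket (fun x => B (swap x) 0 1) (fun x => T x 1 1) x) -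
  (bracket (fun x => T x 0 0) (fun x => A x 0 1) x + bracket (fun x => T x 0 1) (fun x => A x 1 1) x).
have brC (X Y : C2 -> 'M[K]_2) a b e z : sd_mx [set x | x.1 != 0] X -> sd_mx [set x | x.1 != 0] Y ->
    z != 0 -> {for 0, continuous (fun u => bracket (fun x => X x a b) (fun x => Y x b e) (z, u))}.
  move=> Xsd Ysd z0; apply: continuous_fiber.
  apply: (std_bracket_continuous oD) => // y y0; [exact: Xsd|exact: Ysd].
have Asd0 : sd_mx [set x | x.1 != 0] A by move=> x i j _; exact: Asd.
have brH z : z != 0 -> {for 0, continuous (fun u => br (z, u))} /\ br (z, 0) = 0.
  move=> z0; split; last by rewrite /br b1z// b2z// b3z// b4z// addr0 subrr.
  apply: (@continuous2B K) => //; apply: (@continuous2D K); exact: brC.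
apply: (fiber_order1 (h := fun x => H1 x 0 1) (fun x => Asd x 1 1 I) (fun x => A'sd x 1 1 I) al'sd
  (fun x => Bsd x 0 0 I) (fun x => B'sd x 0 0 I) be'sd tausd _ brH (fun _ => erefl) (fun _ => erefl)
  B00 _ B'00 A'11 c0) => [x x0|z|x x0]; [exact: H1sd|by rewrite A11 cdE|].
have /matrixP/(_ 0 1) := G1 x x0.
rewrite mx_subE mx_scaleE !mx_addE !bracket_mxE !mulmx2E => <-.
have [h1 [h2 h3]] := T10_ x; have [h4 [h5 h6]] := T20_ x.
rewrite T01 T11 T00 beE be'E alE al'E tauE h1 h6 T11_ T21_ /br.
ring.
Qed.

End Rigidity.

(** * Equivalence of quantum bundles *)

Section RingIdentities.
Variable A : pzRingType.
Implicit Types a b c m n p t : A.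

(** The hbar-part of (M A)(C N), where C is a star inverse of A and N inverts the constant matrix M;
    p is the bracket of A and C. The suffix 2 marks the coefficients of hbar. *)
Lemma lmul_inverse_right m m2 n n2 a a2 c c2 p : a * c = 1 -> a * c2 + a2 * c + p = 0 ->
  m * n2 + m2 * n = 0 -> m * a * (c * n2 + c2 * n) + (m * a2 + m2 * a) * (c * n) + m * p * n = 0.
Proof.
move=> ac acp mn.
have -> : m * a * (c * n2 + c2 * n) + (m * a2 + m2 * a) * (c * n) + m * p * n =
    (m * (a * c) * n2 + m2 * (a * c) * n) + m * (a * c2 + a2 * c + p) * n.
  by rewrite !(mulrDl, mulrDr) !mulrA (AC (2*2*1) ((1*4)*((2*3)*5))).
by rewrite ac acp !mulr1 mulr0 mul0r addr0 mn.
Qed.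

Lemma lmul_inverse_left m m2 n n2 a a2 c c2 p : c * a2 + c2 * a + p = 0 -> n * m = 1 ->
  n * m2 + n2 * m = 0 -> c * n * (m * a2 + m2 * a) + (c * n2 + c2 * n) * (m * a) + p = 0.
Proof.
move=> acp nm nm2.
have -> : c * n * (m * a2 + m2 * a) + (c * n2 + c2 * n) * (m * a) + p =
    (c * (n * m) * a2 + c2 * (n * m) * a + p) + c * (n * m2 + n2 * m) * a.
  by rewrite !(mulrDl, mulrDr) !mulrA (AC (2*2*1) (((1*4)*5)*(2*3))).
by rewrite nm nm2 !mulr1 mulr0 mul0r addr0 acp.
Qed.

(* The hbar-part of M (B U - T A), for M T = V M; q and r stand for the brackets. *)
Lemma lmul_equation m m2 b b2 t t2 a a2 u u2 v v2 q r :
  m * t = v * m -> m * t2 + m2 * t = v2 * m + v * m2 ->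
  m * b * u2 + (m * b2 + m2 * b) * u + m * q -
    (v * (m * a2 + m2 * a) + v2 * (m * a) + m * r) =
  m * (b * u2 + b2 * u + q - (t * a2 + t2 * a + r)) + m2 * (b * u - t * a).
Proof.
move=> mt mt2.
have -> : v * (m * a2 + m2 * a) + v2 * (m * a) + m * r =
    m * (t * a2) + (m * t2 + m2 * t) * a + m * r.
  rewrite mt2 !(mulrDl, mulrDr) !mulrA -mt.
  by rewrite (AC (2*1*1) ((1*(3*2))*4)) /=.
rewrite !(mulrBr, mulrDl, mulrDr) !mulrA !opprD.
by rewrite (AC ((1*2*1)*(1*2*1)) ((1*2*4*(5*6*8))*(3*7))) /=.
Qed.

End RingIdentities.

Section QuantumEquivalence.
Variables (R : realType) (K : numClosedFieldType) (k : nat).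
Local Notation C2 := (K * K)%type.
Local Notation swap := (@swap_chart K k).
Local Notation hmxK := ((C2 -> 'M[K]_2) * (C2 -> 'M[K]_2))%type.
Implicit Types (X Y : C2 -> 'M[K]_2) (A B C T : hmxK) (M N : 'M[K]_2 * 'M[K]_2).

Definition dmx (v x : C2) X : 'M[K]_2 := \matrix_(a, b) 'D_v (fun y => X y a b) x.

Definition sd_mx_at X x := forall a b, sd (fun y => X y a b) x.

Lemma dmxE v x X a b : dmx v x X a b = 'D_v (fun y => X y a b) x.
Proof. by rewrite mxE. Qed.

Lemma bracket_regroup (s a1 a2 b1 b2 c1 c2 d1 d2 : K) :
  s * (a1 * b1 - a2 * b2) + s * (c1 * d1 - c2 * d2) =
  s * ((a1 * b1 + c1 * d1) - (a2 * b2 + c2 * d2)).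
Proof. ring. Qed.

Lemma bracket_mx_dmx s X Y x : bracket_mx s X Y x =
  s x *: (dmx (1, 0) x X *m dmx (0, 1) x Y - dmx (0, 1) x X *m dmx (1, 0) x Y).
Proof.
apply/matrixP => a b; rewrite bracket_mxE mx_scaleE mx_subE !mulmx2E !dmxE.
exact: bracket_regroup.
Qed.

Lemma is_sd_scale (V : normedModType K) (f : V -> K) a x L :
  is_sd f x L -> is_sd (fun y => a * f y) x (fun v => a * L v).
Proof.
move=> Lf; apply: (@is_sd_comp _ _ _ _ f (fun y : K => a * y) x L (fun v => a * v) Lf).
apply: is_sd_lin; split => [c u v|]; first by rewrite mulrDr mulrCA.
exists (`|a| + 1) => [|v]; first by rewrite ltr_wpDl.
by rewrite normrM ler_wpM2r// lerDl.
Qed.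

Lemma dderiv_lin (f g : C2 -> K) a b v x : sd f x -> sd g x ->
  'D_v (fun y => a * f y + b * g y) x = a * 'D_v f x + b * 'D_v g x.
Proof.
move=> [L Lf] [M Mg].
have H := is_sdD (is_sd_scale a Lf) (is_sd_scale b Mg).
have [d1 e1] := is_sd_diff H; have [d2 e2] := is_sd_diff Lf; have [d3 e3] := is_sd_diff Mg.
by rewrite (deriveE _ d1) (deriveE _ d2) (deriveE _ d3) e1 e2 e3.
Qed.

Lemma dmx_mull P X v x : sd_mx_at X x -> dmx v x (fun y => P *m X y) = P *m dmx v x X.
Proof.
move=> Xsd; apply/matrixP => a b; rewrite mulmx2E !dmxE -dderiv_lin; try exact: Xsd.
by congr ('D_v _ x); apply/funext => y; rewrite mulmx2E.
Qed.

Lemma dmx_mulr P X v x : sd_mx_at X x -> dmx v x (fun y => X y *m P) = dmx v x X *m P.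
Proof.
move=> Xsd; apply/matrixP => a b; rewrite mulmx2E !dmxE [X in X + _]mulrC [X in _ + X]mulrC.
rewrite -dderiv_lin; try exact: Xsd.
by congr ('D_v _ x); apply/funext => y; rewrite mulmx2E mulrC; congr (_ + _); rewrite mulrC.
Qed.

Lemma sd_mx_mull P X x : sd_mx_at X x -> sd_mx_at (fun y => P *m X y) x.
Proof.
move=> Xsd a b; have -> : (fun y => (P *m X y) a b) = (fun y => P a 0 * X y 0 b + P a 1 * X y 1 b).
  by apply/funext => y; rewrite mulmx2E.
exact: (sdD (sdM (sd_cst (P a 0) x) (Xsd 0 b)) (sdM (sd_cst (P a 1) x) (Xsd 1 b))).
Qed.

Lemma sd_mx_mulr P X x : sd_mx_at X x -> sd_mx_at (fun y => X y *m P) x.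
Proof.
move=> Xsd a b; have -> : (fun y => (X y *m P) a b) = (fun y => X y a 0 * P 0 b + X y a 1 * P 1 b).
  by apply/funext => y; rewrite mulmx2E.
exact: (sdD (sdM (Xsd a 0) (sd_cst (P 0 b) x)) (sdM (Xsd a 1) (sd_cst (P 1 b) x))).
Qed.

Lemma sd_mxD X Y x : sd_mx_at X x -> sd_mx_at Y x -> sd_mx_at (fun y => X y + Y y) x.
Proof.
move=> Xsd Ysd a b; have -> : (fun y => (X y + Y y) a b) = (fun y => X y a b + Y y a b).
  by apply/funext => y; rewrite mxE.
exact: sdD (Xsd a b) (Ysd a b).
Qed.

Lemma bracket_mx_mull s P X Y x : sd_mx_at X x -> sd_mx_at Y x ->
  bracket_mx s (fun y => P *m X y) Y x = P *m bracket_mx s X Y x.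
Proof.
by move=> Xsd Ysd; rewrite !bracket_mx_dmx !(dmx_mull P _ Xsd) -scalemxAr mulmxBr !mulmxA.
Qed.

Lemma bracket_mx_mulr s P X Y x : sd_mx_at X x -> sd_mx_at Y x ->
  bracket_mx s X (fun y => Y y *m P) x = bracket_mx s X Y x *m P.
Proof.
by move=> Xsd Ysd; rewrite !bracket_mx_dmx !(dmx_mulr P _ Ysd) -scalemxAl mulmxBl !mulmxA.
Qed.

Lemma bracket_mx_slide s P X Y x : sd_mx_at X x -> sd_mx_at Y x ->
  bracket_mx s (fun y => X y *m P) Y x = bracket_mx s X (fun y => P *m Y y) x.
Proof.
by move=> Xsd Ysd; rewrite !bracket_mx_dmx !(dmx_mulr P _ Xsd) !(dmx_mull P _ Ysd) !mulmxA.
Qed.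

Definition starK (s : C2 -> K) A B : hmxK :=
  (fun x => A.1 x *m B.1 x,
   fun x => A.1 x *m B.2 x + A.2 x *m B.1 x + bracket_mx s A.1 B.1 x).

Definition sd_hmx A := (forall x, sd_mx_at A.1 x) /\ (forall x, sd_mx_at A.2 x).

Definition honeK : hmxK := (fun=> 1%:M, fun=> 0).

Definition star_invertibleK s A := sd_hmx A /\
  exists B, [/\ sd_hmx B, starK s A B = honeK & starK s B A = honeK].

(** The star product with a constant matrix, whose brackets vanish. *)
Definition lmul M A : hmxK := (fun x => M.1 *m A.1 x, fun x => M.1 *m A.2 x + M.2 *m A.1 x).
Definition rmul A M : hmxK := (fun x => A.1 x *m M.1, fun x => A.1 x *m M.2 + A.2 x *m M.1).

Definition hinverse M N := [/\ M.1 *m N.1 = 1%:M, N.1 *m M.1 = 1%:M,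
  M.1 *m N.2 + M.2 *m N.1 = 0 & N.1 *m M.2 + N.2 *m M.1 = 0].

Lemma hmx_eq A B : (forall x, A.1 x = B.1 x) -> (forall x, A.2 x = B.2 x) -> A = B.
Proof. by case: A B => [a a'] [b b'] /= h1 h2; congr (_, _); apply/funext. Qed.

Lemma sd_hmx_lmul M A : sd_hmx A -> sd_hmx (lmul M A).
Proof.
move=> [h1 h2]; split=> x; first exact: sd_mx_mull.
by apply: sd_mxD; exact: sd_mx_mull.
Qed.

Lemma sd_hmx_rmul M A : sd_hmx A -> sd_hmx (rmul A M).
Proof.
move=> [h1 h2]; split=> x; first exact: sd_mx_mulr.
by apply: sd_mxD; exact: sd_mx_mulr.
Qed.

Lemma star_invertible_lmul s M N A : hinverse M N -> star_invertibleK s A ->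
  star_invertibleK s (lmul M A).
Proof.
move=> [MN NM MN2 NM2] [Asd [C [Csd AC CA]]].
split; first exact: sd_hmx_lmul.
exists (rmul C N); split; first exact: sd_hmx_rmul.
- have a1 x : A.1 x *m C.1 x = 1%:M by rewrite -[LHS]/((starK s A C).1 x) AC.
  have a2 x : A.1 x *m C.2 x + A.2 x *m C.1 x + bracket_mx s A.1 C.1 x = 0.
    by rewrite -[LHS]/((starK s A C).2 x) AC.
  apply: hmx_eq => x /=.
    by rewrite mulmxA -[M.1 *m _ *m _]mulmxA a1 mulmx1.
  rewrite bracket_mx_mull; [|exact: (proj1 Asd)|exact: (sd_mx_mulr _ (proj1 Csd x))].
  rewrite bracket_mx_mulr; [|exact: (proj1 Asd)|exact: (proj1 Csd)].
  rewrite [X in _ + X]mulmxA.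
  exact: (@lmul_inverse_right 'M[K]_2 _ _ _ _ _ _ _ _ _ (a1 x) (a2 x) MN2).
- have a1 x : C.1 x *m A.1 x = 1%:M by rewrite -[LHS]/((starK s C A).1 x) CA.
  have a2 x : C.1 x *m A.2 x + C.2 x *m A.1 x + bracket_mx s C.1 A.1 x = 0.
    by rewrite -[LHS]/((starK s C A).2 x) CA.
  apply: hmx_eq => x /=.
    by rewrite mulmxA -[C.1 x *m _ *m _]mulmxA NM mulmx1.
  rewrite bracket_mx_slide; [|exact: (proj1 Csd)|exact: (sd_mx_mull _ (proj1 Asd x))].
  have -> : (fun y => N.1 *m (M.1 *m A.1 y)) = A.1.
    by apply/funext => y; rewrite mulmxA NM mul1mx.
  exact: (@lmul_inverse_left 'M[K]_2 _ _ _ _ _ _ _ _ _ (a2 x) NM NM2).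
Qed.

Definition eqmodK X Y := exists H : C2 -> 'M[K]_2,
  (forall x, x.1 != 0 -> sd_mx_at H x) /\ forall x, x.1 != 0 -> X x - Y x = x.2 ^+ 2 *: H x.

Definition in_chartU B : hmxK := (fun x => B.1 (swap x), fun x => B.2 (swap x)).

Definition qequivK (su sv : C2 -> K) T T' := exists A B : hmxK,
  [/\ star_invertibleK su A, star_invertibleK sv B &
    eqmodK (starK su (in_chartU B) T').1 (starK su T A).1 /\
    eqmodK (starK su (in_chartU B) T').2 (starK su T A).2].

Lemma sd_mx_swap X x : (forall y, sd_mx_at X y) -> x.1 != 0 -> sd_mx_at (fun y => X (swap y)) x.
Proof. by move=> Xsd x0 a b; apply: (@sd_swap_comp K k (fun y => X y a b)) => // y; exact: Xsd. Qed.

Lemma scale_rem (c : K) M (P Q : 'M[K]_2) :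
  M.1 *m (c *: P) + M.2 *m (c *: Q) = c *: (M.1 *m P + M.2 *m Q).
Proof. by rewrite -!scalemxAr scalerDr. Qed.

Lemma qequivK_lmul su sv M N T T1 T2 : hinverse M N ->
  (forall x, x.1 != 0 -> sd_mx_at T.1 x) -> (forall x, x.1 != 0 -> sd_mx_at T1.1 x) ->
  (forall x, x.1 != 0 -> sd_mx_at T2.1 x) ->
  (forall x, M.1 *m T.1 x = T1.1 x *m M.1) ->
  (forall x, M.1 *m T.2 x + M.2 *m T.1 x = T1.2 x *m M.1 + T1.1 x *m M.2) ->
  qequivK su sv T T2 -> qequivK su sv T1 T2.
Proof.
move=> MN Tsd T1sd T2sd MT MT2 [A [B [Ai Bi [[H0 [H0sd E0]] [H1 [H1sd E1]]]]]].
have Asd := proj1 Ai; have Bsd := proj1 Bi.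
exists (lmul M A), (lmul M B); split; [exact: (star_invertible_lmul MN Ai)|exact: (star_invertible_lmul MN Bi)|split].
  exists (fun x => M.1 *m H0 x); split => x x0; first by apply: sd_mx_mull; exact: H0sd.
  rewrite [x.2 ^+ 2 *: _]scalemxAr -(E0 x x0) /=.
  by rewrite mulmxBr !mulmxA -MT.
exists (fun x => M.1 *m H1 x + M.2 *m H0 x); split => x x0.
  by apply: sd_mxD; apply: sd_mx_mull; [exact: H1sd|exact: H0sd].
rewrite -scale_rem -(E1 x x0) -(E0 x x0) /=.
have sB := sd_mx_swap (proj1 Bsd) x0; have sA := proj1 Asd x.
rewrite (bracket_mx_mull _ _ sB (T2sd x x0)) -(bracket_mx_slide _ _ (T1sd x x0) sA).
have -> : (fun y => T1.1 y *m M.1) = (fun y => M.1 *m T.1 y) by apply/funext => y; rewrite MT.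
rewrite (bracket_mx_mull _ _ (Tsd x x0) sA).
exact: (@lmul_equation 'M[K]_2 _ _ _ _ _ _ _ _ _ _ _ _ _ _ (MT x) (MT2 x)).
Qed.

Lemma bracket_mx_cstl s P X x : sd_mx_at X x -> bracket_mx s (fun=> P) X x = 0.
Proof.
move=> Xsd; have z v : dmx v x (fun=> P) = 0.
  by apply/matrixP => a b; rewrite !mxE derive_cst.
by rewrite bracket_mx_dmx !z !mul0mx subrr scaler0.
Qed.

Lemma bracket_mx_cstr s P X x : sd_mx_at X x -> bracket_mx s X (fun=> P) x = 0.
Proof.
move=> Xsd; have z v : dmx v x (fun=> P) = 0.
  by apply/matrixP => a b; rewrite !mxE derive_cst.
by rewrite bracket_mx_dmx !z !mulmx0 subrr scaler0.
Qed.

Lemma sd_hone : sd_hmx honeK.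
Proof. by split=> x a b; exact: sd_cst. Qed.

Lemma star_invertible_hone s : star_invertibleK s honeK.
Proof.
have h : starK s honeK honeK = honeK.
  apply: hmx_eq => x /=; first by rewrite mulmx1.
  rewrite bracket_mx_cstl ?mulmx0 ?mul0mx ?addr0 //; exact: (proj1 sd_hone).
split; first exact: sd_hone.
by exists honeK; split => //; exact: sd_hone.
Qed.

Lemma qequivK_refl su sv T : (forall x, x.1 != 0 -> sd_mx_at T.1 x) -> qequivK su sv T T.
Proof.
move=> Tsd; exists honeK, honeK; split; [exact: star_invertible_hone|exact: star_invertible_hone|split].
  exists (fun=> 0); split => x x0; first by move=> a b; exact: sd_cst.
  by rewrite /= mul1mx mulmx1 subrr scaler0.
exists (fun=> 0); split => x x0; first by move=> a b; exact: sd_cst.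
rewrite /= (bracket_mx_cstl _ _ (Tsd x x0)) (bracket_mx_cstr _ _ (Tsd x x0)).
by rewrite mul1mx mulmx1 mul0mx mulmx0 !addr0 add0r subrr scaler0.
Qed.

End QuantumEquivalence.

(** * Upper triangular matrices and rows of coefficients *)

Section UpperTriangular.
Variable K : fieldType.

Definition utri (a b d : K) : 'M[K]_2 := block_mx a%:M b%:M 0 d%:M : 'M[K]_(1 + 1).

Lemma utri_mul a b d a' b' d' :
  utri a b d *m utri a' b' d' = utri (a * a') (a * b' + b * d') (d * d').
Proof.
rewrite /utri [LHS](@mulmx_block _ 1 1 1 1 1 1) !mul0mx !mulmx0 !addr0 add0r.
by rewrite -!scalar_mxM raddfD.
Qed.

Lemma utri_add a b d a' b' d' : utri a b d + utri a' b' d' = utri (a + a') (b + b') (d + d').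
Proof. by rewrite /utri [LHS](@add_block_mx _ 1 1 1 1) addr0 -!raddfD. Qed.

Lemma utri1 : utri 1 0 1 = 1%:M.
Proof. by rewrite /utri raddf0 -scalar_mx_block. Qed.

Lemma utri0 : utri 0 0 0 = 0.
Proof. by rewrite /utri !raddf0 block_mx0. Qed.

Let ord2_0 : (0 : 'I_2) = lshift 1 (0 : 'I_1). Proof. exact: val_inj. Qed.
Let ord2_1 : (1 : 'I_2) = rshift 1 (0 : 'I_1). Proof. exact: val_inj. Qed.

Lemma utri00 a b d : utri a b d 0 0 = a.
Proof. by rewrite ord2_0 [LHS]block_mxEul mxE. Qed.

Lemma utri01 a b d : utri a b d 0 1 = b.
Proof. by rewrite ord2_0 ord2_1 [LHS]block_mxEur mxE. Qed.

Lemma utri10 a b d : utri a b d 1 0 = 0.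
Proof. by rewrite {1}ord2_0 ord2_1 [LHS]block_mxEdl mxE. Qed.

Lemma utri11 a b d : utri a b d 1 1 = d.
Proof. by rewrite ord2_1 [LHS]block_mxEdr mxE. Qed.

End UpperTriangular.

Section Coefficients.
Variable K : fieldType.

Lemma sum_coef_at k n (p : 'rV[K]_n) (z : K) : 
  \sum_i p 0 i * z ^ (k%:Z - k%:Z + 1 + (i : nat)%:Z) =
  \sum_(1 <= m < n.+1) coef_at p m * z ^+ m.
Proof.
rewrite big_add1 /= big_mkord; apply: eq_bigr => i _; rewrite coef_atE subrr add0r.
by rewrite -PoszD add1n.
Qed.

(** L deletes coordinate 0, the coefficient of z u, so its kernel is the line spanned by p = z u. *)
Lemma drop_first_coef n : exists L : 'M[K]_(n, n.-1), row_full L /\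
  forall p q : 'rV[K]_n, p *m L = q *m L <-> forall i : 'I_n, (0 < i)%N -> p 0 i = q 0 i.
Proof.
case: n => [|n].
  exists 0; split; first by apply/row_fullP; exists 0; apply/matrixP => -[].
  by move=> p q; split => [_ []//|_]; rewrite !mulmx0.
pose L : 'M[K]_(n.+1, n) := \matrix_(i, j) (i == lift ord0 j)%:R.
have LE m (p : 'M[K]_(m, n.+1)) i j : (p *m L) i j = p i (lift ord0 j).
  rewrite mxE (bigD1 (lift ord0 j)) //= mxE eqxx mulr1 big1 ?addr0// => l lj.
  by rewrite mxE (negPf lj) mulr0.
exists L; split.
  apply/row_fullP; exists (\matrix_(i, j) (lift ord0 i == j)%:R).
  apply/matrixP => i j; by rewrite LE !mxE (inj_eq lift_inj).
move=> p q; split=> [/matrixP H i i0|H].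
  have [j ->|ij] := unliftP ord0 i; first by rewrite -!LE.
  by rewrite ij in i0.
by apply/matrixP => i j; rewrite !LE (ord1 i); apply: H.
Qed.

Lemma sum_rowD n (p q : 'rV[K]_n) e (F : 'I_n -> K) u :
  (\sum_i (q + e *: p) 0 i * F i) * u =
  (\sum_i q 0 i * F i) * u + e * ((\sum_i p 0 i * F i) * u).
Proof.
rewrite mulrA -mulrDl mulr_sumr -big_split; congr (_ * u); apply: eq_bigr => i _.
by rewrite !mxE mulrDl mulrA.
Qed.

Lemma sum_rowZ n (p : 'rV[K]_n) e (F : 'I_n -> K) u :
  (\sum_i (e *: p) 0 i * F i) * u = e * ((\sum_i p 0 i * F i) * u).
Proof.
by rewrite mulrA mulr_sumr; congr (_ * u); apply: eq_bigr => i _; rewrite !mxE mulrA.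
Qed.

Lemma sum_delta n (i0 : 'I_n) (F : 'I_n -> K) : \sum_i (delta_mx 0 i0 : 'rV[K]_n) 0 i * F i = F i0.
Proof.
rewrite (bigD1 i0) //= mxE !eqxx mul1r big1 ?addr0// => i ii0.
by rewrite mxE (negPf ii0) andbF mul0r.
Qed.

Lemma delta_neq0 n (i0 : 'I_n) : (delta_mx 0 i0 : 'rV[K]_n) != 0.
Proof.
by apply/eqP => /matrixP/(_ 0 i0); rewrite !mxE !eqxx => /eqP; rewrite oner_eq0.
Qed.

Lemma row_split n (i0 : 'I_n) (p q : 'rV[K]_n) : (i0 = 0 :> nat) ->
  (forall i : 'I_n, (0 < i)%N -> p 0 i = q 0 i) ->
  p = q + (p 0 i0 - q 0 i0) *: delta_mx 0 i0.
Proof.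
move=> z H; apply/rowP => i; rewrite !mxE eqxx /=.
have [->|ii0] := eqVneq i i0; first by rewrite mulr1 addrC subrK.
by rewrite mulr0 addr0 H// lt0n; apply: contra ii0 => /eqP i0'; apply/eqP/val_inj; rewrite /= i0' z.
Qed.

End Coefficients.

(** * Explicit equivalences between quantum transition matrices *)

Section Moves.
Variables (R : realType) (K : numClosedFieldType) (E : complex_model R K) (k : nat).
Local Notation C2 := (K * K)%type.
Local Notation hmxK := ((C2 -> 'M[K]_2) * (C2 -> 'M[K]_2))%type.
Implicit Types (f g : C2 -> K).

Definition Tq f g : hmxK :=
  (fun x => utri (x.1 ^+ k) (f x) (x.1 ^- k), fun x => utri 0 (g x) 0).

Lemma sd_Tq f g x : (forall x, sd f x) -> x.1 != 0 -> sd_mx_at (Tq f g).1 x.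
Proof.
move=> fsd x0 a b; have e1 : (fun y : C2 => utri (y.1 ^+ k) (f y) (y.1 ^- k) 0 0) = (fun y => y.1 ^+ k).
  by apply/funext => y; rewrite utri00.
have e2 : (fun y : C2 => utri (y.1 ^+ k) (f y) (y.1 ^- k) 0 1) = f by apply/funext => y; rewrite utri01.
have e3 : (fun y : C2 => utri (y.1 ^+ k) (f y) (y.1 ^- k) 1 0) = (fun=> 0) by apply/funext => y; rewrite utri10.
have e4 : (fun y : C2 => utri (y.1 ^+ k) (f y) (y.1 ^- k) 1 1) = (fun y => y.1 ^- k).
  by apply/funext => y; rewrite utri11.
have h : sd (fun y : C2 => y.1 ^+ k) x by exact: (sdX k (@sd_fst K K K x)).
move: a; apply: ord2_cases; move: b; apply: ord2_cases.
- by rewrite e1.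
- by rewrite e2.
- by rewrite e3; exact: sd_cst.
- by rewrite e4; apply: sdV => //; exact: expf_neq0.
Qed.

Lemma sd_coef_fun (c : nat -> K) (x : C2) :
  sd (fun x : C2 => (\sum_(1 <= m < k) c m * x.1 ^+ m) * x.2) x.
Proof.
apply: sdM (@sd_snd K K K x); apply: sd_sum => m.
exact: (sdM (sd_cst _ _) (sdX m (@sd_fst K K K x))).
Qed.

Lemma qequivK_shift su sv e f g f2 g2 : (forall x, sd f x) -> (forall x, sd f2 x) ->
  qequivK k su sv (Tq f g) (Tq f2 g2) ->
  qequivK k su sv (Tq f (fun x => g x + e * f x)) (Tq f2 g2).
Proof.
move=> fsd f2sd.
apply: (@qequivK_lmul K k su sv (1%:M, utri e 0 0) (1%:M, utri (- e) 0 0)).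
- by split; rewrite /= ?mulmx1 ?mul1mx ?utri_add ?(addNr, addrN, addr0) ?utri0.
- by move=> x x0; exact: sd_Tq.
- by move=> x x0; exact: sd_Tq.
- by move=> x x0; exact: sd_Tq.
- by move=> x; rewrite /= mul1mx mulmx1.
move=> x; rewrite /= mul1mx mulmx1 !utri_mul !utri_add.
by rewrite !(mulr0, mul0r, addr0, add0r) [e * x.1 ^+ k]mulrC.
Qed.

Lemma qequivK_scale su sv c f g f2 g2 : c != 0 -> (forall x, sd f x) -> (forall x, sd f2 x) ->
  qequivK k su sv (Tq f g) (Tq f2 g2) ->
  qequivK k su sv (Tq (fun x => c * f x) (fun x => c * g x)) (Tq f2 g2).
Proof.
move=> c0 fsd f2sd; have cfsd x : sd (fun x => c * f x) x by exact: (sdM (sd_cst c x) (fsd x)).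
apply: (@qequivK_lmul K k su sv (utri c 0 1, 0) (utri c^-1 0 1, 0)).
- by split; rewrite /= ?mulmx0 ?mul0mx ?addr0 // utri_mul ?mulfV ?mulVf // !(mulr0, mul0r, addr0, mulr1) utri1.
- by move=> x x0; exact: sd_Tq.
- by move=> x x0; exact: sd_Tq.
- by move=> x x0; exact: sd_Tq.
- move=> x; rewrite /= !utri_mul !(mulr0, mul0r, addr0, add0r, mulr1, mul1r).
  by rewrite [c * x.1 ^+ k]mulrC.
move=> x; rewrite /= mul0mx mulmx0 !addr0 !utri_mul.
by rewrite !(mulr0, mul0r, addr0, add0r, mulr1).
Qed.

Lemma qequivK_rigid su sv f g1 g2 (p1 p2 : nat -> K) : (2 < k)%N ->
  (forall x, sd su x) -> (forall x, sd sv x) ->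
  (forall x, x.1 != 0 -> sv (swap_chart k x) = - (x.1 ^- 2 * x.1 ^+ k) * su x) ->
  (forall x, f x = x.1 * x.2) ->
  (forall x, g1 x = (\sum_(1 <= m < k) p1 m * x.1 ^+ m) * x.2) ->
  (forall x, g2 x = (\sum_(1 <= m < k) p2 m * x.1 ^+ m) * x.2) ->
  qequivK k su sv (Tq f g1) (Tq f g2) -> forall m, (1 < m < k)%N -> p2 m = p1 m.
Proof.
move=> k2 susd svsd svE fE g1E g2E.
move=> [A [B [[[A1 A2] [C [_ AC _]]] [[B1 B2] _] [[H0 [H0sd E0]] [H1 [H1sd E1]]]]]].
apply: (@quantum_rigidity R K E k k2 (fun x => utri (x.1 ^+ k) (f x) (x.1 ^- k)) _ _ _ _ 
  A.1 A.2 B.1 B.2 C.1 (fun x => utri 0 (g1 x) 0) (fun x => utri 0 (g2 x) 0) H0 H1 su sv p1 p2) => //.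
- by move=> x; rewrite utri00.
- by move=> x; rewrite utri01.
- by move=> x; rewrite utri10.
- by move=> x; rewrite utri11.
- by move=> x a b _; exact: A1.
- by move=> x a b _; exact: A2.
- by move=> x a b _; exact: B1.
- by move=> x a b _; exact: B2.
- by move=> x a b x0; exact: H0sd.
- by move=> x a b x0; exact: H1sd.
- by move=> x; rewrite utri00 utri10 utri11.
- by move=> x; rewrite utri00 utri10 utri11.
- by move=> x; rewrite utri01.
- by move=> x; rewrite utri01.
by move=> x; rewrite -[LHS]/((starK su A C).1 x) AC.
Qed.

End Moves.

(** * The stalk at the point of z u *)

Section Quantum.
Variables (R : realType) (k : nat).
Local Notation K := (Cplx R).

Lemma Thmx_Tq (a : qpair R k k) : Thmx a = Tq k (pfun a.1) (pfun a.2).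
Proof. by apply: hmx_eq => x //=; rewrite /utri !raddf0. Qed.

Lemma hol_hmxP (A : hmx R) : hol_hmx A <-> sd_hmx A.
Proof.
split=> -[h1 h2]; split.
- by move=> x a b; apply: (proj1 (holoM_sdP _ (@openT _)) h1 x a b I).
- by move=> x a b; apply: (proj1 (holoM_sdP _ (@openT _)) h2 x a b I).
- by apply/(holoM_sdP _ (@openT _)) => x a b _; exact: h1.
- by apply/(holoM_sdP _ (@openT _)) => x a b _; exact: h2.
Qed.

Lemma honeE : @hone R = honeK K.
Proof. reflexivity. Qed.

Lemma starE s (A B : hmx R) : star s A B = starK s A B.
Proof. reflexivity. Qed.

Lemma star_invertibleP s (A : hmx R) : star_invertible s A <-> star_invertibleK s A.
Proof.
rewrite /star_invertible /star_invertibleK honeE.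
split=> -[h1 [B [h2 h3 h4]]].
  have h1' := proj1 (hol_hmxP A) h1.
  have h2' := proj1 (hol_hmxP B) h2.
  rewrite !starE in h3 h4.
  exact: (conj h1' (ex_intro _ B (And3 h2' h3 h4))).
have h1' := proj2 (hol_hmxP A) h1; have h2' := proj2 (hol_hmxP B) h2.
by rewrite -!starE in h3 h4; exact: (conj h1' (ex_intro _ B (And3 h2' h3 h4))).
Qed.

Lemma eqmod_u2P F G : @eqmod_u2 R F G <-> eqmodK F G.
Proof.
have oD := @open_neq0_fst K.
split=> -[H [h1 h2]]; exists H; split=> //.
- by move=> x x0 a b; exact: (proj1 (holoM_sdP _ oD) h1 x a b x0).
- by apply/(holoM_sdP _ oD) => x a b x0; exact: h1.
Qed.

Lemma qequivP s (a b : qpair R k k) : qequiv s a b <->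
  qequivK k (s true) (s false) (Tq k (pfun a.1) (pfun a.2)) (Tq k (pfun b.1) (pfun b.2)).
Proof.
rewrite -!Thmx_Tq.
split=> -[A [B [/star_invertibleP h1 /star_invertibleP h2 [/eqmod_u2P h3 /eqmod_u2P h4]]]];
  exists A, B; split=> //.
Qed.

Hypothesis k_gt2 : (2 < k)%N.
Implicit Types (p q : coefs R k k) (a b : qpair R k k) (s : chfun R).

Lemma nco_diag : (nco k k).+1 = k.
Proof. by rewrite /nco mul2n -addnn addnK subn1 prednK// (leq_trans _ k_gt2). Qed.

Lemma pfun_sum p x : pfun p x = (\sum_(1 <= m < k) coef_at p m * x.1 ^+ m) * x.2.
Proof. by rewrite /pfun sum_coef_at nco_diag. Qed.

Lemma sd_pfun p x : sd (pfun p) x.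
Proof. by rewrite (funext (pfun_sum p)); exact: (sd_coef_fun k (coef_at p) x). Qed.

Lemma pfunD p q e : pfun (q + e *: p) = (fun x => pfun q x + e * pfun p x).
Proof. by apply/funext => x; exact: sum_rowD. Qed.

Lemma pfunZ p e : pfun (e *: p) = (fun x => e * pfun p x).
Proof. by apply/funext => x; exact: sum_rowZ. Qed.

Lemma qequiv_refl s a : qequiv s a a.
Proof.
by apply/qequivP; apply: qequivK_refl => x x0; exact: (@sd_Tq K k _ _ x (sd_pfun _) x0).
Qed.

Lemma qequiv_shift s p p' e b : qequiv s (p, p') b -> qequiv s (p, p' + e *: p) b.
Proof.
move/qequivP => h; apply/qequivP; rewrite [pfun _ in X in qequivK _ _ _ X _]/= pfunD.
exact: (qequivK_shift e (sd_pfun _) (sd_pfun _) h).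
Qed.

Lemma qequiv_scale s p p' c b : c != 0 -> qequiv s (p, p') b -> qequiv s (c *: p, c *: p') b.
Proof.
move=> c0 /qequivP h; apply/qequivP; rewrite /= !pfunZ.
exact: (qequivK_scale c0 (sd_pfun _) (sd_pfun _) h).
Qed.

Lemma qclass_eq s a b : (forall d, qequiv s a d <-> qequiv s b d) -> qclass s a = qclass s b.
Proof.
move=> H; apply/seteqP; split => d [h1 h2]; first exact: (conj h1 (proj1 (H d) h2)).
exact: (conj h1 (proj2 (H d) h2)).
Qed.

Lemma qclass_shift s p p' e : qclass s (p, p' + e *: p) = qclass s (p, p').
Proof.
apply: qclass_eq => d; split; last exact: qequiv_shift.
by move/(@qequiv_shift s p (p' + e *: p) (- e) d); rewrite (scaleNr e p) (addrK (e *: p) p').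
Qed.

Lemma qclass_scale s p p' c : c != 0 -> qclass s (c *: p, p') = qclass s (p, c^-1 *: p').
Proof.
move=> c0; apply: qclass_eq => d; split.
  by move/(@qequiv_scale s _ _ c^-1 d (invr_neq0 c0)); rewrite (scalerK c0 p).
by move/(@qequiv_scale s _ _ c d c0); rewrite (scalerKV c0 p').
Qed.

Lemma ppoint_self n (p : 'rV[K]_n) : ppoint p p.
Proof. by exists 1; rewrite ?oner_eq0 ?scale1r. Qed.

(** A pair over the same point is (t p, q') with t != 0, and by [qclass_scale] it has the class of
    (p, t^-1 q'). *)
Lemma stalk_ppoint s p : MI R k k (ppoint p) ->
  stalk s (ppoint p) = [set qclass s (p, p') | p' in setT].
Proof.
move=> MIp; apply/seteqP; split => c.
  move=> [_ [[q q'] -> e]]; have [t t0 qt] : ppoint p q by rewrite e; exact: ppoint_self.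
  have e1 := qclass_scale s p q' t0; rewrite -qt in e1.
  exact: (ex_intro2 _ _ (t^-1 *: q') I (esym e1)).
move=> [p' _ <-]; split; first exact: (ex_intro2 _ _ (p, p') MIp erefl).
exact: (ex_intro2 _ _ (p, p') erefl erefl).
Qed.

Lemma poisson_sd s i x : poisson k s -> sd (s i) x.
Proof. by move=> [hs _]; apply: (proj1 (holo_sdP _ (@openT _)) (hs i)). Qed.

Lemma nco_gt0 : (0 < nco k k)%N.
Proof. by rewrite -ltnS nco_diag (leq_trans _ k_gt2). Qed.

(** The monomial z u: for j = k, entry 0 has the exponent k - k + 1 = 1. *)
Definition pdelta : coefs R k k := delta_mx 0 (Ordinal nco_gt0).

Lemma pfun_pdelta x : pfun pdelta x = x.1 * x.2.
Proof.
by rewrite /pfun sum_delta /= subrr add0r addr0 expr1z.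
Qed.

Lemma MI_pdelta : MI R k k (ppoint pdelta).
Proof.
split; first exact: dvdnn.
exists pdelta; split => //; first exact: delta_neq0.
have k1 : (1 < k)%N by apply: ltnW.
have t00 x : Tmx pdelta x 0 0 = x.1 ^+ k by exact: utri00.
have t01 x : Tmx pdelta x 0 1 = x.1 * x.2 by rewrite -pfun_pdelta; exact: utri01.
have t10 x : Tmx pdelta x 1 0 = 0 by exact: utri10.
have t11 x : Tmx pdelta x 1 1 = x.1 ^- k by exact: utri11.
exists 0%N, k.-1; split; [exact: h0_bidu|exact: h0_cech|].
by rewrite add0n addn1 prednK// ltnW.
Qed.

Lemma qequiv_pdelta s p' p'' : poisson k s -> qequiv s (pdelta, p') (pdelta, p'') ->
  forall i : 'I_(nco k k), (0 < i)%N -> p' 0 i = p'' 0 i.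
Proof.
move=> hs /qequivP h i i0; rewrite -!coef_atE; apply/esym.
apply: (qequivK_rigid (Cplx_model R) k_gt2 _ _ (proj2 hs) pfun_pdelta (pfun_sum _) (pfun_sum _) h).
- by move=> x; exact: poisson_sd.
- by move=> x; exact: poisson_sd.
- by rewrite ltnS i0 -[X in (_ < X)%N]nco_diag ltnS ltn_ord.
Qed.

Lemma rebel_pdelta s : poisson k s -> rebel s (ppoint pdelta).
Proof.
(* [nco k k] is k - 1, so this predecessor is positive exactly because 2 < k. *)
move=> hs; exists (nco k k).-1; first by rewrite -ltnS prednK ?nco_gt0// -ltnS nco_diag.
have [L [Lfull LE]] := drop_first_coef K (nco k k).
exists pdelta; first exact: erefl.
exists L; split; [exact: Lfull|exact: (stalk_ppoint s MI_pdelta)|].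
move=> p' p''; split.
  move=> e; apply/LE; have [_ h] : qclass s (pdelta, p') (pdelta, p'').
    rewrite e; split; [exact: MI_pdelta|exact: (qequiv_refl s (pdelta, p''))].
  exact: (qequiv_pdelta hs h).
move=> /LE H; have e := row_split (i0 := Ordinal nco_gt0) (erefl _) H.
rewrite e; exact: (qclass_shift s pdelta p'').
Qed.

End Quantum.

Theorem theorem9p10 (R : realType) (k : nat) (hk : (3 <= k)%N)
    (s : chfun R) (hs : poisson k s) :
  exists (j : nat) (P : set (coefs R k j)), MI R k j P /\ rebel s P.
Proof. by exists k, (ppoint (pdelta R hk)); split; [exact: MI_pdelta|exact: rebel_pdelta]. Qed.
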